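(* Let $a\in(0,1)$, $m\in\mathbb{N}$, let $P_m(z,a)$ be the best uniform approximation of $|x|$ by polynomials of degree not more than $2m$ on $[-1,-a]\cup[a,1]$, and let $L=L_m(a)$ be the approximation error. There is a curve $\gamma=\gamma_m(a)$ inside the half-strip $$\{w=u+iv:\ u\in(0,(m+1)\pi),\ v>0\}$$ such that the extremal polynomial possesses the representation $$P_m(z,a)=z+L\cos\phi_m(z,a)$$ for $z$ in the first quadrant, where $\phi_m(z,a)$ is the conformal map of the first quadrant onto the region in this half-strip bounded on the left by $\gamma_m(a)$, normalized by $\phi_m(a,a)=0$, $\phi_m(1,a)=(m+1)\pi$ and $\phi_m(\infty,a)=\infty$. Moreover, the curve $\gamma_m(a)$ is the image of the imaginary half-axis $\{iy:y>0\}$ under this conformal map and satisfies the following functional equation: $$\gamma_m(a)=\{u+iv=\phi_m(iy,a):\ L\sin u(y)\,\sinh v(y)=y,\ y>0\},$$ i.e. writing $\phi_m(iy,a)=u(y)+iv(y)$, one has $L\sin u(y)\sinh v(y)=y$ for all $y>0$.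
   Context: $L_m(a)=\inf_{\deg P\le 2m}\sup_{|x|\in[a,1]}\bigl||x|-P(x)\bigr|$, and $P_m(\cdot,a)$ is the (unique) polynomial of degree at most $2m$ attaining this infimum. The first quadrant is $\{z:\operatorname{Re}z>0,\operatorname{Im}z>0\}$; the conformal map $\phi_m(\cdot,a)$ is extended to the boundary of the quadrant. ''Bounded on the left by $\gamma$'' means that the region is the part of the half-strip lying to the right of $\gamma$. *)

(* Defs.v *)
From mathcomp Require Import all_boot all_order all_algebra.
From mathcomp Require Import complex.
From mathcomp Require Import all_classical all_reals all_analysis.

Set Implicit Arguments.
Unset Strict Implicit.
Unset Printing Implicit Defensive.

Import Order.TTheory GRing.Theory Num.Theory.
Import numFieldNormedType.Exports.

Local Open Scope classical_set_scope.
Local Open Scope ring_scope.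
Local Open Scope complex_scope.

Section Approximation.
Context {R : realType}.

Definition approx_error (a : R) (P : {poly R}) : R :=
  sup [set `| `|x| - P.[x] | | x in [set x : R | a <= `|x| <= 1]].

Definition L_ (m : nat) (a : R) : R :=
  inf [set approx_error a P | P in [set P : {poly R} | (size P <= (2 * m).+1)%N]].

Definition best_approx (m : nat) (a : R) (P : {poly R}) : Prop :=
  (size P <= (2 * m).+1)%N /\ approx_error a P = L_ m a.

End Approximation.

Section Complex.
Context {R : realType}.
(* [R[i]^o] rather than [R[i]]: the former carries the normed space structure. *)
Local Notation C := (R[i]^o).

Definition cexp (z : C) : C :=
  (expR (complex.Re z))%:C * (cos (complex.Im z) +i* sin (complex.Im z)).

Definition ccos (z : C) : C :=
  (cexp ((0 +i* 1 : C) * z) + cexp (- ((0 +i* 1 : C) * z))) / 2.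

Definition sinh (x : R) : R := (expR x - expR (- x)) / 2.

Definition ceval (P : {poly R}) (z : C) : C := (map_poly (real_complex R) P).[z].

(* [derivable f z 1] is taken over the field [C], so it is complex
   differentiability. *)
Definition conformal_map (D E : set C) (f : C -> C) : Prop :=
  (forall z, D z -> derivable f z 1) /\ set_bij D E f.

Definition first_quadrant : set C :=
  [set z | 0 < complex.Re z /\ 0 < complex.Im z].

Definition pos_imaginary_axis : set C := [set 0 +i* y | y in [set y : R | 0 < y]].

Definition half_strip (m : nat) : set C :=
  [set w | 0 < complex.Re w < m.+1%:R * pi /\ 0 < complex.Im w].

Definition right_side (m : nat) : set C :=
  [set (m.+1%:R * pi) +i* v | v in [set v : R | 0 < v]].

(* A simple arc in the half-strip joining a point of its left side to infinity:
   these are the curves that can bound a part of the half-strip on the left. *)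
Definition left_bounding_curve (m : nat) (gamma : set C) : Prop :=
  gamma `<=` half_strip m /\
  exists (g : R -> C) (v0 : R),
    [/\ {in `]0, +oo[, continuous g},
        set_bij [set t | 0 < t] gamma g,
        0 <= v0,
        g t @[t --> 0^'+] --> (0 +i* v0 : C)
      & Normc.normc (g t) @[t --> +oo] --> +oo].

(* The complement of such a curve in the half-strip has two components; the one
   lying to the right is the one that abuts on the right side. *)
Definition right_region (m : nat) (gamma : set C) : set C :=
  [set w | (half_strip m `\` gamma) w /\
           right_side m `<=`
             closure (connected_component (half_strip m `\` gamma) w)].

(* [phi] is given on the closed quadrant: conformal inside and continuous up to
   the boundary, with [phi z] tending to infinity as [z] does. *)
Definition normalized_conformal_map (m : nat) (a : R) (gamma : set C)
    (phi : C -> C) : Prop :=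
  [/\ conformal_map first_quadrant (right_region m gamma) phi,
      {within closure first_quadrant, continuous phi},
      phi a%:C = 0,
      phi 1 = (m.+1%:R * pi)%:C
    & forall M : R, exists K : R, forall z, closure first_quadrant z ->
        K < Normc.normc z -> M < Normc.normc (phi z)].

End Complex.

(* Main.v *)
Require Import Defs.
From mathcomp Require Import all_boot all_order all_algebra.
From mathcomp Require Import complex polyrcf polyorder.
From mathcomp Require Import all_classical all_reals all_analysis.
From mathcomp Require Import ring lra zify.
Import Order.TTheory GRing.Theory Num.Theory.
Import numFieldNormedType.Exports.
Local Open Scope classical_set_scope.
Local Open Scope ring_scope.
Local Open Scope complex_scope.

(** Write [D z = P z - z], let [L] be the error and let [Q] be the open first
    quadrant.  The even part of [P] is again extremal, and Chebyshev's
    alternation argument for even polynomials gives nodes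
    [a = x 0 < ... < x (m+1) = 1] with [D (x j) = (-1)^j L], while [`|D| <= L] on
    [[a, 1]].  Two polynomials that both attain the error agree at the nodes and
    at their opposites, so [P] itself is even.  On [[a, 1]] the function [D]
    oscillates between [L] and [- L] exactly as [L cos] does on
    [[0, (m+1) pi]], and the map [phi] is the matching branch of
    [arccos (D / L)].

    The branch exists on [Q].  As [P] is even, it is real on the imaginary axis
    and its derivative is imaginary there; hence [Im D (iy) = - y] and
    [Re D' (iy) = -1].  A polynomial whose values on the imaginary axis lie in a
    half-plane turns by at most half a revolution along it, which bounds the
    number of its zeros to the right of the axis.  The argument of a product of
    linear factors along the axis is a sum of arctangents, one per root, so this
    argument principle is elementary: [size_right_roots_1], [size_right_roots_2].
    It leaves at most [m] zeros of [D'] with positive real part and at most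
    [m + 1] solutions of [D = s].  The alternation exhibits that many on the
    real axis: [D'] vanishes at the interior nodes, and for [`|s| < L] the
    equation [D = s] is solved between consecutive nodes.  So [D] avoids the
    segment [[- L, L]] on [Q] ([deviation_quadrant]).  Hence [L^2 - D^2] has a
    continuous square root [S] on the closed quadrant, [(D + i S) / L] has a
    continuous logarithm, and [- i] times it is a continuous [phi] with
    [L cos phi = D] ([arccosine_lift], [normalized_lift_exists]).

    On the boundary, [Re phi] is [0] on [[0, a]], equals [j pi] at [x j] and
    [(m+1) pi] from [1] on, because [sin (Re phi)] vanishes where [D] is real
    with [`|D| >= L] and because the sign of [D'] between two nodes decides the
    direction in which the branch moves.  On the imaginary axis the equation
    [Im D (iy) = - y] reads [L sin u sinh v = y], which forces [0 < u < pi].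

    The rest is topology.  The map [phi] is open on [Q], since [D] is open and
    [cos] is locally injective off the real axis, and it is proper, since [D] is.
    Therefore a connected set that meets [phi Q] and avoids the image of the
    boundary of [Q] lies in [phi Q].  A point of [phi Q] beside the half-strip
    would bring with it a half-plane or quadrant of values on which [cos] takes
    a value infinitely often, whereas [D] takes it finitely often
    ([lift_half_strip]).  Distinct points with the same image make the divided
    difference of [D] vanish; conversely a zero of the divided difference on the
    diagonal is a zero of [D'], hence a node.  So the coincidences of [phi] form a
    closed set whose image is open as well.  Following it down the imaginary
    axis shows that [phi Q] is disjoint from the curve ([imaginary_not_image]),
    and following it to the right side of the half-strip shows that [phi] is
    injective ([lift_injective]).  Finally [phi Q] is connected, relatively open
    and closed in the half-strip minus the curve, and abuts on the right side
    ([right_region_image]).  Complex differentiability follows from continuity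
    by dividing increments of [L cos phi = D], since [cos'] is not zero off the
    real axis. *)

Set Implicit Arguments.
Unset Strict Implicit.
Unset Printing Implicit Defensive.

(** * Topology of the complex plane *)

Section ComplexPlane.
Context {R : realType}.
Local Notation C := (R[i]^o).
Local Notation normc := (@Normc.normc R).
Local Notation Re := (@complex.Re R).
Local Notation Im := (@complex.Im R).

Lemma ReB (z w : C) : Re (z - w) = Re z - Re w.
Proof. by case: z w => [? ?] []. Qed.

Lemma ImB (z w : C) : Im (z - w) = Im z - Im w.
Proof. by case: z w => [? ?] []. Qed.

Lemma normcE_sqrt (z : C) : normc z = Num.sqrt (Re z ^+ 2 + Im z ^+ 2).
Proof. by case: z. Qed.

Lemma normc_ge0 (z : C) : 0 <= normc z.
Proof. by rewrite normcE_sqrt sqrtr_ge0. Qed.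

Lemma abs_Re_le (z : C) : `|Re z| <= normc z.
Proof.
by rewrite normcE_sqrt -sqrtr_sqr ler_wsqrtr// lerDl sqr_ge0.
Qed.

Lemma abs_Im_le (z : C) : `|Im z| <= normc z.
Proof.
by rewrite normcE_sqrt -sqrtr_sqr ler_wsqrtr// lerDr sqr_ge0.
Qed.

Lemma normc_le (z : C) : normc z <= `|Re z| + `|Im z|.
Proof.
rewrite normcE_sqrt -(ger0_norm (addr_ge0 (normr_ge0 (Re z)) (normr_ge0 (Im z)))).
rewrite -sqrtr_sqr ler_wsqrtr// sqrrD !real_normK ?num_real//.
by rewrite [leRHS]addrAC lerDl mulrn_wge0// mulr_ge0.
Qed.

(** The norm of the complex numbers takes complex values, so that its balls have
    complex radii; all estimates below use the real-valued modulus instead. *)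
Lemma nbhs_complexP (z : C) (A : set C) :
  nbhs z A <-> exists2 e : R, 0 < e & forall w, normc (w - z) < e -> A w.
Proof.
have E (x y : C) (e : R) : ball x e%:C y = (normc (y - x) < e) :> Prop.
  rewrite -ball_normE /ball_ /=.
  rewrite distrC (_ : `|y - x| = (normc (y - x))%:C)//.
  by rewrite ltcR.
split=> [/nbhs_ballP[e /= e0 eA]|[e e0 eA]].
  have He : e = (Re e)%:C by rewrite RRe_real// gtr0_real.
  exists (Re e); first by move: e0; rewrite He ltcR.
  by move=> w; rewrite -E -He => /eA.
apply/nbhs_ballP; exists e%:C => /=; first by rewrite ltcR.
by move=> w; rewrite E => /eA.
Qed.

Lemma cvg_complexP T (F : set_system T) {FF : Filter F} (f : T -> C) (l : C) :
  f @ F --> l <->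
  (Re (f x) @[x --> F] --> Re l) /\ (Im (f x) @[x --> F] --> Im l).
Proof.
split=> [fl|[fr fi]].
  split; apply/cvgrPdist_lt => e e0.
    have /(fl _) : nbhs l [set w : C | `|Re l - Re w| < e].
      apply/nbhs_complexP; exists e => // w.
      apply: le_lt_trans; rewrite distrC.
      by move: (abs_Re_le (w - l)); case: w l {fl} => ? ? [].
    exact.
  have /(fl _) : nbhs l [set w : C | `|Im l - Im w| < e].
    apply/nbhs_complexP; exists e => // w.
    apply: le_lt_trans; rewrite distrC.
    by move: (abs_Im_le (w - l)); case: w l {fl} => ? ? [].
  exact.
move=> A /nbhs_complexP[e e0 eA].
have e2 : 0 < e / 2 by rewrite divr_gt0.
move/cvgrPdist_lt : fr => /(_ _ e2) fr.
move/cvgrPdist_lt : fi => /(_ _ e2) fi.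
apply: filterS2 fr fi => x hr hi; apply: eA.
rewrite (le_lt_trans (normc_le _))// (splitr e) ltrD//.
  by move: hr; rewrite distrC; case: (f x) l {hi} => ? ? [].
by move: hi; rewrite distrC; case: (f x) l {hr} => ? ? [].
Qed.

Lemma cvg_real_complex T (F : set_system T) {FF : Filter F} (f : T -> R) (a : R) :
  f @ F --> a -> ((fun x => (f x)%:C) : T -> C) @ F --> (a%:C : C).
Proof. by move=> fa; apply/cvg_complexP; split => //=; exact: cvg_cst. Qed.

Lemma cvg_normc T (F : set_system T) {FF : Filter F} (f : T -> C) (l : C) :
  f @ F --> l -> normc (f x) @[x --> F] --> normc l.
Proof.
move=> fl; apply/cvgrPdist_lt => e e0.
have /(fl _) : nbhs l [set w : C | `|normc l - normc w| < e].
  apply/nbhs_complexP; exists e => // w wl.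
  rewrite /= (le_lt_trans _ wl)// ler_norml.
  have h1 := le_normcD (l - w) w; have h2 := le_normcD (w - l) l.
  have h3 : normc (l - w) = normc (w - l) by rewrite -normcN opprB.
  by rewrite !subrK in h1 h2; rewrite h3 in h1; apply/andP; split; lra.
exact.
Qed.

Section ContinuousAt.
Variables (T : topologicalType) (x : T).

(** The combinators below are phrased with [continuous_at], for which the filter
    and the limit are determined by the goal: for raw limits of functions into the
    complex numbers both have to be supplied by hand. *)
Lemma cts_cst (c : C) : continuous_at x (fun=> c).
Proof. exact: cvg_cst. Qed.

Lemma ctsD (f g : T -> C) : continuous_at x f -> continuous_at x g ->
  continuous_at x (fun t => f t + g t).
Proof. by move=> fx gx; apply: (@cvgD R[i] C T (nbhs x) _ f g _ _ fx gx). Qed.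

Lemma ctsN (f : T -> C) : continuous_at x f -> continuous_at x (fun t => - f t).
Proof. by move=> fx; apply: (@cvgN R[i] C T (nbhs x) _ f _ fx). Qed.

Lemma ctsB (f g : T -> C) : continuous_at x f -> continuous_at x g ->
  continuous_at x (fun t => f t - g t).
Proof. by move=> fx gx; exact: (ctsD fx (ctsN gx)). Qed.

Lemma ctsM (f g : T -> C) : continuous_at x f -> continuous_at x g ->
  continuous_at x (fun t => f t * g t).
Proof. by move=> fx gx; apply: (@cvgM R[i] T (nbhs x) _ f g _ _ fx gx). Qed.

Lemma ctsV (f : T -> C) : f x != 0 -> continuous_at x f ->
  continuous_at x (fun t => (f t)^-1).
Proof. by move=> f0 fx; apply: (@cvgV R[i] T (nbhs x) _ f _ f0 fx). Qed.

Lemma cts_sum (n : nat) (f : nat -> T -> C) :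
    (forall k, (k < n)%N -> continuous_at x (f k)) ->
  continuous_at x (fun t => \sum_(0 <= k < n) f k t).
Proof.
elim: n => [_|n IH h].
  have -> : (fun t => \sum_(0 <= k < 0) f k t) = (fun=> 0).
    by apply/funext => t; rewrite big_geq.
  exact: cts_cst.
have -> : (fun t => \sum_(0 <= k < n.+1) f k t) =
          (fun t => \sum_(0 <= k < n) f k t + f n t).
  by apply/funext => t; rewrite big_nat_recr.
by apply: ctsD; [apply: IH => k kn; apply: h; exact: ltnW|exact: h].
Qed.

Lemma cts_real_complex (f : T -> R) : continuous_at x f ->
  continuous_at x (fun t => (f t)%:C : C).
Proof. by move=> fx; apply: (@cvg_real_complex T (nbhs x) _ f _ fx). Qed.

Lemma cts_Re (f : T -> C) : continuous_at x f -> continuous_at x (fun t => Re (f t)).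
Proof. by move=> fx; have [] := (@cvg_complexP T (nbhs x) _ f (f x)).1 fx. Qed.

Lemma cts_Im (f : T -> C) : continuous_at x f -> continuous_at x (fun t => Im (f t)).
Proof. by move=> fx; have [] := (@cvg_complexP T (nbhs x) _ f (f x)).1 fx. Qed.

Lemma cts_complex (f g : T -> R) : continuous_at x f -> continuous_at x g ->
  continuous_at x (fun t => f t +i* g t : C).
Proof. by move=> fx gx; apply: ((@cvg_complexP T (nbhs x) _ (fun t => f t +i* g t) (f x +i* g x)).2 (conj fx gx)). Qed.

Lemma cts_scale (g : T -> R) (c : R) :
  continuous_at x g -> continuous_at x (fun t => c * g t).
Proof. by move=> gx; apply: (@cvgM R T (nbhs x) _ (fun=> c) g _ _ _ gx); exact: cvg_cst. Qed.

Lemma cts_normc (f : T -> C) : continuous_at x f -> continuous_at x (fun t => normc (f t)).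
Proof. by move=> fx; apply: (@cvg_normc T (nbhs x) _ f _ fx). Qed.

End ContinuousAt.

Lemma cts_id (T : topologicalType) (x : T) : continuous_at x (fun t : T => t).
Proof. exact: cvg_id. Qed.

Lemma cts_fst (T U : topologicalType) (p : T * U) : continuous_at p (fst : T * U -> T).
Proof. exact: cvg_fst. Qed.

Lemma cts_snd (T U : topologicalType) (p : T * U) : continuous_at p (snd : T * U -> U).
Proof. exact: cvg_snd. Qed.

Lemma cts_comp (T U V : topologicalType) (f : T -> U) (g : U -> V) (x : T) :
  continuous_at x f -> continuous_at (f x) g -> continuous_at x (fun t => g (f t)).
Proof. exact: continuous_comp. Qed.

Lemma cts_near_eq (f g : C -> C) (z : C) (e : R) : 0 < e ->
    (forall w, normc (w - z) < e -> f w = g w) ->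
  continuous_at z f -> continuous_at z g.
Proof.
move=> e0 fg fz A; have -> : g z = f z by rewrite fg// subrr Normc.normc0.
move=> /fz /nbhs_complexP[d d0 dA]; apply/nbhs_complexP.
exists (Num.min d e); first by rewrite lt_min d0.
by move=> w; rewrite lt_min => /andP[wd we] /=; rewrite -fg//; exact: dA.
Qed.

Lemma convex_connected (A : set C) :
  (forall (x y : C) (t : R), A x -> A y -> 0 <= t <= 1 ->
     A (x + t%:C * (y - x))) -> connected A.
Proof.
move=> cA.
have [[x Ax]|] := pselect (A !=set0); last first.
  by move/set0P/negP/negPn/eqP => ->; exact: connected0.
pose seg (y : C) := [set x + t%:C * (y - x) | t in `[0 : R, 1]].
have -> : A = \bigcup_(y in A) seg y.
  apply/seteqP; split=> [y Ay|_ [y Ay] [t /= + <-]].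
    by exists y => //; exists 1; [rewrite /= in_itv /= ler01 lexx|rewrite mul1r addrC subrK].
  by rewrite in_itv /= => ht; exact: cA.
apply: bigcup_connected.
  by exists x => y Ay; exists 0; [rewrite /= in_itv /= lexx ler01|rewrite mul0r addr0].
move=> y Ay; apply: connected_continuous_connected.
  exact: segment_connected.
apply: continuous_subspaceT => t.
apply: ctsD; first exact: cts_cst.
by apply: ctsM; [apply: cts_real_complex; exact: cts_id|exact: cts_cst].
Qed.

(** The form of the connectedness argument used throughout: a set that is open
    and one that is closed need only have the same trace on [A]. *)
Lemma connected_clopen_sub (T : topologicalType) (A U F : set T) :
  connected A -> open U -> closed F -> A `&` U = A `&` F ->
  A `&` U !=set0 -> A `<=` U.
Proof.
move=> cA oU cF AUF AU0; rewrite -(cA _ AU0); first exact: subIsetr.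
  by exists U.
by exists F.
Qed.

Lemma compact_box (a b c d : R) :
  compact [set z : C | a <= Re z <= b /\ c <= Im z <= d].
Proof.
have -> : [set z : C | a <= Re z <= b /\ c <= Im z <= d] =
    (fun p : R * R => (p.1 +i* p.2 : C)) @` (`[a, b] `*` `[c, d]).
  apply/seteqP; split=> [[x y] /= [hx hy]|_ [[x y] /= [hx hy] <-]] /=.
    by exists (x, y) => //=; rewrite !in_itv.
  by move: hx hy; rewrite !in_itv.
apply: continuous_compact; last by apply: compact_setX; exact: segment_compact.
apply: continuous_subspaceT => p.
by apply/cvg_complexP; split => /=; [exact: cvg_fst|exact: cvg_snd].
Qed.

End ComplexPlane.

(** * Counting zeros in the right half-plane *)

Section RootCount.
Context {R : realType}.
Local Notation C := (R[i]^o).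
Local Notation Re := (@complex.Re R).
Local Notation Im := (@complex.Im R).

Definition cis (t : R) : C := cos t +i* sin t.

Lemma cisD (s t : R) : cis (s + t) = cis s * cis t.
Proof. by rewrite /cis cosD sinD; congr (_ +i* _); rewrite addrC. Qed.

Lemma cis0 : cis 0 = 1.
Proof. by rewrite /cis cos0 sin0. Qed.

Lemma cisDpi (t : R) : cis (t + pi) = - cis t.
Proof. by rewrite /cis cosDpi sinDpi. Qed.

Lemma cisBpi (t : R) : cis (t - pi) = - cis t.
Proof. by rewrite -[in RHS](subrK pi t) cisDpi opprK. Qed.

Lemma cis_atan (x : R) :
  (1 +i* x : C) = (Num.sqrt (1 + x ^+ 2))%:C * cis (atan x).
Proof.
have s0 : 0 < Num.sqrt (1 + x ^+ 2).
  by rewrite sqrtr_gt0 ltr_wpDr// sqr_ge0.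
have ca := cos_atan x.
have c0 : cos (atan x) != 0 by rewrite ca invr_eq0 gt_eqF.
have sa : sin (atan x) = x * cos (atan x).
  by transitivity (tan (atan x) * cos (atan x)); [rewrite /tan divfK|rewrite atanK].
rewrite /cis sa ca; simpc.
by rewrite !mulrA mulrAC divff ?gt_eqF// mul1r.
Qed.

(** For [Re rho != 0], this is the argument of [iy - rho] up to a constant
    multiple of [pi], in the branch that is continuous along the whole axis. *)
Definition turn (rho : C) (y : R) : R := atan ((y - Im rho) / - Re rho).

(** The real factor [- Re rho * r] may be negative: only the direction of the line
    through the origin is followed, which is what makes [turn] continuous. *)
Lemma sub_turn (rho : C) (y : R) : Re rho != 0 -> exists2 r : R, 0 < r &
  (0 +i* y : C) - rho = (- Re rho * r)%:C * cis (turn rho y).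
Proof.
move=> rho0; pose x := (y - Im rho) / - Re rho.
exists (Num.sqrt (1 + x ^+ 2)); first by rewrite sqrtr_gt0 ltr_wpDr// sqr_ge0.
rewrite rmorphM /= -mulrA -cis_atan.
have xE : x * - Re rho = y - Im rho by rewrite /x divfK// oppr_eq0.
move: x xE => x; case: rho {rho0} => p q /= xE.
by apply/eqP; rewrite eq_complex /=; apply/andP; split; apply/eqP; [ring|lra].
Qed.

Lemma prod_sub_turn (rs : seq C) (y : R) : all (fun rho => Re rho != 0) rs ->
  exists2 r : R, 0 < r & \prod_(rho <- rs) ((0 +i* y : C) - rho) =
    (\prod_(rho <- rs) (- Re rho) * r)%:C * cis (\sum_(rho <- rs) turn rho y).
Proof.
elim: rs => [_|rho rs IH /= /andP[rho0 /IH[r r0 E]]].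
  by exists 1; rewrite ?big_nil ?ltr01// cis0 !mulr1.
have [r' r'0 E'] := sub_turn y rho0.
exists (r' * r); first exact: mulr_gt0.
by rewrite !big_cons E E' cisD !rmorphM /=; ring.
Qed.

Lemma turn_continuous (rho : C) : continuous (turn rho).
Proof.
move=> y; apply: continuous_comp; last exact: continuous_atan.
by apply: cvgM; [apply: cvgB => //; exact: cvg_cst|exact: cvg_cst].
Qed.

Lemma sum_turn_continuous (rs : seq C) :
  continuous (fun y => \sum_(rho <- rs) turn rho y).
Proof.
move=> y; elim: rs => [|rho rs IH].
  under eq_fun do rewrite big_nil.
  exact: cvg_cst.
under eq_fun do rewrite big_cons.
by apply: cvgD => //; exact: turn_continuous.
Qed.

Lemma Im_mul_real (c z : C) (u : R) : Im (c * (u%:C * z)) = u * Im (c * z).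
Proof. by case: c z => [? ?] [? ?] /=; ring. Qed.

(** On a stretch of the imaginary axis where the polynomial stays strictly on one
    side of the real line its argument varies by at most [pi]. *)
Lemma sum_turn_bounded (c : C) (rs : seq C) (s y1 y2 : R) :
    all (fun rho => Re rho != 0) rs -> y1 <= y2 ->
    (forall y, y1 <= y <= y2 ->
       0 < s * Im (c * \prod_(rho <- rs) ((0 +i* y : C) - rho))) ->
  `|\sum_(rho <- rs) turn rho y2 - \sum_(rho <- rs) turn rho y1| <= pi.
Proof.
move=> rs0 y12 hs; set T := fun y => \sum_(rho <- rs) turn rho y.
rewrite -/(T y1) -/(T y2).
(* If the argument moved by more than pi, it would pass exactly pi away from its
   initial value, where the imaginary part has the opposite sign. *)
suff noflip y : y1 <= y <= y2 -> cis (T y) <> - cis (T y1).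
  have cT : {within `[y1, y2], continuous T}.
    by apply: continuous_subspaceT; exact: sum_turn_continuous.
  rewrite leNgt; apply/negP => big.
  have [Tle|Tlt] := leP (T y1) (T y2).
    rewrite ger0_norm ?subr_ge0// in big.
    have [|y yin] := @IVT R T y1 y2 (T y1 + pi) y12 cT.
      by have := @pi_ge0 R; rewrite ge_min le_max; lra.
    by move=> Ty; apply: (noflip y); [move: yin; rewrite in_itv|rewrite Ty cisDpi].
  rewrite ltr0_norm ?subr_lt0// in big.
  have [|y yin] := @IVT R T y1 y2 (T y1 - pi) y12 cT.
    by have := @pi_ge0 R; rewrite ge_min le_max; lra.
  by move=> Ty; apply: (noflip y); [move: yin; rewrite in_itv|rewrite Ty cisBpi].
move=> yin E.
have := hs y yin; have := hs y1; rewrite lexx y12 => /(_ isT).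
have [r r0 ->] := prod_sub_turn y rs0.
have [r1 r10 ->] := prod_sub_turn y1 rs0.
rewrite -/(T y) -/(T y1) E; set k := \prod_(_ <- _) _.
rewrite !Im_mul_real mulrN raddfN /= => h1 h2.
move: (Im _) (k : R) h1 h2 => X {}k h1 h2.
have {}h1 : 0 < s * k * X.
  suff : 0 < r1 * (s * k * X) by rewrite pmulr_rgt0.
  by rewrite [r1 * _](_ : _ = s * (k * r1 * X))//; ring.
move: h2; have -> : s * (k * r * - X) = - (r * (s * k * X)) by ring.
by rewrite oppr_gt0 ltNge mulr_ge0// ltW.
Qed.

Lemma cvgy_atan_affine (b k : R) : 0 < k ->
  atan ((y - b) / k) @[y --> +oo] --> pi / 2.
Proof.
move=> k0.
apply: (cvg_comp (fun y : R => (y - b) / k) (@atan R)); last exact: cvgy_atan.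
apply/cvgryPge => A.
near=> y.
rewrite ler_pdivlMr// lerBrDr.
by near: y; apply: nbhs_pinfty_ge; rewrite num_real.
Unshelve. all: by end_near. Qed.

(** A root on the left is passed anticlockwise and a root on the right clockwise,
    each contributing half a revolution. *)
Lemma cvgy_turn (rho : C) : Re rho != 0 ->
  turn rho y - turn rho (- y) @[y --> +oo] -->
    if Re rho < 0 then pi else - pi.
Proof.
move=> rho0.
(* Reflection in the imaginary axis exchanges the two cases. *)
wlog neg : rho rho0 / Re rho < 0 => [hw|].
  have [neg|pos] := boolP (Re rho < 0); first by have := hw _ rho0 neg; rewrite neg.
  have /hw : Re (- rho^*%C) != 0 by case: rho rho0 {pos} => /= p q; rewrite oppr_eq0.
  have -> : Re (- rho^*%C) < 0.
    by case: rho rho0 pos => /= p q p0 np; rewrite oppr_lt0 lt_def p0 leNgt.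
  move=> /(_ isT) h.
  apply: cvg_trans (cvgN h); apply: near_eq_cvg; near=> y => /=.
  case: rho rho0 {pos h} => p q /= p0; rewrite opprfctE /turn /=.
  have -> (z : R) : (z - - - q) / - - p = - ((z - q) / - p) by field.
  have -> (z : R) : (z - - - q) / - - p = - ((z - q) / - p) by field.
  by rewrite !atanN; ring.
have k0 : 0 < - Re rho by rewrite oppr_gt0.
rewrite neg.
have -> : (pi : R) = pi / 2 - - (pi / 2) by field.
apply: cvgB; first exact: cvgy_atan_affine.
apply: cvg_trans (cvgN (cvgy_atan_affine (- Im rho) k0)); apply: near_eq_cvg; near=> y => /=.
rewrite opprfctE -atanN /turn; congr atan.
by rewrite opprK -mulNr opprD.
Unshelve. all: by end_near. Qed.

Lemma cvgy_sum_turn (rs : seq C) : all (fun rho => Re rho != 0) rs ->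
  (\sum_(rho <- rs) turn rho y - \sum_(rho <- rs) turn rho (- y))
    @[y --> +oo] -->
  ((count (fun rho => Re rho < 0) rs)%:R
    - (count (fun rho => 0 < Re rho) rs)%:R) * (pi : R).
Proof.
elim: rs => [_|rho rs IH /= /andP[rho0 /IH {}IH]].
  under eq_fun do rewrite !big_nil subrr.
  by rewrite subrr mul0r; exact: cvg_cst.
under eq_fun do rewrite !big_cons opprD addrACA.
have -> : (((Re rho < 0)%R + count (fun rho => Re rho < 0)%R rs)%N%:R -
    ((0 < Re rho)%R + count (fun rho => 0 < Re rho)%R rs)%N%:R) * pi =
    (if Re rho < 0 then pi else - pi) +
    ((count (fun rho => Re rho < 0) rs)%:R
      - (count (fun rho => 0 < Re rho) rs)%:R) * pi :> R.
  by rewrite !natrD; have [neg|pos|z] := ltgtP (Re rho) 0;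
    [rewrite /=; ring|rewrite /=; ring|rewrite z eqxx in rho0].
by apply: cvgD => //; exact: cvgy_turn.
Qed.

(** An argument principle: the total turn along the axis is [pi] times the excess
    of left roots over right roots. *)
Lemma count_right_half_plane (rs : seq C) (M : nat) :
    all (fun rho => Re rho != 0) rs ->
    (forall y, 0 < y -> `|\sum_(rho <- rs) turn rho y
                        - \sum_(rho <- rs) turn rho (- y)| <= M%:R * pi) ->
  (count (fun rho => 0 < Re rho)%R rs <=
     count (fun rho => Re rho < 0)%R rs + M)%N.
Proof.
move=> rs0 hM; have := cvgy_sum_turn rs0.
set l := _ * _ => cl.
have : - (M%:R * pi) <= l.
  apply: (@closed_cvg _ _ _ _ _ (fun x => - (M%:R * pi) <= x) _ _ _ cl).
    exact: closed_ge.
  near=> y; rewrite /=.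
  have /hM : 0 < y by near: y; apply: nbhs_pinfty_gt; rewrite num_real.
  by rewrite ler_norml => /andP[].
by rewrite /l -mulNr ler_pM2r ?pi_gt0// lerBrDl lerBlDr -natrD ler_nat.
Unshelve. all: by end_near. Qed.

Lemma poly_roots_seq (p : {poly C}) : p != 0 ->
  exists2 rs : seq C, (size rs).+1 = size p &
    (forall z, p.[z] = lead_coef p * \prod_(rho <- rs) (z - rho)) /\
    (forall z, root p z = (z \in rs)).
Proof.
move=> p0; have [rs E] := @closed_field_poly_normal R[i] p.
have l0 : lead_coef p != 0 by rewrite lead_coef_eq0.
exists rs; first by rewrite E size_scale// size_prod_XsubC.
split=> z; first by rewrite {1}E hornerZ horner_prod; under eq_bigr do rewrite hornerXsubC.
by rewrite E rootZ// root_prod_XsubC.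
Qed.

(** Since left and right roots together number [size p - 1], a bound on their
    difference bounds the right ones.  Multiplicities work in favour of the
    inequality, so that any list of distinct right roots may be counted. *)
Lemma size_right_roots (p : {poly C}) (M : nat) (t : seq C) : p != 0 ->
    (forall y, p.[0 +i* y] != 0) ->
    (forall rs, (forall z, root p z = (z \in rs)) ->
      (forall z, p.[z] = lead_coef p * \prod_(rho <- rs) (z - rho)) ->
      forall y, 0 < y -> `|\sum_(rho <- rs) turn rho y
                        - \sum_(rho <- rs) turn rho (- y)| <= M%:R * pi) ->
    uniq t -> {in t, forall z, root p z /\ 0 < Re z} ->
  ((size t).*2 < size p + M)%N.
Proof.
move=> p0 pi0 hM ut ht.
have [rs srs [pE rsE]] := poly_roots_seq p0.
have rs0 : all (fun rho => Re rho != 0) rs.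
  apply/allP => rho; rewrite -rsE => /eqP r0; apply/eqP => re0.
  by move: (pi0 (Im rho)); rewrite -re0 (_ : _ +i* _ = rho) ?r0 ?eqxx//; case: rho {r0 re0}.
have cle := count_right_half_plane rs0 (hM rs rsE pE).
have tle : (size t <= count (fun rho => 0 < Re rho)%R rs)%N.
  rewrite -size_filter uniq_leq_size// => z zt.
  by have [rz z0] := ht _ zt; rewrite mem_filter z0 -rsE.
have csum : (count (fun rho => 0 < Re rho)%R rs + count (fun rho => Re rho < 0)%R rs = size rs)%N.
  rewrite -(count_predC (fun rho => 0 < Re rho)%R rs); congr addn.
  apply: eq_in_count => z zrs /=; rewrite -leNgt lt_neqAle.
  by move/allP : rs0 => /(_ _ zrs) ->.
rewrite -srs; lia.
Qed.

(** Applied to [i D'], whose imaginary part on the axis is constantly [-1]. *)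
Lemma size_right_roots_1 (p : {poly C}) (s : R) (t : seq C) :
    (forall y, 0 < s * Im p.[0 +i* y]) ->
    uniq t -> {in t, forall z, root p z /\ 0 < Re z} ->
  ((size t).*2 <= size p)%N.
Proof.
move=> hs ut ht.
have nz y : p.[0 +i* y] != 0.
  by apply/eqP => E; have := hs y; rewrite E /= mulr0 ltxx.
rewrite -ltnS -[(size p).+1]addn1; apply: size_right_roots => //.
  by apply/eqP => E; have := nz 0; rewrite E horner0 eqxx.
move=> rs rsE pE y y0; rewrite mul1r.
apply: (@sum_turn_bounded (lead_coef p) rs s (- y) y).
- apply/allP => rho; rewrite -rsE => /eqP r0; apply/eqP => re0.
  by move: (nz (Im rho)); rewrite -re0 (_ : _ +i* _ = rho) ?r0 ?eqxx//; case: rho {r0 re0}.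
- by rewrite ge0_cp// ltW.
- by move=> t' _; rewrite -pE.
Qed.

(** Applied to [D - s], whose imaginary part on the axis is [- y]: the values cross
    the real line once, at the origin, which allows one half turn for each half
    of the axis. *)
Lemma size_right_roots_2 (p : {poly C}) (s s' : R) (t : seq C) : p.[0] != 0 ->
    (forall y, 0 < y -> 0 < s * Im p.[0 +i* y]) ->
    (forall y, y < 0 -> 0 < s' * Im p.[0 +i* y]) ->
    uniq t -> {in t, forall z, root p z /\ 0 < Re z} ->
  ((size t).*2 <= (size p).+1)%N.
Proof.
move=> p00 hs hs' ut ht.
have nz y : p.[0 +i* y] != 0.
  have [y0|y0|->//] := ltgtP y 0.
    by apply/eqP => E; have := hs' y y0; rewrite E /= mulr0 ltxx.
  by apply/eqP => E; have := hs y y0; rewrite E /= mulr0 ltxx.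
rewrite -ltnS -[(size p).+2]addn2; apply: size_right_roots => //.
  by apply/eqP => E; have := nz 0; rewrite E horner0 eqxx.
move=> rs rsE pE y y0.
have rs0 : all (fun rho => Re rho != 0) rs.
  apply/allP => rho; rewrite -rsE => /eqP r0; apply/eqP => re0.
  by move: (nz (Im rho)); rewrite -re0 (_ : _ +i* _ = rho) ?r0 ?eqxx//; case: rho {r0 re0}.
set T := fun y => \sum_(rho <- rs) turn rho y.
(* The bound holds on [z e, z] for 0 < e < 1, and e is sent to 0. *)
have near0 (z : R) : z != 0 -> `|T z - T 0| <= pi.
  move=> z0.
  have cT : (fun e => `|T z - T (z * e)|) e @[e --> 0^'+] --> `|T z - T 0|.
    apply: cvg_at_right_filter; apply: cvg_norm; apply: cvgB; first exact: cvg_cst.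
    rewrite -[X in T X](mulr0 z).
    apply: (@continuous_comp _ _ _ (fun e => z * e) T); last exact: sum_turn_continuous.
    by apply: cvgM => //; exact: cvg_cst.
  apply: (@closed_cvg _ _ _ _ _ (fun x => x <= pi) _ _ _ cT).
    exact: closed_le.
  near=> e; rewrite /=.
  have e0 : 0 < e by [].
  have e1 : e < 1 by [].
  have [zneg|zpos|/eqP] := ltgtP z 0; last by rewrite (negPf z0).
    rewrite distrC; apply: (@sum_turn_bounded (lead_coef p) rs s') => //.
      by nra.
    by move=> x hx; rewrite -pE; apply: hs'; nra.
  apply: (@sum_turn_bounded (lead_coef p) rs s) => //.
    by nra.
  by move=> x hx; rewrite -pE; apply: hs; nra.
rewrite -/(T y) -/(T (- y)).
have := near0 y; have := near0 (- y); rewrite oppr_eq0 (gt_eqF y0) => /(_ isT) h1 /(_ isT) h2.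
rewrite (_ : T y - T (- y) = (T y - T 0) - (T (- y) - T 0)); last by ring.
by rewrite (le_trans (ler_normB _ _))//; lra.
Unshelve. all: by end_near. Qed.

End RootCount.

(** * Chebyshev alternation for even polynomials *)

Section Alternation.
Context {R : realType}.
Implicit Types (a x y L : R) (P Q E D q : {poly R}) (m : nat).

Lemma norm_horner_le P x : `|x| <= 1 -> `|P.[x]| <= \sum_(i < size P) `|P`_i|.
Proof.
move=> x1; rewrite horner_coef (le_trans (ler_norm_sum _ _ _))// ler_sum// => i _.
by rewrite normrM normrX ler_piMr// exprn_ile1.
Qed.

Lemma le_approx_error a P x : a <= `|x| <= 1 ->
  `| `|x| - P.[x] | <= approx_error a P.
Proof.
move=> xin; apply: ub_le_sup; last by exists x.
exists (1 + \sum_(i < size P) `|P`_i|) => _ [y /= /andP[_ y1] <-].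
rewrite (le_trans (ler_normB _ _))// normr_id lerD//.
exact: norm_horner_le.
Qed.

Lemma approx_error_le a P L : a <= 1 ->
    (forall x, a <= `|x| <= 1 -> `| `|x| - P.[x] | <= L) ->
  approx_error a P <= L.
Proof.
move=> a1 h; apply: ge_sup; last by move=> _ [x xin <-]; exact: h.
by exists `| `|1| - P.[1] |; exists 1; rewrite //= normr1 a1 lexx.
Qed.

Lemma min_error_le m a Q : a <= 1 -> (size Q <= (2 * m).+1)%N ->
  L_ m a <= approx_error a Q.
Proof.
move=> a1 sQ; apply: ge_inf; last by exists Q.
exists 0 => _ [P _ <-].
apply: le_trans (_ : `| `|1| - P.[1] | <= _) => //.
by apply: le_approx_error; rewrite normr1 a1 lexx.
Qed.

Definition even P := P \Po (- 'X) = P.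

Lemma horner_even P x : even P -> P.[- x] = P.[x].
Proof. by move=> {2}<-; rewrite horner_comp !hornerE. Qed.

Lemma even_normr P x : even P -> P.[`|x|] = P.[x].
Proof. by move=> eP; case: (ger0P x) => // _; exact: horner_even. Qed.

(** By symmetry and compactness, a strict bound at each point of [[a, 1]] makes the
    uniform error smaller. *)
Lemma approx_error_even_lt a P L : 0 < a -> a <= 1 -> even P ->
    (forall x, a <= x <= 1 -> `|P.[x] - x| < L) ->
  approx_error a P < L.
Proof.
move=> a0 a1 eP h.
have cf : {within `[a, 1], continuous (fun x => `|P.[x] - x|)}.
  apply: continuous_subspaceT => x; apply: cvg_norm.
  by apply: cvgB; [exact: continuous_horner|exact: cvg_id].
have [c cin hc] := EVT_max a1 cf.
apply: (@le_lt_trans _ _ (`|P.[c] - c|)); last by apply: h; move: cin; rewrite in_itv.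
apply: approx_error_le => // x xin; rewrite -(even_normr _ eP) distrC.
by apply: hc; rewrite in_itv.
Qed.

(** The improvement step of Chebyshev's argument.  Where [D] and [q] have the same
    sign, subtracting a small multiple of [q] moves [D] towards [0]; the other
    points form a compact set on which [`|D|] stays away from [L], so that a small
    enough multiple does no harm there. *)
Lemma perturbed_deviation_lt a D q L : 0 < L ->
    (forall x, a <= x <= 1 -> `|D.[x]| <= L) ->
    (forall x, a <= x <= 1 -> `|D.[x]| = L -> 0 < D.[x] * q.[x]) ->
  exists e, forall x, a <= x <= 1 -> `|D.[x] - e * q.[x]| < L.
Proof.
move=> L0 DL Dq.
(* K is the part of the interval on which the correction goes the wrong way. *)
pose K := `[a, 1] `&` [set x | D.[x] * q.[x] <= 0].
have [L' [L'0 L'L KL]] :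
    exists L', [/\ 0 <= L', L' < L & forall x, K x -> `|D.[x]| <= L'].
  have [K0|] := pselect (K !=set0); last first.
    by move=> K0; exists 0; split => // x Kx; exfalso; apply: K0; exists x.
  have cK : compact K.
    apply: compact_closedI; first exact: segment_compact.
    apply: (@closed_comp _ _ (fun x => D.[x] * q.[x]) [set x | x <= 0]).
      by move=> x _; apply: cvgM; exact: continuous_horner.
    exact: closed_le.
  have [|c cK' hc] := @compact_EVT_max _ _ (fun x => `|D.[x]|) K K0 cK.
    by apply: continuous_subspaceT => x; apply: cvg_norm; exact: continuous_horner.
  exists `|D.[c]|; split => //; last by move=> x Kx; apply: hc; rewrite inE.
  move: cK'; rewrite inE => -[/= cin Dqc].
  have {}cin : a <= c <= 1 by move: cin; rewrite in_itv.
  rewrite lt_neqAle DL// andbT; apply/eqP => DcL.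
  by move: Dqc; rewrite leNgt Dq.
have [M [M0 qM]] : exists M, 0 < M /\ forall x, a <= x <= 1 -> `|q.[x]| < M.
  have [a1|a1] := leP a 1; last first.
    by exists 1; split => // x /andP[ax x1]; move: (lt_le_trans a1 ax); rewrite ltNge x1.
  have [|c cin hc] := @EVT_max R (fun x => `|q.[x]|) a 1 a1.
    by apply: continuous_subspaceT => x; apply: cvg_norm; exact: continuous_horner.
  exists (`|q.[c]| + 1); split; first by rewrite ltr_wpDl.
  by move=> x xin; rewrite (le_lt_trans (hc x _)) ?ltrDl// in_itv.
have d0 : 0 < (L - L') / M by rewrite divr_gt0// subr_gt0.
exists ((L - L') / M) => x xin.
have eq : `|(L - L') / M * q.[x]| < L - L'.
  rewrite normrM gtr0_norm// mulrAC ltr_pdivrMr// ltr_pM2l ?qM//.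
  by rewrite subr_gt0.
have [Dq0|Dq0] := leP (D.[x] * q.[x]) 0.
  have /KL : K x by split => //=; rewrite in_itv.
  by move=> DL'; rewrite (le_lt_trans (ler_normB _ _))//; lra.
have DLx := DL _ xin; move: eq.
set e := (L - L') / M in d0 *; move: (D.[x]) (q.[x]) Dq0 DLx => u v uv.
rewrite ler_norml !ltr_norml => /andP[u1 u2] /andP[w1 w2].
have [v0|v0] := leP 0 v.
  have {}v0 : 0 < v by rewrite lt_def v0 andbT; apply/eqP => E; rewrite E mulr0 ltxx in uv.
  have u0 : 0 < u by rewrite -(pmulr_lgt0 _ v0).
  by have := mulr_gt0 d0 v0; lra.
have u0 : u < 0 by rewrite -(nmulr_lgt0 _ v0).
have := mulr_gt0 d0 (_ : 0 < - v); rewrite oppr_gt0 => /(_ v0).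
by rewrite mulrN; lra.
Qed.

(** Here [s] lists the extremal points and [sg] tells where the deviation is
    positive.  A zero is placed midway between neighbours of different signs; the
    product of the resulting linear factors then has the sign pattern of [sg], and
    the points [t] that follow a change of sign, together with [x], alternate.  So
    there are as many zeros as changes of sign. *)
Lemma sign_separation (sg : R -> bool) x (s : seq R) : path <%R x s ->
  exists t zs, [/\ {subset t <= s},
    path (fun u v => (u < v) && (sg u != sg v)) x t,
    size zs = size t, all (fun z => x < z) zs
  & {in x :: s, forall y,
      0 < (-1) ^+ (sg x (+) sg y) * \prod_(z <- zs) (z - y)}].
Proof.
elim: s x => [|y s IH] x /=.
  move=> _; exists [::], [::]; split => // y; rewrite inE => /eqP ->.
  by rewrite big_nil addbb mulr1.
move=> /andP[xy ys]; have [t [zs [ts pt szs yzs hyp]]] := IH y ys.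
have xzs : all (fun z => x < z) zs.
  by apply: sub_all yzs => z; exact: lt_trans.
have xpos (zs' : seq R) : all (fun z => x < z) zs' -> 0 < \prod_(z <- zs') (z - x).
  elim: zs' => [_|z zs' IHz /= /andP[xz /IHz]]; first by rewrite big_nil.
  by rewrite big_cons => ?; rewrite mulr_gt0// subr_gt0.
have [sxy|sxy] := eqVneq (sg x) (sg y).
  exists t, zs; split => //.
  - by move=> z /ts; rewrite inE orbC => ->.
  - case: t pt {ts szs} => //= v t /andP[/andP[yv syv] ->].
    by rewrite (lt_trans xy yv) sxy syv.
  - move=> w; rewrite inE => /orP[/eqP ->|/hyp].
      by rewrite addbb mul1r xpos.
    by rewrite sxy.
have xz : x < (x + y) / 2 by lra.
exists (y :: t), ((x + y) / 2 :: zs); split => /=.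
- by move=> z; rewrite !inE => /orP[->//|/ts ->]; rewrite orbT.
- by rewrite xy sxy.
- by rewrite szs.
- by rewrite xz.
- move=> w; rewrite inE => /orP[/eqP ->|wys].
    by rewrite addbb mul1r xpos//= xz.
  have yw : y <= w.
    move: wys; rewrite inE => /orP[/eqP ->//|ws]; apply: ltW.
    by move: ys; rewrite lt_path_sortedE => /andP[/allP /(_ _ ws)].
  rewrite big_cons mulrCA nmulr_rgt0; last by lra.
  have -> : sg x = ~~ sg y by case: (sg x) (sg y) sxy => [] [].
  by rewrite addNb signrN mulNr oppr_lt0; apply: hyp.
Qed.

Lemma evenZ (c : R) P : even P -> even (c *: P).
Proof. by rewrite /even comp_polyZ => ->. Qed.

Lemma evenB P Q : even P -> even Q -> even (P - Q).
Proof. by rewrite /even comp_polyB => -> ->. Qed.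

Lemma even_prod (zs : seq R) : even (\prod_(z <- zs) ((z ^+ 2)%:P - 'X^2)).
Proof.
rewrite /even rmorph_prod; apply: eq_bigr => z _ /=.
by rewrite comp_polyB comp_polyC comp_Xn_poly sqrrN.
Qed.

Lemma size_even_prod (zs : seq R) :
  (size (\prod_(z <- zs) ((z ^+ 2)%:P - 'X^2) : {poly R})%R <= (2 * size zs).+1)%N.
Proof.
elim: zs => [|z zs IH]; first by rewrite big_nil size_poly1.
rewrite big_cons (leq_trans (size_polyMleq _ _))//=.
have : (size ((z ^+ 2)%:P - 'X^2 : {poly R})%R <= 3)%N.
  rewrite (leq_trans (size_polyD _ _))// geq_max size_polyN size_polyXn leqnn andbT.
  by rewrite (leq_trans (size_polyC_leq1 _)).
move=> h; rewrite -subn1 leq_subLR (leq_trans (leq_add h IH))//; lia.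
Qed.

(** Makes [D^2 - L^2] a nonzero polynomial, so that the extremal points are finite
    in number and can be listed in order.  Evenness matters: [E = X + c] would be a
    counterexample. *)
Lemma even_deviation_neq_const E (c : R) : even E -> (E - 'X) ^+ 2 != c%:P.
Proof.
move=> eE; apply/eqP => h.
have h2 x : (E.[x] - x) ^+ 2 = c by rewrite -[RHS](hornerC c x) -h !hornerE.
have h3 x : (E.[x] + x) ^+ 2 = c by rewrite -(horner_even x eE) -[in X in _ + X](opprK x) h2.
have E0 x : x * E.[x] = 0.
  have := h2 x; have := h3 x => <-; nra.
have := h2 1; have := h2 2; have := E0 1; have := E0 2.
by rewrite mul1r => e2 e1; rewrite e1; nra.
Qed.

(** If the error were zero, [E - X] would have infinitely many zeros in [[a, 1]]. *)
Lemma min_error_gt0 m a E : 0 < a < 1 -> even E -> best_approx m a E -> 0 < L_ m a.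
Proof.
move=> /andP[a0 a1] eE [_ EL].
have ub x : a <= x <= 1 -> `|x - E.[x]| <= L_ m a.
  move=> /andP[ax x1]; have x0 : 0 <= x by rewrite (le_trans (ltW a0)).
  by rewrite -EL -{1}(ger0_norm x0); apply: le_approx_error; rewrite ger0_norm// ax.
have L0 : 0 <= L_ m a by apply: le_trans (ub 1 _) => //; rewrite (ltW a1) lexx.
rewrite lt_neqAle L0 andbT eq_sym; apply/eqP => Lz.
have /negP := even_deviation_neq_const 0 eE; apply.
rewrite polyC0 sqrf_eq0; apply/eqP.
apply: (@roots_geq_poly_eq0 _ _
  [seq a + (1 - a) / n.+1%:R | n <- iota 0 (size (E - 'X))]).
- apply/allP => _ /mapP[n _ ->]; rewrite rootE !hornerE; set x := a + _.
  have xin : a <= x <= 1.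
    have a1' : 0 <= 1 - a by rewrite subr_ge0 ltW.
    rewrite /x lerDl divr_ge0//= -lerBrDl ler_pdivrMr// ler_peMr//.
    by rewrite ler1n.
  by have := ub _ xin; rewrite Lz normr_le0 subr_eq0 eq_sym -subr_eq0.
- rewrite map_inj_uniq ?iota_uniq// => n k /addrI.
  move=> /(mulfI _) h; have {}h := h (lt0r_neq0 _).
  by move: h; rewrite subr_gt0 => /(_ a1) /invr_inj /eqP; rewrite eqr_nat eqSS => /eqP.
- by rewrite size_map size_iota.
Qed.

(** The function [`|x|] is even, so averaging [P x] and [P (- x)] does not increase
    the error. *)
Lemma even_part_exists m a P : a <= 1 -> best_approx m a P ->
  exists2 E, even E /\ best_approx m a E &
    forall x, P.[x] + P.[- x] = 2 * E.[x].
Proof.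
move=> a1 [sP aP]; pose E := 2^-1 *: (P + (P \Po (- 'X))).
have EE x : 2 * E.[x] = P.[x] + P.[- x].
  by rewrite /E hornerZ hornerD horner_comp hornerN hornerX mulrA divff ?mul1r.
have sE : (size E <= (2 * m).+1)%N.
  rewrite (leq_trans (size_scale_leq _ _))// (leq_trans (size_polyD _ _))//.
  rewrite geq_max sP/= (leq_trans (size_comp_poly_leq _ _))//.
  by rewrite size_polyN size_polyX muln1; case: (size P) sP.
exists E => //; split.
  by rewrite /even comp_polyZ comp_polyD -comp_polyA raddfN /= comp_polyX opprK comp_polyXr addrC.
split => //; apply/eqP; rewrite eq_le (min_error_le a1 sE) andbT -aP.
apply: approx_error_le => // x xin.
have h1 := le_approx_error P xin.
have := @le_approx_error a P (- x); rewrite normrN => /(_ xin) h2.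
have -> : `|x| - E.[x] = ((`|x| - P.[x]) + (`|x| - P.[- x])) / 2.
  by have := EE x; lra.
rewrite normrM [`|2^-1|]ger0_norm// ler_pdivrMr// (le_trans (ler_normD _ _))//.
by lra.
Qed.

(** With fewer than [m + 2] alternating points, at most [m] changes of sign occur;
    replacing each separating zero [z] by the even factor [z^2 - x^2] gives an even
    polynomial of degree at most [2 m] with the sign of the deviation at all
    extremal points, and subtracting a small multiple of it contradicts minimality. *)
Lemma alternation_exists m a E : 0 < a < 1 -> even E -> best_approx m a E ->
  exists x t, [/\ {in x :: t, forall u, a <= u <= 1 /\
                     `|(E - 'X).[u]| = L_ m a},
    path (fun u v => (u < v) && (((E - 'X).[u] == L_ m a)
                               != ((E - 'X).[v] == L_ m a))) x t
  & (m < size t)%N].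
Proof.
move=> a01 eE bE; have L0 := min_error_gt0 a01 eE bE.
have [a0 a1] := andP a01; have [sE EL] := bE.
set L := L_ m a in L0 EL *; pose D := E - 'X.
have DE x : D.[x] = E.[x] - x by rewrite !hornerE.
have DL x : a <= x <= 1 -> `|D.[x]| <= L.
  move=> /andP[ax x1]; have x0 : 0 <= x by rewrite (le_trans (ltW a0)).
  rewrite -EL DE distrC -{1}(ger0_norm x0); apply: le_approx_error.
  by rewrite ger0_norm// ax.
have noimp q : even q -> (size q <= (2 * m).+1)%N ->
    (forall x, a <= x <= 1 -> `|D.[x]| = L -> 0 < D.[x] * q.[x]) -> False.
  move=> eq sq hq; have [e he] := perturbed_deviation_lt L0 DL hq.
  have : approx_error a (E - e *: q) < L.
    apply: approx_error_even_lt => //; first exact: ltW.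
      by apply: evenB => //; exact: evenZ.
    move=> x /he; rewrite DE hornerD hornerN hornerZ.
    by congr (`|_| < _); ring.
  rewrite ltNge => /negP; apply; apply: min_error_le; first exact: ltW.
  rewrite (leq_trans (size_polyD _ _))// geq_max sE size_polyN.
  by rewrite (leq_trans (size_scale_leq _ _)).
(* The open interval ]0, 2[ serves only to contain [a, 1]. *)
pose X := [seq u <- roots (D ^+ 2 - (L ^+ 2)%:P) 0 2 | a <= u <= 1].
have XP u : (u \in X) = (a <= u <= 1) && (`|D.[u]| == L).
  rewrite mem_filter; case/boolP: (a <= u <= 1) => //= /andP[au u1].
  rewrite -root_is_roots ?subr_eq0 ?even_deviation_neq_const//; last first.
    by rewrite in_itv/= (lt_le_trans a0 au) (le_lt_trans u1)// ltr1n.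
  rewrite rootE !hornerE -!DE subr_eq0 -[D.[u] ^+ 2]real_normK ?num_real//.
  by rewrite eqrXn2// ltW.
have sX : sorted <%R X by apply: sorted_filter; [exact: lt_trans|exact: sorted_roots].
case EX : X => [|x s].
  exfalso; apply: (noimp 1); rewrite ?size_poly1//.
    by rewrite /even comp_polyC.
  by move=> x xin /eqP DxL; have := XP x; rewrite EX xin DxL.
have [t [zs [ts pt szs xzs hsep]]] :=
  @sign_separation (fun u => D.[u] == L) x s ltac:(by move: sX; rewrite EX).
exists x, t; split => //.
  move=> u ut; have : u \in X.
    by move: ut; rewrite EX !inE => /orP[->//|/ts ->]; rewrite orbT.
  by rewrite XP => /andP[-> /eqP].
rewrite ltnNge; apply/negP => stm.
(* The sign makes q agree with D at the first extremal point. *)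
pose q := (-1) ^+ (D.[x] != L) *: \prod_(z <- zs) ((z ^+ 2)%:P - 'X^2).
apply: (noimp q).
- by apply: evenZ; exact: even_prod.
- rewrite (leq_trans (size_scale_leq _ _))// (leq_trans (size_even_prod _))// szs.
  by rewrite ltnS leq_mul2l stm.
move=> u uin DuL.
have u0 : 0 < u by case/andP: uin => au _; exact: lt_le_trans au.
have uX : u \in x :: s by rewrite -EX XP uin DuL eqxx.
have x0 : 0 < x.
  have : x \in X by rewrite EX inE eqxx.
  by rewrite XP => /andP[/andP[ax _] _]; exact: lt_le_trans ax.
have -> : D.[u] = (-1) ^+ (D.[u] != L) * L.
  have [->|] := eqVneq; first by rewrite mul1r.
  by move: DuL => <-; case: (ger0P D.[u]); rewrite ?eqxx// mulN1r opprK.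
have -> : q.[u] = (-1) ^+ (D.[x] != L) * (\prod_(z <- zs) (z - u) * \prod_(z <- zs) (z + u)).
  rewrite hornerZ horner_prod -big_split /=; congr (_ * _); apply: eq_bigr => z _.
  by rewrite !hornerE; ring.
have pos : 0 < \prod_(z <- zs) (z + u).
  rewrite big_seq; apply: prodr_gt0 => z zzs.
  by rewrite addr_gt0// (lt_trans x0)//; move/allP : xzs => /(_ _ zzs).
have := mulr_gt0 (mulr_gt0 L0 pos) (hsep u uX).
congr (_ < _); rewrite signr_addb.
by case: (D.[x] == L) (D.[u] == L) => [] [] /=; rewrite ?expr0 ?expr1; ring.
Qed.

End Alternation.

(** * Equioscillation of the extremal polynomial *)

Section Structure.
Context {R : realType}.
Local Notation C := (R[i]^o).
Local Notation Re := (@complex.Re R).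
Local Notation Im := (@complex.Im R).
Implicit Types (a L : R) (P D : {poly R}) (m : nat).

Lemma ceval_conj P (z : C) : ceval P (z^*)%C = ((ceval P z)^*)%C.
Proof.
rewrite /ceval !horner_poly rmorph_sum; apply: eq_bigr => i _.
by rewrite rmorphM rmorphXn; congr (_ * _); exact/esym/conjc_real.
Qed.

Lemma ceval_real P (x : R) : ceval P x%:C = (P.[x])%:C.
Proof. by rewrite /ceval horner_map. Qed.

Lemma ceval_comp_opp P (z : C) : ceval (P \Po (- 'X)) z = ceval P (- z).
Proof. by rewrite /ceval map_comp_poly horner_comp rmorphN /= map_polyX !hornerE. Qed.

Lemma cevalB P D (z : C) : ceval (P - D) z = ceval P z - ceval D z.
Proof. by rewrite /ceval rmorphB hornerD hornerN. Qed.

Lemma cevalX (z : C) : ceval 'X z = z.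
Proof. by rewrite /ceval map_polyX hornerX. Qed.

Lemma cevalC (c : R) (z : C) : ceval c%:P z = c%:C.
Proof. by rewrite /ceval map_polyC hornerC. Qed.

(** Both [- iy] and the conjugate of [iy] are the same point, where an even real
    polynomial takes the value it has at [iy] and the conjugate of that value. *)
Lemma Im_even_imaginary P (y : R) : even P -> Im (ceval P (0 +i* y)) = 0.
Proof.
move=> eP; have := ceval_comp_opp P (0 +i* y); rewrite eP.
have -> : - (0 +i* y) = ((0 +i* y)^*)%C :> C by simpc.
rewrite ceval_conj; case: (ceval P _) => u v /= [] /=; lra.
Qed.

Lemma Re_even_deriv_imaginary P (y : R) : even P -> Re (ceval P^`() (0 +i* y)) = 0.
Proof.
move=> eP; have := ceval_comp_opp P^`() (0 +i* y).
have -> : P^`() \Po (- 'X) = - P^`().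
  have /(congr1 deriv) := eP; rewrite deriv_comp derivN derivX mulrN1.
  by move=> /(congr1 -%R); rewrite opprK.
have -> : - (0 +i* y) = ((0 +i* y)^*)%C :> C by simpc.
rewrite ceval_conj -[in X in X -> _](sub0r P^`()) cevalB cevalC.
case: (ceval P^`() _) => u v /= [] /=; lra.
Qed.

(** [Re (P - X)' = -1] on the imaginary axis, so the zeros of [i (P - X)'] can be
    counted.  The list [t] may contain nonreal zeros, which is how these are
    excluded later. *)
Lemma size_deviation_deriv_roots m P (t : seq C) :
    even P -> (size P <= (2 * m).+1)%N -> uniq t ->
    {in t, forall z, ceval (P - 'X)^`() z = 0 /\ 0 < Re z} ->
  (size t <= m)%N.
Proof.
move=> eP sP ut ht.
pose p : {poly C} := ('i%C : C) *: map_poly (real_complex R) (P - 'X)^`().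
have pE z : p.[z] = 'i%C * ceval (P - 'X)^`() z by rewrite /p hornerZ.
have sp : (size p <= maxn (2 * m) 1)%N.
  rewrite (leq_trans (size_scale_leq _ _))// size_map_poly derivB derivX.
  rewrite (leq_trans (size_polyD _ _))// size_polyN size_poly1.
  by rewrite geq_max leq_maxr andbT (leq_trans _ (leq_maxl _ _))// size_deriv; case: (size P) sP.
have : ((size t).*2 <= size p)%N.
  apply: (@size_right_roots_1 R p (-1)) => //.
    move=> y; rewrite pE derivB derivX cevalB cevalC mulN1r.
    have := Re_even_deriv_imaginary y eP; case: (ceval P^`() _) => u v /= ->; lra.
  by move=> z /ht[z0 rz]; rewrite rootE pE z0 mulr0.
lia.
Qed.

(** [Im (P - X) (iy) = - y] has a constant sign on each half of the axis. *)
Lemma size_deviation_level_roots m P (s : R) (t : seq C) :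
    even P -> (size P <= (2 * m).+1)%N -> P.[0] != s -> uniq t ->
    {in t, forall z, ceval (P - 'X) z = s%:C /\ 0 < Re z} ->
  (size t <= m.+1)%N.
Proof.
move=> eP sP P0 ut ht.
pose p : {poly C} := map_poly (real_complex R) (P - 'X - s%:P).
have pE z : p.[z] = ceval P z - z - s%:C by rewrite -[LHS]/(ceval _ _) !cevalB cevalX cevalC.
have sp : (size p <= maxn (2 * m).+1 2)%N.
  rewrite size_map_poly (leq_trans (size_polyD _ _))// size_polyN geq_max.
  have -> : (size s%:P <= maxn (2 * m).+1 2)%N.
    by rewrite (leq_trans (size_polyC_leq1 _))// leq_max orbT.
  rewrite andbT.
  rewrite (leq_trans (size_polyD _ _))// size_polyN size_polyX geq_max.
  by rewrite leq_maxr andbT (leq_trans sP)// leq_maxl.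
have Imp y : Im p.[0 +i* y] = - y.
  rewrite pE; have := Im_even_imaginary y eP.
  by case: (ceval P _) => u v /= ->; lra.
have : ((size t).*2 <= (size p).+1)%N.
  apply: (@size_right_roots_2 R p (-1) 1) => //.
  - rewrite pE (ceval_real P 0) subr0 -rmorphB /= -(rmorph0 (real_complex R)).
    by rewrite (inj_eq (@complexI R)) subr_eq0.
  - by move=> y y0; rewrite Imp; lra.
  - by move=> y y0; rewrite Imp; lra.
  - move=> z /ht[z0 rz]; split => //; rewrite rootE pE.
    by move: z0; rewrite cevalB cevalX => ->; rewrite subrr.
lia.
Qed.

(** Fermat's theorem.  Up to sign [D u = L]; a nonzero derivative at [u] would make
    [D] exceed [L] on one side. *)
Lemma interior_extremum_deriv D a L (u : R) :
    (forall x, a <= x <= 1 -> `|D.[x]| <= L) -> a < u < 1 -> `|D.[u]| = L ->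
  D^`().[u] = 0.
Proof.
wlog : D / 0 <= D.[u] => [hw|Du0].
  have [/hw|Du0] := leP 0 D.[u]; first exact.
  move=> DL uin DuL; have := hw (- D).
  rewrite hornerN oppr_ge0 normrN => /(_ (ltW Du0)) h.
  apply/eqP; rewrite -oppr_eq0 -hornerN -derivN; apply/eqP/h => // x.
  by rewrite hornerN normrN; exact: DL.
rewrite (ger0_norm Du0) => DL /andP[au u1] DuL.
apply/eqP; apply/negPn/negP => D'0.
have d0 : 0 < `|D^`().[u]| by rewrite normr_gt0.
have [d d0' hd] := @poly_cont _ u D^`() _ d0.
have sgd y : `|y - u| < d -> 0 < D^`().[u] * D^`().[y].
  move=> /hd; rewrite ltr_norml; have [u0|u0|E] := ltgtP 0 D^`().[u].
  - by rewrite (gtr0_norm u0) => /andP[? ?]; apply: mulr_gt0 => //; lra.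
  - by rewrite (ltr0_norm u0) => /andP[? ?]; rewrite nmulr_rgt0//; lra.
  - by rewrite -E eqxx in D'0.
have [u0|u0|E] := ltgtP 0 D^`().[u]; last by rewrite -E eqxx in D'0.
  pose e := Order.min (d / 2) (1 - u).
  have e0 : 0 < e by rewrite lt_min divr_gt0//= subr_gt0.
  have ed : e <= d / 2 by rewrite ge_min lexx.
  have eu : e <= 1 - u by rewrite ge_min lexx orbT.
  have [c] := @poly_mvt R u (u + e) D ltac:(lra).
  rewrite in_itv /= => /andP[uc ce] E.
  have := sgd c; rewrite ger0_norm ?subr_ge0 ?ltW// pmulr_rgt0// => /(_ ltac:(lra)) c0.
  have : D.[u + e] <= L by rewrite (le_trans (ler_norm _))// DL//; lra.
  have : 0 < D^`().[c] * (u + e - u) by rewrite mulr_gt0//; lra.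
  lra.
pose e := Order.min (d / 2) (u - a).
have e0 : 0 < e by rewrite lt_min divr_gt0//= subr_gt0.
have ed : e <= d / 2 by rewrite ge_min lexx.
have eu : e <= u - a by rewrite ge_min lexx orbT.
have [c] := @poly_mvt R (u - e) u D ltac:(lra).
rewrite in_itv /= => /andP[uc ce] E.
have := sgd c; rewrite ler0_norm ?subr_le0 ?ltW// nmulr_rgt0// => /(_ ltac:(lra)) c0.
have : D.[u - e] <= L by rewrite (le_trans (ler_norm _))// DL//; lra.
have : D^`().[c] * (u - (u - e)) < 0 by rewrite nmulr_rlt0//; lra.
lra.
Qed.

(** What the later parts use of the extremal polynomial.  The last field carries the
    result of the root count: apart from the interior nodes, [(P - X)'] has no zero
    in the open right half-plane, real or not. *)
Record extremal m a L P (x : nat -> R) : Prop := Extremal {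
  ext_a : 0 < a < 1;
  ext_L : 0 < L;
  ext_even : even P;
  ext_size : (size P <= (2 * m).+1)%N;
  ext_first : x 0 = a;
  ext_last : x m.+1 = 1;
  ext_lt : forall j, (j <= m)%N -> x j < x j.+1;
  ext_le : forall u, a <= u <= 1 -> `|(P - 'X).[u]| <= L;
  ext_val : forall j, (j <= m.+1)%N -> (P - 'X).[x j] = (-1) ^+ j * L;
  ext_deriv : forall z : C, 0 < Re z -> ceval (P - 'X)^`() z = 0 ->
    exists2 j, (0 < j <= m)%N & z = (x j)%:C }.

(** At a positive extremal point [u] of the even part [E], the values [P u] and
    [P (- u)] both lie within the error of [u], and their mean [E u] is at that distance exactly;
    so they coincide.  This gives more than [2 m] zeros of [P - E]. *)
Lemma best_approx_even_part m a P E (l : seq R) : 0 < a < 1 ->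
    best_approx m a P -> best_approx m a E ->
    (forall x, P.[x] + P.[- x] = 2 * E.[x]) ->
    uniq l -> {in l, forall u, a <= u <= 1 /\ `|(E - 'X).[u]| = L_ m a} ->
    (m < size l)%N ->
  P = E.
Proof.
move=> /andP[a0 a1] [sP bP] [sE _] PE ul hl sl.
have PEl u : u \in l -> P.[u] = E.[u] /\ P.[- u] = E.[u].
  move=> /hl[/andP[au u1]]; have u0 : 0 < u by exact: lt_le_trans au.
  have h1 := @le_approx_error _ a P u; have h2 := @le_approx_error _ a P (- u).
  rewrite bP normrN gtr0_norm// au u1 in h1 h2.
  move: (h1 isT) (h2 isT) (PE u); rewrite !hornerE !ler_norml.
  move=> /andP[? ?] /andP[? ?] ?.
  by case: (ger0P (E.[u] - u)) => ? ?; lra.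
have lpos u : u \in l -> 0 < u by move=> /hl[/andP[au _] _]; exact: lt_le_trans au.
apply/eqP; rewrite -subr_eq0; apply/eqP.
apply: (@roots_geq_poly_eq0 _ _ (l ++ map -%R l)).
- apply/allP => u; rewrite mem_cat rootE !hornerE subr_eq0 => /orP[/PEl[->]//|].
  move=> /mapP[v vl ->]; have [h1 h2] := PEl _ vl.
  have := PE (- v); rewrite opprK; have := PE v; rewrite h1 h2.
  by move=> ? ?; apply/eqP; lra.
- rewrite cat_uniq ul (map_inj_uniq oppr_inj) ul andbT /=.
  apply/hasPn => _ /mapP[v vl ->]; apply/negP => /lpos.
  by rewrite oppr_gt0 ltNge ltW// lpos.
- rewrite size_cat size_map (leq_trans (size_polyD _ _))// size_polyN geq_max.
  have h : ((2 * m).+1 <= size l + size l)%N by lia.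
  by rewrite (leq_trans sP h) (leq_trans sE h).
Qed.

(** The alternating list has at least [m + 2] points.  Those inside [[a, 1]] are
    zeros of [D'], of which there are at most [m]; hence both ends belong to the
    list and the list has exactly [m + 2] points.  Since [D' 0 = -1] and [D'] has no
    zero before the first interior node, [D] decreases from [x 0 = a] to [x 1], and
    so [D a = L] rather than [- L]. *)
Lemma extremal_exists m a P : 0 < a < 1 -> best_approx m a P ->
  exists x, extremal m a (L_ m a) P x.
Proof.
move=> a01 bP; have [a0 a1] := andP a01.
have [E [eE bE] PE] := even_part_exists (ltW a1) bP.
have [x0 [t [hl pt st]]] := alternation_exists a01 eE bE.
have L0 := min_error_gt0 a01 eE bE.
set L := L_ m a in hl pt L0 *; pose D := E - 'X; rewrite -/D in hl pt.
pose l := x0 :: t; rewrite -/l in hl.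
have ltp : path <%R x0 t by apply: sub_path pt => u v /andP[].
have ul : uniq l by apply: (sorted_uniq lt_trans (@ltxx _ _)).
have EP : P = E by apply: (best_approx_even_part a01 bP bE PE ul hl); rewrite /= ltnW.
subst E; have [sP LP] := bP.
have DL u : a <= u <= 1 -> `|D.[u]| <= L.
  move=> /andP[au u1]; have u0 : 0 < u by exact: lt_le_trans au.
  have := @le_approx_error _ a P u; rewrite gtr0_norm// au u1 LP => /(_ isT).
  by rewrite distrC /D !hornerE.
pose I := [seq u <- l | a < u < 1].
pose IC : seq C := map (real_complex R) I.
have uIC : uniq IC by rewrite map_inj_uniq ?filter_uniq//; exact: complexI.
have hIC : {in IC, forall z, ceval (P - 'X)^`() z = 0 /\ 0 < Re z}.
  move=> z /mapP[u]; rewrite mem_filter => /andP[uin /hl[_ DuL]] ->.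
  rewrite ceval_real (interior_extremum_deriv DL uin DuL); split => //=.
  by case/andP: uin => au _; exact: lt_trans au.
have sI : (size I <= m)%N.
  by rewrite -(size_map (real_complex R)) (size_deviation_deriv_roots eE sP uIC hIC).
pose F := [seq u <- l | ~~ (a < u < 1)].
have uF : uniq F by rewrite filter_uniq.
have Fsub : {subset F <= [:: a; 1]}.
  move=> u; rewrite mem_filter => /andP[nu /hl[/andP[au u1] _]].
  rewrite !inE; move: nu; rewrite negb_and -!leNgt => /orP[ua|u1'].
    by rewrite [u == a]eq_le ua au.
  by rewrite [u == 1]eq_le u1' u1 orbT.
have sF : (size F <= 2)%N by rewrite (uniq_leq_size uF Fsub).
have sl : (size I + size F)%N = (size t).+1 by rewrite !size_filter count_predC.
have sF2 : (2 <= size F)%N by lia.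
have [_ Feq] := uniq_min_size uF Fsub sF2.
have al : a \in l by have := Feq a; rewrite !inE eqxx mem_filter => /andP[].
have il : 1 \in l by have := Feq 1; rewrite !inE eqxx orbT mem_filter => /andP[].
have st' : size t = m.+1 by lia.
have sIm : size I = m by lia.
pose x j := nth 0 l j.
have xl j : (j <= m.+1)%N -> x j \in l by move=> jm; rewrite mem_nth//= st'.
have alt j : (j <= m)%N -> x j < x j.+1 /\ D.[x j.+1] = - D.[x j].
  move=> jm; have /(pathP 0) /(_ j) := pt; rewrite st' ltnS => /(_ jm).
  rewrite -[nth 0 (x0 :: t) j]/(x j) -[nth 0 t j]/(x j.+1) => /andP[-> sg]; split => //.
  have [_ h1] := hl _ (xl j (leqW jm)); have [_ h2] := hl _ (xl j.+1 jm).
  move: sg h1 h2; move: (D.[x j]) (D.[x j.+1]) => u v.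
  move=> sg uL vL.
  have [uE|uE] : u = L \/ u = - L by case: (ger0P u) uL => ? ?; [left|right]; lra.
    have [vE|//] : v = L \/ v = - L by case: (ger0P v) vL => ? ?; [left|right]; lra.
      by move: sg; rewrite uE vE eqxx.
    by rewrite uE.
  have [vE|vE] : v = L \/ v = - L by case: (ger0P v) vL => ? ?; [left|right]; lra.
    by rewrite uE vE opprK.
  by move: sg; rewrite uE vE eqxx.
have xmono i j : (i < j)%N -> (j <= m.+1)%N -> x i < x j.
  elim: j => // j IH; rewrite ltnS leq_eqVlt => /orP[/eqP -> jm|ij jm].
    by have [] := alt j jm.
  by rewrite (lt_trans (IH ij (leqW jm)))//; have [] := alt j jm.
have xa : x 0%N = a.
  apply/eqP; rewrite eq_le; have [/andP[-> _] _] := hl _ (xl 0%N isT); rewrite andbT.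
  have [i +] := nthP 0 al; rewrite /= st' => im <-; rewrite -/(x i).
  by case: i im => // i im; rewrite ltW// xmono.
have x1 : x m.+1 = 1.
  apply/eqP; rewrite eq_le; have [/andP[_ ->] _] := hl _ (xl m.+1 (leqnn _)) => /=.
  have [i +] := nthP 0 il; rewrite /= st' ltnS => im <-; rewrite -/(x i).
  by move: im; rewrite leq_eqVlt => /orP[/eqP ->//|im]; rewrite ltW// xmono.
(* Any further zero of D', real or not, would be one too many. *)
have droots (z : C) : 0 < Re z -> ceval (P - 'X)^`() z = 0 ->
    exists2 j, (0 < j <= m)%N & z = (x j)%:C.
  move=> z0 Dz; have [zI|zI] := boolP (z \in IC).
    have /mapP[u uI zu] := zI; move: uI; rewrite mem_filter => /andP[/andP[au u1] ul'].
    have [j +] := nthP 0 ul'; rewrite /= st' ltnS => jm uj; exists j; last by rewrite zu -uj.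
    rewrite lt0n; apply/andP; split.
      by apply/eqP => j0; move: au; rewrite -uj j0 -/(x 0%N) xa ltxx.
    move: jm; rewrite leq_eqVlt => /orP[/eqP jm|//].
    by move: u1; rewrite -uj jm -/(x m.+1) x1 ltxx.
  have := @size_deviation_deriv_roots m P (z :: IC) eE sP.
  rewrite /= zI uIC size_map sIm ltnn => /(_ isT) h.
  exfalso; apply: notF; apply: h => w; rewrite inE => /orP[/eqP ->//|].
  exact: hIC.
have D'0 : D^`().[0] = -1.
  have := Re_even_deriv_imaginary 0 eE; rewrite (ceval_real P^`() 0) /= => P'0.
  by rewrite /D derivB derivX !hornerE P'0 sub0r.
have Da : D.[x 0%N] = L.
  have [_ DaL] := hl _ (xl 0%N isT); have [x01 D1] := alt 0%N isT.
  have [c] := @poly_mvt _ _ _ D x01; rewrite in_itv /= => /andP[xc cx] cE.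
  have c0 : 0 < c by rewrite (lt_trans a0)// -xa.
  have nr : {in `[0, c], forall u, ~~ root D^`() u}.
    move=> u; rewrite in_itv /= => /andP[u0 uc]; apply/negP => /eqP ru.
    have {}u0 : 0 < u.
      by rewrite lt_def u0 andbT; apply/eqP => u00; move: ru; rewrite u00 D'0; lra.
    have := @droots u%:C u0; rewrite ceval_real -/D ru => /(_ erefl)[j /andP[j0 jm] [uj]].
    have : x 1%N <= u.
      by move: j0; rewrite uj leq_eqVlt => /orP[/eqP <-//|j1]; rewrite ltW// xmono// leqW.
    lra.
  have := polyrN0_itv nr; move=> /(_ 0 c); rewrite !in_itv /= lexx (ltW c0) lexx.
  move=> /(_ isT isT); rewrite D'0 sgrN1 => /eqP; rewrite sgr_cp0 => c'neg.
  have : D^`().[c] * (x 1%N - x 0%N) < 0 by rewrite nmulr_rlt0// subr_gt0.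
  rewrite -cE D1 => D0; rewrite -DaL gtr0_norm//; lra.
exists x; split => //.
- by move=> j /alt[].
- elim => [_|j IH jm]; first by rewrite mul1r.
  by have [_ ->] := alt j jm; rewrite IH 1?ltnW// exprS mulN1r mulNr.
Qed.

End Structure.

(** * Values of the deviation on the closed quadrant *)

Section Deviation.
Context {R : realType}.
Local Notation C := (R[i]^o).
Local Notation Re := (@complex.Re R).
Local Notation Im := (@complex.Im R).
Local Notation normc := (@Normc.normc R).

Lemma normc_prod (I : Type) (rs : seq I) (f : I -> C) :
  normc (\prod_(i <- rs) f i) = \prod_(i <- rs) normc (f i).
Proof.
elim: rs => [|i rs IH]; first by rewrite !big_nil Normc.normc1.
by rewrite !big_cons Normc.normcM IH.
Qed.

Lemma normc_gt0 (z : C) : (0 < normc z) = (z != 0).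
Proof.
rewrite lt_def normc_ge0 andbT; congr (~~ _).
by apply/eqP/eqP => [/Normc.eq0_normc|->]; rewrite ?Normc.normc0.
Qed.

Lemma expr_le_prod (I : eqType) (rs : seq I) (g : I -> R) (e : R) : 0 <= e ->
  {in rs, forall i, e <= g i} -> e ^+ size rs <= \prod_(i <- rs) g i.
Proof.
move=> e0; elim: rs => [|i rs IH] h; first by rewrite big_nil.
rewrite big_cons exprS; apply: ler_pM => //.
- exact: exprn_ge0.
- exact/h/mem_head.
- by apply: IH => j jrs; apply: h; rewrite inE jrs orbT.
Qed.

(** If [p] does not take the value [w] within distance [e] of [z0], each of its
    [deg p] factors [z0 - rho], with [rho] a root of [p - w], has modulus at least
    [e], and so [w] is far from [p z0]. *)
Lemma poly_open (p : {poly C}) (z0 : C) (e : R) : (1 < size p)%N -> 0 < e ->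
  exists2 d : R, 0 < d & forall w, normc (w - p.[z0]) < d ->
    exists2 z, normc (z - z0) < e & p.[z] = w.
Proof.
move=> sp e0; have p0 : p != 0 by rewrite -size_poly_gt0 ltnW.
exists (normc (lead_coef p) * e ^+ (size p).-1).
  by rewrite mulr_gt0 ?exprn_gt0// normc_gt0 lead_coef_eq0.
move=> w wd; pose q := p - w%:P.
have sw : (size (- w%:P) < size p)%N by rewrite size_polyN (leq_ltn_trans (size_polyC_leq1 _)).
have sq : size q = size p by rewrite size_polyDl.
have lq : lead_coef q = lead_coef p by rewrite lead_coefDl.
have q0 : q != 0 by rewrite -size_poly_gt0 sq ltnW.
have [rs srs [qE rsE]] := poly_roots_seq q0.
have [[z zrs ze]|far] := pselect (exists2 z, z \in rs & normc (z - z0) < e).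
  exists z => //; apply/eqP; rewrite -subr_eq0; move: zrs; rewrite -rsE rootE.
  by rewrite hornerD hornerN hornerC.
exfalso; move: wd; apply/negP; rewrite -leNgt.
have -> : w - p.[z0] = - q.[z0] by rewrite hornerD hornerN hornerC opprB.
rewrite normcN qE lq Normc.normcM ler_pM2l ?normc_gt0 ?lead_coef_eq0// normc_prod.
rewrite -sq -srs /=.
apply: expr_le_prod; first exact: ltW.
move=> rho rhors; rewrite leNgt; apply/negP => he; apply: far; exists rho => //.
by rewrite -normcN opprB.
Qed.

(** Comparing the two endpoint values decides the sign of the derivative. *)
Lemma noroot_increasing (p : {poly R}) (u v : R) : u < v ->
    {in `]u, v[, forall t, ~~ root p^`() t} -> p.[u] < p.[v] ->
  {in `[u, v] &, forall s t, (p.[s] < p.[t]) = (s < t)}.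
Proof.
move=> uv nr puv s t sin tin.
have uin : u \in `[u, v] by rewrite in_itv /= lexx ltW.
have vin : v \in `[u, v] by rewrite in_itv /= lexx ltW.
have := lgtr_horner uv nr uin vin; rewrite (lgtr_horner uv nr sin tin) puv.
case: (_ < 0) => /=; rewrite ?expr0 ?expr1 ?mul1r// !mulN1r.
by rewrite ltrN2 ltNge ltW.
Qed.

Lemma noroot_deriv_gt0 (p : {poly R}) (u v : R) : u < v ->
    {in `]u, v[, forall t, ~~ root p^`() t} -> p.[u] < p.[v] ->
  {in `]u, v[, forall t, 0 < p^`().[t]}.
Proof.
move=> uv nr puv t tin; have [c cin cE] := @poly_mvt _ _ _ p uv.
have : 0 < p^`().[c] * (v - u) by rewrite -cE subr_gt0.
rewrite pmulr_lgt0 ?subr_gt0// => c0.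
by have := polyrN0_itv nr tin cin; rewrite (gtr0_sg c0) => /esym/eqP; rewrite sgr_cp0.
Qed.

Variables (m : nat) (a L : R) (P : {poly R}) (x : nat -> R).
Hypothesis ext : extremal m a L P x.
Let D := P - 'X.
Let L0 : 0 < L := ext_L ext.

Lemma ext_a0 : 0 < a. Proof. by have /andP[] := ext_a ext. Qed.

Lemma ext_mono i j : (i < j)%N -> (j <= m.+1)%N -> x i < x j.
Proof.
elim: j => // j IH; rewrite ltnS leq_eqVlt => /orP[/eqP -> jm|ij jm].
  exact: (ext_lt ext).
by rewrite (lt_trans (IH ij (leqW jm)))//; exact: (ext_lt ext).
Qed.

Lemma ext_ge_a j : (j <= m.+1)%N -> a <= x j.
Proof.
case: j => [_|j jm]; first by rewrite (ext_first ext).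
by rewrite -(ext_first ext) ltW// ext_mono.
Qed.

Lemma ext_le_1 j : (j <= m.+1)%N -> x j <= 1.
Proof.
rewrite -(ext_last ext) leq_eqVlt => /orP[/eqP ->//|jm].
by rewrite ltW// ext_mono.
Qed.

Lemma deviation_deriv_imaginary (y : R) : Re (ceval D^`() (0 +i* y)) = -1.
Proof.
have := Re_even_deriv_imaginary y (ext_even ext).
rewrite /D derivB derivX cevalB cevalC.
by case: (ceval P^`() _) => u v /= ->; rewrite sub0r.
Qed.

Lemma deviation_imaginary (y : R) : Im (ceval D (0 +i* y)) = - y.
Proof.
have := Im_even_imaginary y (ext_even ext).
rewrite /D cevalB cevalX.
by case: (ceval P _) => u v /= ->; rewrite sub0r.
Qed.

Lemma deviation_deriv_eq0 (z : C) : 0 <= Re z -> ceval D^`() z = 0 ->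
  exists2 j, (0 < j <= m)%N & z = (x j)%:C.
Proof.
rewrite le_eqVlt => /orP[/eqP z0 Dz|]; last exact: (ext_deriv ext).
have := deviation_deriv_imaginary (Im z).
rewrite (_ : _ +i* _ = z); first by rewrite Dz /= => /esym/eqP; rewrite oppr_eq0 oner_eq0.
by case: z z0 {Dz} => /= u v <-.
Qed.

Lemma deviation_deriv_real_neq0 (t : R) : 0 <= t ->
    (forall j, (0 < j <= m)%N -> t <> x j) -> ~~ root D^`() t.
Proof.
move=> t0 tx; apply/negP => /eqP Dt.
have /(_ t%:C t0)[|j jm [tj]] := deviation_deriv_eq0; first by rewrite ceval_real Dt.
exact: tx tj.
Qed.

Lemma node_noroot j (t : R) : (j <= m)%N -> x j < t < x j.+1 -> ~~ root D^`() t.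
Proof.
move=> jm /andP[xt tx]; apply: deviation_deriv_real_neq0.
  by rewrite ltW// (lt_trans _ xt)// (lt_le_trans ext_a0)// ext_ge_a// leqW.
move=> i /andP[i0 im] ti; move: xt tx; rewrite ti.
have [ij|ji|->] := ltngtP i j; last by rewrite ltxx.
  by rewrite ltNge ltW// ext_mono// leqW.
by move=> _; rewrite ltNge; move: ji; rewrite leq_eqVlt => /orP[/eqP ->|ji];
  rewrite ?lexx// ltW// ext_mono// leqW.
Qed.

(** The derivative does not vanish between consecutive nodes, where [D] goes from
    [(-1)^j L] to its opposite. *)
Lemma deviation_between_nodes j (t : R) : (j <= m)%N -> x j < t < x j.+1 ->
  `|D.[t]| < L /\ (-1) ^+ j * D^`().[t] < 0.
Proof.
move=> jm tin; pose q := (-1) ^+ j.+1 *: D.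
have s1 : (-1) ^+ j * (-1) ^+ j = 1 :> R by rewrite -expr2 sqrr_sign.
have nr : {in `]x j, x j.+1[, forall t, ~~ root q^`() t}.
  move=> u; rewrite in_itv /= => uin.
  by rewrite derivZ rootZ ?signr_eq0//; exact: node_noroot uin.
have qj : q.[x j] = - L.
  by rewrite hornerZ (ext_val ext) ?leqW// exprS mulN1r mulrA mulNr s1 mulN1r.
have qj1 : q.[x j.+1] = L.
  by rewrite hornerZ (ext_val ext)// exprS mulN1r mulrA mulrNN s1 mul1r.
have qq : q.[x j] < q.[x j.+1] by rewrite qj qj1; have := L0; lra.
have xx := ext_lt ext jm.
have inc := noroot_increasing xx nr qq.
have der := noroot_deriv_gt0 xx nr qq.
have /andP[xt tx] := tin.
split.
  rewrite -[`|_|]mul1r -(normr_sign R j.+1) -normrM -hornerZ -/q ltr_norml -qj -qj1.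
  have tI : t \in `[x j, x j.+1] by rewrite in_itv /= !ltW.
  have jI : x j \in `[x j, x j.+1] by rewrite in_itv /= lexx ltW.
  have j1I : x j.+1 \in `[x j, x j.+1] by rewrite in_itv /= lexx ltW.
  by rewrite !inc// xt.
have := der t; rewrite in_itv /= => /(_ tin).
by rewrite derivZ hornerZ exprS mulN1r mulNr oppr_gt0.
Qed.

Lemma deviation_deriv0 : D^`().[0] = -1.
Proof.
by have := deviation_deriv_imaginary 0; rewrite (ceval_real D^`() 0).
Qed.

(** [D' 0 = -1] and [D'] has no zero before the first interior node. *)
Lemma deviation_decreasing : {in `[0, x 1] &, forall s t, (D.[s] < D.[t]) = (t < s)}.
Proof.
have x10 : 0 < x 1%N by rewrite (lt_le_trans ext_a0)// ext_ge_a.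
have nr : {in `[0, x 1[, forall t, ~~ root D^`() t}.
  move=> t; rewrite in_itv /= => /andP[t0 tx]; apply: deviation_deriv_real_neq0 => //.
  move=> j /andP[j0 jm] tj; move: tx; rewrite tj ltNge.
  move: j0; rewrite leq_eqVlt => /orP[/eqP <-|j1]; first by rewrite lexx.
  by rewrite ltW// ext_mono// leqW.
move=> s t sin tin; apply: (@gtr_horner _ D 0 (x 1%N)) => // u.
rewrite in_itv /= => /andP[u0 ux].
have := @polyrN0_itv _ `[0, x 1%N[ _ nr 0 u; rewrite !in_itv /= lexx x10 ux ltW//.
by move=> /(_ isT isT); rewrite deviation_deriv0 sgrN1 => /eqP; rewrite sgr_cp0.
Qed.

Lemma deviation_left (t : R) : 0 <= t -> t < a -> L < D.[t].
Proof.
move=> t0 ta; have <- : D.[a] = L by rewrite -(ext_first ext) (ext_val ext)// mul1r.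
have ax : a < x 1%N by rewrite -(ext_first ext) (ext_lt ext).
rewrite deviation_decreasing// in_itv /= ?t0 ?ltW ?ext_a0//.
exact: lt_trans ax.
Qed.

Lemma deviation_left_inj : {in `[0, a] &, injective (horner D)}.
Proof.
have ax : a < x 1%N by rewrite -(ext_first ext) (ext_lt ext).
have sub t : t \in `[0, a] -> t \in `[0, x 1%N].
  by rewrite !in_itv /= => /andP[-> ta]; rewrite (le_trans ta)// ltW.
move=> s t /sub sin /sub tin E.
have := deviation_decreasing sin tin; have := deviation_decreasing tin sin.
by rewrite E ltxx => /esym/negbT; rewrite -leNgt => ? /esym/negbT; rewrite -leNgt => ?;
  apply/eqP; rewrite eq_le; apply/andP; split.
Qed.

(** Beyond [x m] the derivative has no zero, so [D] keeps moving in the direction in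
    which it arrives at [x (m+1) = 1]. *)
Lemma deviation_right_increasing (T : R) : x m < T ->
  {in `[x m, T] &, forall s t,
     (((-1) ^+ m.+1 *: D).[s] < ((-1) ^+ m.+1 *: D).[t]) = (s < t)}.
Proof.
move=> mT; pose q := (-1) ^+ m.+1 *: D.
have s1 : (-1) ^+ m * (-1) ^+ m = 1 :> R by rewrite -expr2 sqrr_sign.
have nr U : {in `]x m, U[, forall t, ~~ root q^`() t}.
  move=> t; rewrite in_itv /= => /andP[mt _].
  rewrite derivZ rootZ ?signr_eq0//; apply: deviation_deriv_real_neq0.
    by rewrite ltW// (lt_trans _ mt)// (lt_le_trans ext_a0)// ext_ge_a.
  move=> j /andP[_ jm] tj; move: mt; rewrite tj ltNge.
  move: jm; rewrite leq_eqVlt => /orP[/eqP ->|jm]; first by rewrite lexx.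
  by rewrite ltW// ext_mono.
have xx := ext_lt ext (leqnn m).
have qm : q.[x m] < q.[x m.+1].
  rewrite !hornerZ !(ext_val ext)// exprS mulN1r !mulrA mulNr mulrNN s1.
  by have := L0; lra.
(* The interval is enlarged to contain the last node, where the value of D is known. *)
pose U := Num.max T (x m.+1).
have mU : x m < U by rewrite lt_max mT.
have inc1 := lgtr_horner mU (nr U).
have qU : q.[x m] < q.[U].
  have mi : x m \in `[x m, U] by rewrite in_itv /= lexx ltW.
  have m1i : x m.+1 \in `[x m, U] by rewrite in_itv /= ltW//= le_max lexx orbT.
  have Ui : U \in `[x m, U] by rewrite in_itv /= lexx ltW.
  move: qm; rewrite !inc1//; case: (_ < 0) => /=; rewrite ?expr0 ?expr1 ?mul1r// !mulN1r.
  by rewrite ltrN2 ltNge ltW.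
move=> s t; rewrite !in_itv /= => /andP[ms sT] /andP[mt tT].
have TU : T <= U by rewrite le_max lexx.
by rewrite (noroot_increasing mU (nr U) qU)// in_itv /= ?ms ?mt (le_trans _ TU).
Qed.

Lemma deviation_right (t : R) : 1 < t -> L < `|D.[t]|.
Proof.
move=> t1; have xx := ext_lt ext (leqnn m); rewrite (ext_last ext) in xx.
have s1 : (-1) ^+ m.+1 * (-1) ^+ m.+1 = 1 :> R by rewrite -expr2 sqrr_sign.
have := @deviation_right_increasing t (lt_trans xx t1) 1 t.
rewrite !in_itv /= lexx (ltW t1) (ltW xx) (ltW (lt_trans xx t1)) => /(_ isT isT).
have D1 : D.[1] = (-1) ^+ m.+1 * L by rewrite -(ext_val ext (leqnn _)) (ext_last ext).
rewrite !hornerZ D1 mulrA s1 mul1r t1.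
move=> h; rewrite (lt_le_trans h)// (le_trans (ler_norm _))//.
by rewrite normrM normr_sign mul1r.
Qed.

Lemma deviation_right_inj : {in `[1, +oo[ &, injective (horner D)}.
Proof.
have xx := ext_lt ext (leqnn m); rewrite (ext_last ext) in xx.
move=> s t; wlog st : s t / s < t => [hw|].
  move=> s1 t1 E; have [/hw|/hw|//] := ltgtP s t; first exact.
  by move=> /(_ t1 s1 (esym E)).
rewrite !in_itv /= !andbT => s1 t1 E.
have := @deviation_right_increasing t (lt_le_trans xx t1) s t.
rewrite !in_itv /= lexx (ltW st) (ltW (lt_le_trans xx s1)) (ltW (lt_le_trans xx t1)).
by move=> /(_ isT isT); rewrite !hornerZ E ltxx st.
Qed.

(** The intermediate value theorem gives one solution between each two consecutive
    nodes, [m + 1] in all.  A nonreal one would exceed the bound of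
    [size_deviation_level_roots]. *)
Lemma deviation_level_real (z : C) (s : R) : 0 < Re z -> `|s| < L ->
  ceval D z = s%:C -> Im z = 0.
Proof.
move=> z0 sL Dz.
have /choice[t ht] : forall j, exists t, (j <= m)%N -> x j < t < x j.+1 /\ D.[t] = s.
  move=> j; have [jm|_] := leqP j m; last by exists 0.
  have [||t] := @poly_ivtoo _ (D - s%:P) (x j) (x j.+1).
  - exact/ltW/(ext_lt ext).
  - have DsE u : (D - s%:P).[u] = D.[u] - s by rewrite hornerD hornerN hornerC.
    rewrite !DsE (ext_val ext (leqW jm)) (ext_val ext (jm : (j.+1 <= m.+1)%N)) exprS.
    move: sL; rewrite ltr_norml => /andP[s1 s2].
    have [->|->] : (-1) ^+ j = 1 :> R \/ (-1) ^+ j = -1 :> R.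
    - by rewrite -signr_odd; case: (odd j); [right|left].
    - by nra.
    - by nra.
  by rewrite in_itv /= => tin; rewrite rootE hornerD hornerN hornerC subr_eq0 => /eqP; exists t.
pose T : seq C := [seq (t j)%:C | j <- iota 0 m.+1].
have tpos j : (j <= m)%N -> 0 < t j.
  move=> jm; have [/andP[h _] _] := ht j jm.
  by rewrite (lt_trans _ h)// (lt_le_trans ext_a0)// ext_ge_a// leqW.
have tmono i j : (i < j)%N -> (j <= m)%N -> t i < t j.
  move=> ij jm; have [/andP[_ h1] _] := ht i (ltnW (leq_trans ij jm)).
  have [/andP[h2 _] _] := ht j jm.
  rewrite (lt_trans h1)// (le_lt_trans _ h2)//.
  by move: ij; rewrite leq_eqVlt => /orP[/eqP ->//|ij]; rewrite ltW// ext_mono// leqW.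
have uT : uniq T.
  rewrite map_inj_in_uniq ?iota_uniq// => i j; rewrite !mem_iota !add0n !ltnS /= => im jm [tij].
  by have [/tmono|/tmono|//] := ltngtP i j; [move=> /(_ jm)|move=> /(_ im)]; rewrite tij ltxx.
have hT : {in T, forall z, ceval (P - 'X) z = s%:C /\ 0 < Re z}.
  move=> _ /mapP[j + ->]; rewrite mem_iota add0n ltnS /= => jm.
  by rewrite ceval_real /=; have [_ ->] := ht j jm; rewrite tpos.
have P0 : P.[0] != s.
  have := deviation_left (lexx 0) ext_a0; rewrite !hornerE subr0.
  by move=> h; rewrite gt_eqF// (lt_trans _ h)// (le_lt_trans (ler_norm _) sL).
have [/mapP[j _ ->]//|zT] := boolP (z \in T).
have := size_deviation_level_roots (t := z :: T) (ext_even ext) (ext_size ext) P0.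
rewrite cons_uniq zT uT (_ : size (z :: T) = m.+2); last by rewrite /= size_map size_iota.
rewrite ltnn => /(_ isT) h.
exfalso; apply: notF; apply: h => w; rewrite inE => /orP[/eqP ->//|]; exact: hT.
Qed.

Lemma size_deviation : (1 < size D)%N.
Proof.
rewrite ltnNge; apply/negP => /size1_polyC DE.
by have := deviation_deriv0; rewrite DE derivC horner0 => /esym/eqP; rewrite oppr_eq0 oner_eq0.
Qed.

Lemma deviation_open (z0 : C) (e : R) : 0 < e ->
  exists2 d : R, 0 < d & forall w, normc (w - ceval D z0) < d ->
    exists2 z, normc (z - z0) < e & ceval D z = w.
Proof. by move=> e0; apply: poly_open => //; rewrite size_map_poly size_deviation. Qed.

(** The case [`|s| < L] is [deviation_level_real].  If [D z = L] or [D z = - L] at some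
    point of the quadrant, openness of [D] would give nearby points of the quadrant
    whose value is real and of modulus smaller than [L]. *)
Lemma deviation_quadrant (z : C) (s : R) : first_quadrant z -> `|s| <= L ->
  ceval D z <> s%:C.
Proof.
move=> [z0 z1]; rewrite le_eqVlt => /orP[/eqP sL|sL Dz]; last first.
  by move: z1; rewrite (deviation_level_real z0 sL Dz) ltxx.
move=> Dz; pose e := Num.min (Re z) (Im z).
have e0 : 0 < e by rewrite lt_min z0.
have [d d0 hd] := deviation_open z e0.
pose k := Num.min (1 / 2) (d / (2 * L)).
have k0 : 0 < k by rewrite lt_min !divr_gt0// mulr_gt0.
have k1 : k <= 1 / 2 by rewrite ge_min lexx.
have kd : k * L < d.
  have : k <= d / (2 * L) by rewrite ge_min lexx orbT.
  rewrite ler_pdivlMr ?mulr_gt0//; nra.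
have [z' zz' Dz'] : exists2 z', normc (z' - z) < e & ceval D z' = (s * (1 - k))%:C.
  apply: hd; rewrite Dz -rmorphB normcE_sqrt /= expr0n addr0 sqrtr_sqr.
  have -> : s * (1 - k) - s = - (k * s) by ring.
  by rewrite normrN normrM sL gtr0_norm.
have h1 := le_lt_trans (abs_Re_le (z' - z)) zz'.
have h2 := le_lt_trans (abs_Im_le (z' - z)) zz'.
rewrite ReB in h1; rewrite ImB in h2.
have eR : e <= Re z by rewrite ge_min lexx.
have eI : e <= Im z by rewrite ge_min lexx orbT.
move: h1 h2; rewrite !ltr_norml => /andP[? ?] /andP[? ?].
have : Im z' = 0.
  apply: (deviation_level_real _ _ Dz'); first lra.
  by rewrite normrM sL ger0_norm; [have := L0; nra|lra].
lra.
Qed.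

End Deviation.

(** * Complex exponential and cosine *)

Section ComplexFunctions.
Context {R : realType}.
Local Notation C := (R[i]^o).
Local Notation Re := (@complex.Re R).
Local Notation Im := (@complex.Im R).
Local Notation normc := (@Normc.normc R).

Definition cosh (v : R) : R := (expR v + expR (- v)) / 2.

Lemma sinh_gt0 (v : R) : (0 < sinh v) = (0 < v).
Proof. by rewrite /sinh pmulr_lgt0 ?invr_gt0// subr_gt0 ltr_expR; apply/idP/idP; lra. Qed.

Lemma sinhN (v : R) : sinh (- v) = - sinh v.
Proof. by rewrite /sinh opprK; field. Qed.

Lemma sinh_lt0 (v : R) : (sinh v < 0) = (v < 0).
Proof. by rewrite -oppr_gt0 -sinhN sinh_gt0 oppr_gt0. Qed.

Lemma sinh_eq0 (v : R) : sinh v = 0 -> v = 0.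
Proof.
have [v0|v0|//] := ltgtP v 0; first by rewrite -sinh_lt0 in v0; lra.
by rewrite -sinh_gt0 in v0; lra.
Qed.

Lemma cosh2Dsinh2 (v : R) : cosh v ^+ 2 = 1 + sinh v ^+ 2.
Proof.
have E : expR v * expR (- v) = 1 by rewrite -expRD subrr expR0.
by rewrite /cosh /sinh; nra.
Qed.

Lemma cosh_gt0 (v : R) : 0 < cosh v.
Proof. by rewrite divr_gt0// addr_gt0// expR_gt0. Qed.

Lemma cosh0 : cosh 0 = 1.
Proof. by rewrite /cosh oppr0 expR0; field. Qed.

Lemma sinh0 : sinh (0 : R) = 0.
Proof. by rewrite /sinh oppr0 subrr mul0r. Qed.

Lemma cosh_ge1 (v : R) : 1 <= cosh v.
Proof. by have := cosh2Dsinh2 v; have := cosh_gt0 v; nra. Qed.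

(** Together with [cosh_ge1], the reason why [cos w] real and in [[-1, 1]] forces [w]
    to be real when [sin (Re w) = 0]. *)
Lemma cosh_le1 (v : R) : cosh v <= 1 -> v = 0.
Proof.
move=> h; apply: sinh_eq0.
by have := cosh2Dsinh2 v; have := cosh_ge1 v; nra.
Qed.

Lemma cexpE (z : C) : cexp z = (expR (Re z))%:C * cis (Im z).
Proof. by []. Qed.

Lemma cexpD (z w : C) : cexp (z + w) = cexp z * cexp w.
Proof.
rewrite !cexpE; case: z w => [x y] [x' y'] /=.
by rewrite expRD cisD rmorphM /=; ring.
Qed.

Lemma cexp0 : cexp (0 : C) = 1.
Proof. by rewrite cexpE /= expR0 cis0 mulr1. Qed.

Lemma ccosE (w : C) :
  ccos w = cos (Re w) * cosh (Im w) +i* (- (sin (Re w) * sinh (Im w))).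
Proof.
case: w => u v; rewrite /ccos /cexp /cosh /sinh.
have -> : (0 +i* 1 : C) * (u +i* v) = - v +i* u by simpc.
have half (z : C) : z / 2 = Re z / 2 +i* (Im z / 2).
  apply: (canLR (mulfK _)); first by rewrite pnatr_eq0.
  apply/eqP; rewrite mulr_natr mulr2n eq_complex; case: z => x y /=.
  by apply/andP; split; apply/eqP; field.
by rewrite half /= cosN sinN opprK; congr (_ +i* _); field.
Qed.

(** The zeros of the sine are isolated from one another, and a continuous path
    cannot jump between them. *)
Lemma sin0_constant (f : R -> R) (a b : R) : a <= b ->
    {within `[a, b], continuous f} ->
    (forall t, a <= t <= b -> sin (f t) = 0) -> f b = f a.
Proof.
move=> ab cf sf.
suff nov v : 0 < `|v - f a| < pi ->
    ~ (Num.min (f a) (f b) <= v <= Num.max (f a) (f b)).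
  have p0 := @pi_gt0 R.
  apply/eqP; rewrite eq_le; apply/andP; split; rewrite leNgt; apply/negP => fab.
    pose e := Num.min (f b - f a) (pi / 2).
    have e0 : 0 < e by rewrite lt_min subr_gt0 fab divr_gt0.
    have e1 : e <= f b - f a by rewrite ge_min lexx.
    have e2 : e <= pi / 2 by rewrite ge_min lexx orbT.
    apply: (nov (f a + e)); first by rewrite addrAC subrr add0r gtr0_norm// e0; lra.
    by rewrite ge_min le_max; apply/andP; split; apply/orP; [left|right]; lra.
  pose e := Num.min (f a - f b) (pi / 2).
  have e0 : 0 < e by rewrite lt_min subr_gt0 fab divr_gt0.
  have e1 : e <= f a - f b by rewrite ge_min lexx.
  have e2 : e <= pi / 2 by rewrite ge_min lexx orbT.
  apply: (nov (f a - e)).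
    by rewrite addrAC subrr add0r normrN gtr0_norm// e0; lra.
  by rewrite ge_min le_max; apply/andP; split; apply/orP; [right|left]; lra.
move=> /andP[v0 vpi] vin.
have [t tin ft] := IVT ab cf vin.
have sv : sin v = 0 by rewrite -ft sf//; move: tin; rewrite in_itv.
have sa : sin (f a) = 0 by rewrite sf// lexx.
have s0 : sin (v - f a) = 0 by rewrite sinB sv sa mul0r mulr0 subrr.
have := @sin_gt0_pi R `|v - f a|; rewrite v0 vpi => /(_ isT).
by case: (ger0P (v - f a)) => _; rewrite ?sinN s0 ?oppr0 ltxx.
Qed.

(** The principal logarithm, by a formula that is valid on the right half-plane only. *)
Definition right_log (w : C) : C := ln (normc w) +i* atan (Im w / Re w).

Lemma right_logK (w : C) : 0 < Re w -> cexp (right_log w) = w.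
Proof.
move=> w0; have wE : w = (Re w)%:C * (1 +i* (Im w / Re w)).
  case: w w0 => x y /= x0; simpc; congr (_ +i* _).
  by rewrite mulrC divfK// gt_eqF.
have nw : normc w = Re w * Num.sqrt (1 + (Im w / Re w) ^+ 2).
  rewrite {1}wE Normc.normcM !normcE_sqrt /= expr0n addr0 sqrtr_sqr gtr0_norm//.
  by rewrite expr1n.
rewrite cexpE /= lnK ?posrE; last first.
  by rewrite nw mulr_gt0// sqrtr_gt0 ltr_wpDr// sqr_ge0.
by rewrite nw rmorphM -mulrA -cis_atan -wE.
Qed.

Lemma right_log_cvg T (F : set_system T) {FF : Filter F} (f : T -> C) (l : C) :
  0 < Re l -> f @ F --> l -> right_log (f x) @[x --> F] --> right_log l.
Proof.
move=> l0 fl; have [fr fi] := (@cvg_complexP R T F FF f l).1 fl.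
apply/cvg_complexP; split => /=.
  apply: (cvg_comp (fun x => normc (f x)) (@ln R)).
    exact: (cvg_normc fl).
  apply: continuous_ln; rewrite (lt_le_trans l0)// (le_trans (ler_norm _))//.
  exact: abs_Re_le.
apply: (cvg_comp (fun x => Im (f x) / Re (f x)) (@atan R)); last exact: continuous_atan.
by apply: cvgM => //; apply: cvgV => //; rewrite gt_eqF.
Qed.

Lemma cts_right_log (T : topologicalType) (f : T -> C) (x : T) :
  0 < Re (f x) -> continuous_at x f -> continuous_at x (fun t => right_log (f t)).
Proof. by move=> f0 fx; apply: (@right_log_cvg T (nbhs x) _ f _ f0 fx). Qed.

(** One of [c], [- c], [ic] and [- ic] lies in the right half-plane, where [right_log]
    is available. *)
Lemma cexp_surj (c : C) : c != 0 -> exists l, cexp l = c.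
Proof.
move=> c0.
suff [u [l [lu ru u0]]] : exists u l : C,
    [/\ cexp l = u, 0 < Re (c * u^-1) & u != 0].
  exists (l + right_log (c * u^-1)).
  by rewrite cexpD lu right_logK// mulrC divfK.
have ci : cexp (0 +i* (pi / 2) : C) = 0 +i* 1.
  by rewrite cexpE /= expR0 /cis cos_pihalf sin_pihalf mul1r.
have cpi : cexp (0 +i* pi : C) = -1.
  rewrite cexpE /= expR0 /cis cospi sinpi mul1r.
  by apply/eqP; rewrite eq_complex /= oppr0 !eqxx.
have N1 : (-1 : C) != 0 by rewrite oppr_eq0 oner_eq0.
have [r0|r0|r0] := ltgtP (Re c) 0.
- exists (-1), (0 +i* pi); split=> //.
  by rewrite invrN1 mulrN1; case: c r0 {c0} => /= p q; rewrite oppr_gt0.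
- exists 1, 0; split; [exact: cexp0|by rewrite invr1 mulr1|exact: oner_neq0].
have i0 : (0 +i* 1 : C) != 0 by rewrite eq_complex /= oner_eq0 andbF.
have iV : (0 +i* 1 : C)^-1 = 0 +i* (-1).
  apply: (mulfI i0); rewrite mulfV//.
  by apply/eqP; rewrite eq_complex /=; apply/andP; split; apply/eqP; ring.
have Rei : Re (c * (0 +i* (-1))) = Im c by case: c {c0 r0} => p q /=; ring.
have [qn|qp|qz] := ltgtP (Im c) 0.
- exists (- (0 +i* 1)), ((0 +i* pi) + (0 +i* (pi / 2))); split.
  + by rewrite cexpD ci cpi mulN1r.
  + have -> : c * (- (0 +i* 1))^-1 = - (c * (0 +i* (-1))) by rewrite invrN iV mulrN.
    by rewrite -(sub0r (c * _)) ReB Rei sub0r oppr_gt0.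
  + by rewrite oppr_eq0.
- by exists (0 +i* 1), (0 +i* (pi / 2)); split=> //; rewrite iV Rei.
- by move: c0; rewrite eq_complex r0 qz !eqxx.
Qed.

End ComplexFunctions.

(** * Continuous square roots and logarithms *)

Section Lifting.
Context {R : realType}.
Local Notation C := (R[i]^o).
Local Notation Re := (@complex.Re R).
Local Notation Im := (@complex.Im R).
Local Notation normc := (@Normc.normc R).

(** Modulus and real part being continuous, so is this function, on the whole plane.
    It squares to [w] only on the closed upper half-plane; below the real axis it
    squares to the conjugate of [w]. *)
Definition upper_sqrt (w : C) : C :=
  Num.sqrt ((normc w + Re w) / 2) +i* Num.sqrt ((normc w - Re w) / 2).

Lemma upper_sqrtK (w : C) : 0 <= Im w -> upper_sqrt w * upper_sqrt w = w.
Proof.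
move=> w0; have := abs_Re_le w; rewrite ler_norml => /andP[h1 h2].
have a0 : 0 <= (normc w + Re w) / 2 by rewrite divr_ge0//; lra.
have b0 : 0 <= (normc w - Re w) / 2 by rewrite divr_ge0//; lra.
have n2 : normc w ^+ 2 = Re w ^+ 2 + Im w ^+ 2.
  by rewrite normcE_sqrt sqr_sqrtr// addr_ge0// sqr_ge0.
have ab : Num.sqrt ((normc w + Re w) / 2) * Num.sqrt ((normc w - Re w) / 2) = Im w / 2.
  rewrite -sqrtrM// -[RHS]ger0_norm ?divr_ge0// -sqrtr_sqr; congr Num.sqrt.
  by rewrite !expr2 in n2 *; nra.
apply/eqP; rewrite eq_complex /=; apply/andP; split; apply/eqP.
  by rewrite -!expr2 !sqr_sqrtr//; field.
by rewrite [X in _ + X]mulrC ab; field.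
Qed.

Lemma upper_sqrt_cvg T (F : set_system T) {FF : Filter F} (f : T -> C) (l : C) :
  f @ F --> l -> upper_sqrt (f x) @[x --> F] --> upper_sqrt l.
Proof.
move=> fl; have [fr _] := (@cvg_complexP R T F FF f l).1 fl.
have fn := @cvg_normc _ T F FF f l fl.
apply/cvg_complexP; split => /=.
  apply: (cvg_comp (fun x => (normc (f x) + Re (f x)) / 2) (@Num.sqrt R)); last exact: sqrt_continuous.
  by apply: cvgM; [exact: (cvgD fn fr)|exact: cvg_cst].
apply: (cvg_comp (fun x => (normc (f x) - Re (f x)) / 2) (@Num.sqrt R)); last exact: sqrt_continuous.
by apply: cvgM; [exact: (cvgB fn fr)|exact: cvg_cst].
Qed.

Lemma cts_upper_sqrt (T : topologicalType) (f : T -> C) (x : T) :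
  continuous_at x f -> continuous_at x (fun t => upper_sqrt (f t)).
Proof. by move=> fx; apply: (@upper_sqrt_cvg T (nbhs x) _ f _ fx). Qed.

Definition closed_quadrant : set C := [set z | 0 <= Re z /\ 0 <= Im z].

(** A point [rho] outside the open quadrant lies below it or to its left, so that
    either [z - rho] or [i (z - rho)] stays in the closed upper half-plane. *)
Lemma sqrt_linear (rho : C) : ~ first_quadrant rho ->
  exists s : C -> C, continuous s /\
    forall z, closed_quadrant z -> s z * s z = z - rho.
Proof.
move=> nq; have [Im0|Im0] := leP (Im rho) 0.
  exists (fun z => upper_sqrt (z - rho)); split.
    move=> z; apply: cts_upper_sqrt; apply: ctsD; first exact: cts_id.
    exact: cts_cst.
  by move=> z [z0 z1]; rewrite upper_sqrtK// ImB; lra.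
have Re0 : Re rho <= 0.
  by rewrite leNgt; apply/negP => Re0; apply: nq.
pose c : C := sqrtc (- (0 +i* 1)).
have cc : c * c = - (0 +i* 1) by rewrite -expr2 sqr_sqrtc.
exists (fun z => c * upper_sqrt ((0 +i* 1) * (z - rho))); split.
  move=> z; apply: ctsM; first exact: cts_cst.
  apply: cts_upper_sqrt; apply: ctsM; first exact: cts_cst.
  by apply: ctsD; [exact: cts_id|exact: cts_cst].
move=> z [z0 z1]; rewrite mulrACA cc upper_sqrtK; last first.
  have -> : Im ((0 +i* 1) * (z - rho)) = Re (z - rho) by case: (z - rho) => p q /=; ring.
  by rewrite ReB; lra.
rewrite mulrA mulNr; have -> : (0 +i* 1) * (0 +i* 1) = -1 :> C.
  by apply/eqP; rewrite eq_complex /=; apply/andP; split; apply/eqP; ring.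
by rewrite opprK mul1r.
Qed.

(** The product of the square roots of the linear factors, each of them continuous
    up to the boundary even though some roots may lie on it. *)
Lemma sqrt_poly (p : {poly C}) : p != 0 ->
    (forall z, first_quadrant z -> p.[z] != 0) ->
  exists s : C -> C, continuous s /\
    forall z, closed_quadrant z -> s z * s z = p.[z].
Proof.
move=> p0 hp; have [rs _ [pE rsE]] := poly_roots_seq p0.
have nq : {in rs, forall rho, ~ first_quadrant rho}.
  by move=> rho; rewrite -rsE => /eqP r0 /hp; rewrite r0 eqxx.
suff [s [cs hs]] : exists s : C -> C, continuous s /\
    forall z, closed_quadrant z -> s z * s z = \prod_(rho <- rs) (z - rho).
  exists (fun z => sqrtc (lead_coef p) * s z); split.
    by move=> z; apply: ctsM; [exact: cts_cst|exact: cs].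
  by move=> z zq; rewrite mulrACA hs// -expr2 sqr_sqrtc pE.
elim: rs nq {pE rsE} => [_|rho rs IH nq].
  exists (fun=> 1); split; first by move=> z; exact: cts_cst.
  by move=> z _; rewrite big_nil mulr1.
have [|s [cs hs]] := IH; first by move=> r rrs; apply: nq; rewrite inE rrs orbT.
have [t [ct ht]] := sqrt_linear (nq _ (mem_head _ _)).
exists (fun z => t z * s z); split.
  by move=> z; apply: ctsM; [exact: ct|exact: cs].
by move=> z zq; rewrite mulrACA hs// ht// big_cons.
Qed.

Section Logarithm.
Variable F : C -> C.
Hypothesis Fc : continuous F.
Hypothesis F0 : forall z, F z != 0.

(** By compactness, [F z] and [F w] differ by less than a right angle as soon as [z]
    and [w] are close. *)
Lemma uniform_ratio (r : R) : exists2 d : R, 0 < d & forall z w,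
  normc z < r -> normc w < r -> normc (z - w) < d -> 0 < Re (F z / F w).
Proof.
pose K : set C := [set z | - r <= Re z <= r /\ - r <= Im z <= r].
have Kr z : normc z < r -> K z.
  move=> zr; have := le_lt_trans (abs_Re_le z) zr; have := le_lt_trans (abs_Im_le z) zr.
  by rewrite !ltr_norml => /andP[? ?] /andP[? ?]; split; rewrite !ltW.
pose T := (K `*` K) `&` [set p : C * C | Re (F p.1 / F p.2) <= 0].
have [T0|T0] := pselect (T !=set0); last first.
  exists 1 => // z w zr wr _; rewrite ltNge; apply/negP => h; apply: T0.
  by exists (z, w); split; [split; exact: Kr|].
have cT : compact T.
  apply: compact_closedI; first by apply: compact_setX; exact: compact_box.
  apply: (@closed_comp _ _ (fun p : C * C => Re (F p.1 / F p.2)) [set x | x <= 0]); last exact: closed_le.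
  move=> p _; apply: cts_Re.
    apply: ctsM; first by apply: (@cts_comp _ _ _ fst F); [exact: cts_fst|exact: Fc].
    by apply: ctsV => //; apply: (@cts_comp _ _ _ snd F); [exact: cts_snd|exact: Fc].
have [|p pT hp] := @compact_EVT_min _ R (fun p : C * C => normc (p.1 - p.2)) T T0 cT.
  apply: continuous_subspaceT => p; apply: cts_normc; apply: ctsD; first exact: cts_fst.
  by apply: ctsN; exact: cts_snd.
exists (normc (p.1 - p.2)).
  rewrite lt_def normc_ge0 andbT; apply/eqP => /Normc.eq0_normc/subr0_eq pp.
  move: pT; rewrite inE => -[_] /=; rewrite pp mulfV//= => h.
  by have := @ltr01 R; rewrite ltNge h.
move=> z w zr wr zw; rewrite ltNge; apply/negP => h.
have := hp (z, w); rewrite inE => /(_ _) h'.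
have : normc (p.1 - p.2) <= normc (z - w) by apply: h'; split; [split; exact: Kr|].
by rewrite leNgt zw.
Qed.

(** Each radius is divided into steps so short that consecutive values have a ratio
    in the right half-plane; the principal logarithms of the ratios add up to a
    logarithm that is continuous in the endpoint. *)
Lemma log_on_disc (r : R) (l0 : C) : 0 < r -> cexp l0 = F 0 ->
  exists g : C -> C, g 0 = l0 /\ forall z : C, normc z < r ->
    continuous_at z g /\ cexp (g z) = F z.
Proof.
move=> r0 El0; have [d d0 hd] := uniform_ratio r.
pose N := Num.bound (r / d).
have Nr : r / d < N%:R by apply: archi_boundP; rewrite divr_ge0 ?ltW.
have N0 : (0 : R) < N%:R by apply: lt_trans Nr; rewrite divr_gt0.
pose pt (z : C) (k : nat) : C := (k%:R / N%:R)%:C * z.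
have pt_lt z k : normc z < r -> (k <= N)%N -> normc (pt z k) < r.
  move=> zr kN; rewrite Normc.normcM normcE_sqrt /= expr0n addr0 sqrtr_sqr.
  rewrite ger0_norm ?divr_ge0// (le_lt_trans _ zr)// ler_piMl ?normc_ge0//.
  by rewrite ler_pdivrMr// mul1r ler_nat.
have pt_step z k : normc z < r -> normc (pt z k.+1 - pt z k) < d.
  move=> zr; rewrite /pt -mulrBl -rmorphB -mulrBl -natrB// subSnn.
  rewrite Normc.normcM normcE_sqrt /= expr0n addr0 sqrtr_sqr.
  rewrite ger0_norm ?divr_ge0// mul1r mulrC ltr_pdivrMr// mulrC.
  by move: Nr; rewrite ltr_pdivrMr//; exact: lt_trans.
have ratio z k : normc z < r -> (k < N)%N -> 0 < Re (F (pt z k.+1) / F (pt z k)).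
  by move=> zr kN; apply: hd; [exact: pt_lt|apply: pt_lt => //; exact: ltnW|exact: pt_step].
pose g z := l0 + \sum_(0 <= k < N) right_log (F (pt z k.+1) / F (pt z k)).
exists g; split.
  rewrite /g big1 ?addr0// => k _; rewrite /pt !mulr0 mulfV//.
  rewrite /right_log Normc.normc1 ln1 /= mul0r atan0.
  by [].
move=> z zr; split.
  apply: (@ctsD _ _ _ (fun=> l0)); first exact: cts_cst.
  apply: cts_sum => k kN; apply: cts_right_log; first exact: ratio.
  have cpt i : continuous_at z (fun w => F (pt w i)).
    apply: (@cts_comp _ _ _ (fun w => pt w i) F); last exact: Fc.
    by apply: ctsM; [exact: cts_cst|exact: cts_id].
  by apply: ctsM => //; exact: ctsV.
have tel n : (n <= N)%N ->
    cexp (l0 + \sum_(0 <= k < n) right_log (F (pt z k.+1) / F (pt z k))) = F (pt z n).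
  elim: n => [_|n IH nN]; first by rewrite big_geq// addr0 El0 /pt mul0r mul0r.
  rewrite big_nat_recr//= addrA cexpD IH 1?ltnW// right_logK; last exact: ratio.
  by rewrite mulrC divfK.
by rewrite /g tel// /pt divff ?gt_eqF// mul1r.
Qed.

(** The logarithms on concentric discs agree: along a radius their difference is a
    continuous function with values in the multiples of [2 i pi], and it vanishes at
    the centre. *)
Lemma continuous_log : exists l : C -> C, continuous l /\ forall z, cexp (l z) = F z.
Proof.
have [l0 El0] := cexp_surj (F0 0).
have /choice[G hG] : forall r : R, exists g : C -> C, 0 < r ->
    g 0 = l0 /\ forall z : C, normc z < r -> continuous_at z g /\ cexp (g z) = F z.
  move=> r; have [r0|_] := ltP 0 r; last by exists (fun=> 0).
  by have [g hg] := log_on_disc r0 El0; exists g.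
have agree r s z : normc z < r -> normc z < s -> G r z = G s z.
  move=> zr zs.
  have r0 : 0 < r by exact: le_lt_trans (normc_ge0 z) zr.
  have s0 : 0 < s by exact: le_lt_trans (normc_ge0 z) zs.
  have [Gr0 hr] := hG r r0; have [Gs0 hs] := hG s s0.
  pose h (t : R) : C := G r (t%:C * z) - G s (t%:C * z).
  have tz t : 0 <= t <= 1 -> normc (t%:C * z) <= normc z.
    move=> /andP[t0 t1]; rewrite Normc.normcM normcE_sqrt /= expr0n addr0 sqrtr_sqr.
    by rewrite ger0_norm// ler_piMl ?normc_ge0.
  have hexp t : 0 <= t <= 1 -> cexp (h t) = 1.
    move=> t01; have [_ e1] := hr _ (le_lt_trans (tz _ t01) zr).
    have [_ e2] := hs _ (le_lt_trans (tz _ t01) zs).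
    apply: (mulIf (F0 (t%:C * z))); rewrite mul1r -{1}e2 -cexpD.
    by rewrite /h subrK.
  have hRe t : 0 <= t <= 1 -> Re (h t) = 0 /\ sin (Im (h t)) = 0.
    move=> /hexp; rewrite cexpE /cis; case: (h t) => p q /=; simpc => -[e1 e2].
    have ep := expR_gt0 p.
    have sq : sin q = 0 by apply/eqP; move/eqP: e2; rewrite mulf_eq0 gt_eqF.
    have := cos2Dsin2 q; rewrite sq expr0n addr0 => c2.
    have e3 : expR p ^+ 2 = 1.
      by have := congr1 (fun x => x ^+ 2) e1; rewrite exprMn c2 mulr1 expr1n.
    split=> //; apply: expR_inj; rewrite expR0; nra.
  have hcont : {within `[0, 1], continuous (fun t => Im (h t))}.
    apply: continuous_in_subspaceT => t; rewrite inE /= in_itv /= => t01.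
    have [c1 _] := hr _ (le_lt_trans (tz _ t01) zr).
    have [c2 _] := hs _ (le_lt_trans (tz _ t01) zs).
    have ctz : continuous_at t (fun t : R => t%:C * z : C).
      by apply: ctsM; [apply: cts_real_complex; exact: cts_id|exact: cts_cst].
    apply: (@cts_Im _ _ _ h); apply: ctsD; first exact: (cts_comp ctz c1).
    by apply: ctsN; exact: (cts_comp ctz c2).
  have h10 : Im (h 1) = Im (h 0).
    apply: (sin0_constant _ hcont) => // t t01.
    by have [] := hRe t t01.
  have h00 : h 0 = 0 by rewrite /h mul0r Gr0 Gs0 subrr.
  apply/eqP; rewrite -subr_eq0 -[z]mul1r -/(h 1) eq_complex h10 h00 eqxx andbT.
  by have [-> _] := hRe 1 ltac:(by rewrite ler01 lexx).
exists (fun z => G (normc z + 1) z); split; last first.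
  move=> z; have [_ h] := hG (normc z + 1) ltac:(by have := normc_ge0 z; lra).
  by have [] := h z ltac:(lra).
move=> z; pose r := normc z + 1.
have r0 : 0 < r by rewrite ltr_wpDl// normc_ge0.
have zr : normc z < r by rewrite ltrDl.
have [_ hr] := hG r r0; have [cr _] := hr z zr.
apply: (cts_near_eq ltr01 _ cr) => w wz; apply: agree; last by rewrite ltrDl.
have := le_normcD (w - z) z; rewrite subrK /r => h; rewrite (le_lt_trans h)// addrC.
by rewrite ltrD2l.
Qed.

End Logarithm.

End Lifting.

(** * Closed quadrant, divided differences, paths with positive sine *)

Section Boundary.
Context {R : realType}.
Local Notation C := (R[i]^o).
Local Notation Re := (@complex.Re R).
Local Notation Im := (@complex.Im R).
Local Notation normc := (@Normc.normc R).

(** Extends functions given on the closed quadrant continuously to the plane, so that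
    [continuous_log] applies. *)
Definition retract (z : C) : C := Num.max (Re z) 0 +i* Num.max (Im z) 0.

Lemma retract_in (z : C) : closed_quadrant (retract z).
Proof. by split; rewrite /= le_max lexx orbT. Qed.

Lemma retract_id (z : C) : closed_quadrant z -> retract z = z.
Proof. by case: z => x y [/= x0 y0]; rewrite /retract /= !max_l. Qed.

Lemma retract_continuous : continuous retract.
Proof.
move=> z; apply: cts_complex.
  apply: (@cts_comp _ _ _ _ (fun x : R => Num.max x 0)); first by apply: cts_Re; exact: cts_id.
  by apply: (@continuous_max R R (fun x => x) (fun=> 0)); [exact: cts_id|exact: cvg_cst].
apply: (@cts_comp _ _ _ _ (fun x : R => Num.max x 0)); first by apply: cts_Im; exact: cts_id.
by apply: (@continuous_max R R (fun x => x) (fun=> 0)); [exact: cts_id|exact: cvg_cst].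
Qed.

Lemma first_quadrant_closed (z : C) : first_quadrant z -> closed_quadrant z.
Proof. by move=> [/ltW ? /ltW ?]. Qed.

Lemma first_quadrant_near (z : C) (e : R) : closed_quadrant z -> 0 < e ->
  exists2 w, first_quadrant w & normc (w - z) < e.
Proof.
move=> [z0 z1] e0; exists (z + (e / 3 +i* (e / 3))).
  by case: z z0 z1 => x y /= x0 y0; split => /=; rewrite ltr_wpDl// divr_gt0.
rewrite addrAC subrr add0r (le_lt_trans (normc_le _))//= gtr0_norm ?divr_gt0//; lra.
Qed.

(** Written as a polynomial in both variables: it remains defined, and continuous, on
    the diagonal. *)
Definition divided_difference (p : {poly C}) (z w : C) : C :=
  \sum_(0 <= k < size p) p`_k * \sum_(0 <= i < k) z ^+ (k.-1 - i) * w ^+ i.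

Lemma divided_differenceE (p : {poly C}) (z w : C) :
  p.[z] - p.[w] = (z - w) * divided_difference p z w.
Proof.
rewrite !horner_coef -sumrB /divided_difference big_mkord mulr_sumr.
apply: eq_bigr => k _; rewrite -mulrBr subrXX big_mkord mulrCA; congr (_ * (_ * _)).
Qed.

Lemma divided_difference_diag (p : {poly C}) (z : C) :
  divided_difference p z z = p^`().[z].
Proof.
rewrite -[X in X^`()]coefK poly_def raddf_sum horner_sum /divided_difference big_mkord.
apply: eq_bigr => k _ /=; rewrite derivZ derivXn hornerZ hornerMn hornerXn.
congr (_ * _); rewrite big_mkord (eq_bigr (fun=> z ^+ k.-1)).
  by rewrite sumr_const card_ord.
move=> i _; rewrite -exprD subnK//.
by rewrite -ltnS (leq_trans (ltn_ord i))// leqSpred.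
Qed.

Lemma cts_exp (T : topologicalType) (x : T) (f : T -> C) (n : nat) :
  continuous_at x f -> continuous_at x (fun t => f t ^+ n).
Proof.
move=> fx; elim: n => [|n IH]; first exact: cts_cst.
have -> : (fun t => f t ^+ n.+1) = (fun t => f t * f t ^+ n).
  by apply/funext => t; rewrite exprS.
exact: ctsM.
Qed.

Lemma cts_divided_difference (p : {poly C}) (T : topologicalType) (x : T) (f g : T -> C) :
  continuous_at x f -> continuous_at x g ->
  continuous_at x (fun t => divided_difference p (f t) (g t)).
Proof.
move=> fx gx; apply: cts_sum => k _; apply: ctsM; first exact: cts_cst.
by apply: cts_sum => i _; apply: ctsM; exact: cts_exp.
Qed.

Lemma cts_horner (p : {poly C}) (T : topologicalType) (x : T) (f : T -> C) :
  continuous_at x f -> continuous_at x (fun t => p.[f t]).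
Proof.
move=> fx; have -> : (fun t => p.[f t]) = (fun t => \sum_(0 <= k < size p) p`_k * f t ^+ k).
  by apply/funext => t; rewrite horner_coef big_mkord.
by apply: cts_sum => k _; apply: ctsM; [exact: cts_cst|exact: cts_exp].
Qed.

(** A path that starts at [0] and has positive sine cannot touch [0] or [pi] again
    before its end. *)
Lemma sin_gt0_path (f : R -> R) (a b : R) : a <= b ->
    {within `[a, b], continuous f} -> f a = 0 ->
    (forall t, a < t < b -> 0 < sin (f t)) ->
  (forall t, a < t < b -> 0 < f t < pi) /\ 0 <= f b <= pi.
Proof.
move=> ab cf fa sf; have p0 := @pi_gt0 R.
have cft t : t <= b -> {within `[a, t], continuous f}.
  by move=> tb; apply: continuous_subspaceW cf => s /=; rewrite !in_itv /= => /andP[-> /le_trans ->].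
have hit t v : a <= t <= b -> 0 < v < f t \/ f t < v < 0 ->
    exists2 s, a < s < t & f s = v.
  move=> /andP[at_ tb] hv.
  have [|s sin fs] := IVT at_ (cft t tb) (v := v).
    rewrite fa ge_min le_max.
    by case: hv => /andP[h1 h2]; rewrite !(ltW h1) !(ltW h2) ?orbT.
  exists s => //; move: sin; rewrite in_itv /= => /andP[as_ st].
  rewrite !lt_neqAle as_ st !andbT; apply/andP; split; apply/eqP => E.
    by move: hv; rewrite -fs -E fa ltxx; case=> /andP[] //; rewrite ltxx.
  by move: hv; rewrite -fs -E ltxx; case=> /andP[] //; rewrite ltxx.
have up t : a <= t <= b -> f t <= pi.
  move=> tab; rewrite leNgt; apply/negP => h.
  have [|s /andP[as_ st] fs] := hit t pi tab; first by left; rewrite p0.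
  have := sf s; rewrite as_ fs sinpi ltxx (lt_le_trans st)//; last by case/andP: tab.
  by move=> /(_ isT).
have down t : a <= t <= b -> 0 <= f t.
  move=> tab; rewrite leNgt; apply/negP => h.
  (* A value between f t and 0 at which the sine is negative. *)
  pose v := Num.max (f t / 2) (- (pi / 2)).
  have v0 : v < 0 by rewrite gt_max; apply/andP; split; lra.
  have v1 : f t < v by rewrite lt_max; apply/orP; left; lra.
  have v2 : - (pi / 2) <= v by rewrite le_max lexx orbT.
  have [|s /andP[as_ st] fs] := hit t v tab; first by right; rewrite v0 v1.
  have := sf s; rewrite as_ (lt_le_trans st) ?fs => [/(_ isT)|]; last by case/andP: tab.
  have : 0 < sin (- v) by apply: sin_gt0_pi; apply/andP; split; lra.
  by rewrite sinN; lra.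
split; last by rewrite up ?down ?ab ?lexx.
move=> t /andP[at_ tb]; have tab : a <= t <= b by rewrite !ltW.
have := sf t; rewrite at_ tb => /(_ isT) st.
rewrite !lt_neqAle up ?down// !andbT; apply/andP; split; apply/eqP => E.
  by move: st; rewrite -E sin0 ltxx.
by move: st; rewrite E sinpi ltxx.
Qed.

End Boundary.

(** * The branch of the arccosine *)

Section ArccosineLift.
Context {R : realType}.
Local Notation C := (R[i]^o).
Local Notation Re := (@complex.Re R).
Local Notation Im := (@complex.Im R).
Local Notation normc := (@Normc.normc R).

Variables (m : nat) (a L : R) (P : {poly R}) (x : nat -> R).
Hypothesis ext : extremal m a L P x.
Let D := P - 'X.
Let L0 : 0 < L := ext_L ext.

Lemma cts_ceval (p : {poly R}) (T : topologicalType) (t : T) (f : T -> C) :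
  continuous_at t f -> continuous_at t (fun t => ceval p (f t)).
Proof. exact: cts_horner. Qed.

Lemma ccosN (w : C) : ccos (- w) = ccos w.
Proof. by rewrite !ccosE; case: w => u v /=; rewrite cosN sinN sinhN mulrNN /cosh opprK [expR (- v) + _]addrC. Qed.

Lemma ccosB_period (w : C) (c : R) : cos c = 1 -> sin c = 0 ->
  ccos (w - c%:C) = ccos w.
Proof.
move=> cc sc; rewrite !ccosE ReB ImB /= subr0 cosB sinB cc sc.
by rewrite !mulr1 !mulr0 addr0 subr0.
Qed.

(** If [S^2 = L^2 - D^2], the functions [(D + i S) / L] and [(D - i S) / L] are inverse
    to each other and have half-sum [D / L].  With [l] a logarithm of the first one,
    [- i l] is therefore an arccosine of [D / L]. *)
Lemma arccosine_lift : exists f : C -> C, continuous f /\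
  forall z, closed_quadrant z -> L%:C * ccos (f z) = ceval D z.
Proof.
pose DC := map_poly (real_complex R) D; pose p := (L ^+ 2)%:C%:P - DC ^+ 2.
have pE z : p.[z] = L%:C ^+ 2 - ceval D z ^+ 2.
  by rewrite hornerD hornerN hornerC horner_exp rmorphXn.
have pn0 z : first_quadrant z -> p.[z] != 0.
  move=> zq; rewrite pE subr_eq0 eq_sym eqf_sqr -rmorphN; apply/negP => /orP[|] /eqP.
    by apply: (deviation_quadrant ext zq); rewrite gtr0_norm.
  by apply: (deviation_quadrant ext zq); rewrite normrN gtr0_norm.
have p0 : p != 0.
  apply/eqP => E; have := pn0 (1 +i* 1); rewrite E horner0 eqxx => h.
  by apply: notF; apply: h; split.
have [S [cS hS]] := sqrt_poly p0 pn0.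
have LC0 : L%:C != 0 :> C by rewrite eq_complex /= gt_eqF.
pose F z : C := (ceval D (retract z) + (0 +i* 1) * S (retract z)) / L%:C.
pose G z : C := (ceval D (retract z) - (0 +i* 1) * S (retract z)) / L%:C.
have ii : (0 +i* 1) * (0 +i* 1) = -1 :> C.
  by apply/eqP; rewrite eq_complex /=; apply/andP; split; apply/eqP; ring.
have FG z : F z * G z = 1.
  have e (A B k : C) : (A + k * B) * (A - k * B) = A ^+ 2 - (k * k) * (B * B) by ring.
  rewrite /F /G mulrACA e ii hS; last exact: retract_in.
  rewrite pE mulN1r opprK addrC subrK -expr2 exprVn divff//.
  by rewrite sqrf_eq0.
have F0 z : F z != 0.
  by apply/eqP => Fz; have := FG z; rewrite Fz mul0r => /eqP; rewrite eq_sym oner_eq0.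
have Fc : continuous F.
  move=> z; apply: ctsM; last exact: cts_cst.
  apply: ctsD; first by apply: cts_ceval; exact: retract_continuous.
  apply: ctsM; first exact: cts_cst.
  by apply: (@cts_comp _ _ _ retract S); [exact: retract_continuous|exact: cS].
have [l [cl hl]] := continuous_log Fc F0.
exists (fun z => - (0 +i* 1) * l z); split.
  by move=> z; apply: ctsM; [exact: cts_cst|exact: cl].
move=> z zq; rewrite /ccos.
have -> : (0 +i* 1) * (- (0 +i* 1) * l z) = l z by rewrite mulrA mulrN ii opprK mul1r.
have hln : cexp (- l z) = G z.
  apply: (mulfI (F0 z)); rewrite FG -hl -cexpD subrr; exact: cexp0.
rewrite hl hln /F /G retract_id// -mulrDl addrACA subrr addr0 -mulr2n -[_ *+ 2]mulr_natr.
by rewrite [L%:C * _]mulrC mulrAC divfK// mulfK// pnatr_eq0.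
Qed.

(** Separates [L cos w = t] into imaginary and real part.  The next lemmas draw the
    consequences: where [D] is real, its size relative to [L] decides whether the
    branch is real or lies on a vertical line [Re w = k pi]. *)
Lemma ccos_real (w : C) (t : R) : L%:C * ccos w = t%:C ->
  sin (Re w) * sinh (Im w) = 0 /\ L * (cos (Re w) * cosh (Im w)) = t.
Proof.
move=> h; have := congr1 Re h; have := congr1 Im h.
rewrite ccosE /= !mul0r addr0 subr0 => /eqP hi ->; split=> //.
by apply/eqP; move: hi; rewrite mulrN oppr_eq0 mulf_eq0 gt_eqF.
Qed.

Lemma ccos_real_le (w : C) (t : R) : L%:C * ccos w = t%:C -> `|t| <= L -> Im w = 0.
Proof.
move=> /ccos_real[ss ct] tL; have ch := cosh_ge1 (Im w).
move/eqP: ss; rewrite mulf_eq0 => /orP[/eqP s0|/eqP/sinh_eq0//].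
have := sin0cos1 s0 => c1; apply: cosh_le1.
by move: tL; rewrite -ct 2!normrM c1 mul1r (gtr0_norm L0) (gtr0_norm (cosh_gt0 _)); have := L0; nra.
Qed.

Lemma ccos_real_ge (w : C) (t : R) : L%:C * ccos w = t%:C -> L <= `|t| ->
  sin (Re w) = 0.
Proof.
move=> h tL; have [ss ct] := ccos_real h.
have [|s0] := eqVneq (sin (Re w)) 0; first by [].
move/eqP: ss; rewrite mulf_eq0 (negPf s0)/= => /eqP/sinh_eq0 v0.
apply: cos1sin0; apply/eqP; rewrite eq_le cos_max/=.
move: tL; rewrite -ct v0 cosh0 mulr1 normrM (gtr0_norm L0); have := L0; nra.
Qed.

Lemma ccos_real_gt (w : C) (t : R) : L%:C * ccos w = t%:C -> L < `|t| ->
  Im w <> 0.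
Proof.
move=> /ccos_real[_ ct] tL v0; move: tL.
rewrite -ct v0 cosh0 mulr1 normrM (gtr0_norm L0); have := cos_max (Re w); have := L0; nra.
Qed.

(** The branch of [arccos (D / L)] that vanishes at [a] and has positive imaginary part
    on the quadrant.  It is continuous on the whole plane, but only its values on the
    closed quadrant are meaningful. *)
Record normalized_lift (f : C -> C) : Prop := NormalizedLift {
  lift_cts : continuous f;
  lift_cos : forall z, closed_quadrant z -> L%:C * ccos (f z) = ceval D z;
  lift_a : f a%:C = 0;
  lift_upper : forall z, first_quadrant z -> 0 < Im (f z) }.

(** A real value of the branch would make [D] real with [`|D| <= L]. *)
Lemma lift_Im_neq0 (f : C -> C) (z : C) :
    (forall z, closed_quadrant z -> L%:C * ccos (f z) = ceval D z) ->
  first_quadrant z -> Im (f z) <> 0.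
Proof.
move=> fE zq v0; apply: (deviation_quadrant ext zq (s := L * cos (Re (f z)))).
  by rewrite normrM gtr0_norm// ler_piMr ?cos_max// ltW.
rewrite -fE; last exact: first_quadrant_closed.
rewrite ccosE v0 cosh0 sinh0 mulr0 oppr0 mulr1.
by rewrite -[cos _ +i* 0]/((cos _)%:C) -rmorphM.
Qed.

Lemma segment_quadrant (z w : C) (t : R) : first_quadrant z -> first_quadrant w ->
  0 <= t <= 1 -> first_quadrant (z + t%:C * (w - z)).
Proof.
case: z w => [p q] [p' q'] [/= p0 q0] [/= p0' q0'] /andP[t0 t1]; split => /=; nra.
Qed.

(** Arccosines are determined up to sign and a multiple of [2 pi].  The multiple is
    fixed at [a], where [D = L]; the sign is the same on the whole quadrant, since the
    imaginary part does not vanish there. *)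
Lemma normalized_lift_exists : exists f, normalized_lift f.
Proof.
have [f0 [cf0 hf0]] := arccosine_lift.
have aq : closed_quadrant a%:C by split => //=; rewrite ltW// (ext_a0 ext).
pose c := Re (f0 a%:C).
have Da : D.[a] = L by rewrite -(ext_first ext) (ext_val ext)// mul1r.
have fa : L%:C * ccos (f0 a%:C) = L%:C by rewrite hf0// ceval_real Da.
have va : Im (f0 a%:C) = 0 by apply: (ccos_real_le fa); rewrite gtr0_norm.
have [cc sc] : cos c = 1 /\ sin c = 0.
  split; last by apply: (ccos_real_ge fa); rewrite gtr0_norm.
  have [_] := ccos_real fa; rewrite va cosh0 -/c.
  by rewrite mulr1 => h; apply: (mulfI (lt0r_neq0 L0)); rewrite h mulr1.
pose f1 z := f0 z - c%:C.
have cf1 : continuous f1 by move=> z; apply: ctsB; [exact: cf0|exact: cts_cst].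
have hf1 z : closed_quadrant z -> L%:C * ccos (f1 z) = ceval D z.
  by move=> zq; rewrite /f1 ccosB_period//; exact: hf0.
have fa1 : f1 a%:C = 0.
  by apply/eqP; rewrite subr_eq0 eq_complex /= va !eqxx.
have same z w : first_quadrant z -> first_quadrant w ->
    0 < Im (f1 z) -> 0 < Im (f1 w).
  move=> zq wq vz; rewrite ltNge; apply/negP => vw.
  pose h (t : R) := Im (f1 (z + t%:C * (w - z))).
  have ch : {within `[0, 1], continuous h}.
    apply: continuous_subspaceT => t; apply: cts_Im.
    apply: (@cts_comp _ _ _ (fun t : R => z + t%:C * (w - z) : C) f1); last exact: cf1.
    apply: ctsD; first exact: cts_cst.
    by apply: ctsM; [apply: cts_real_complex; exact: cts_id|exact: cts_cst].
  have h0 : h 0 = Im (f1 z) by rewrite /h mul0r addr0.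
  have h1 : h 1 = Im (f1 w) by rewrite /h mul1r addrC subrK.
  have [|t] := @IVT R h 0 1 0 ler01 ch.
    by rewrite h0 h1 ge_min le_max vw (ltW vz) orbT.
  rewrite in_itv /= => t01; apply: lift_Im_neq0 => //; exact: segment_quadrant.
have iq : first_quadrant (1 +i* 1 : C) by split.
have [vi|vi|vi] := ltgtP (Im (f1 (1 +i* 1))) 0; last by case: (lift_Im_neq0 hf1 iq).
- exists (fun z => - f1 z); split.
  + by move=> z; apply: ctsN; exact: cf1.
  + by move=> z zq; rewrite ccosN hf1.
  + by rewrite fa1 oppr0.
  + move=> z zq; rewrite -(sub0r (f1 z)) ImB sub0r oppr_gt0 ltNge; apply/negP.
    rewrite le_eqVlt => /orP[/eqP/esym|vz]; first exact: lift_Im_neq0.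
    by have := same _ _ zq iq vz; rewrite ltNge ltW.
- by exists f1; split => // z zq; exact: same vi.
Qed.

End ArccosineLift.

(** * Boundary values *)

Section BoundaryValues.
Context {R : realType}.
Local Notation C := (R[i]^o).
Local Notation Re := (@complex.Re R).
Local Notation Im := (@complex.Im R).
Local Notation normc := (@Normc.normc R).

Variables (m : nat) (a L : R) (P : {poly R}) (x : nat -> R).
Hypothesis ext : extremal m a L P x.
Let D := P - 'X.
Let L0 : 0 < L := ext_L ext.
Variable f : C -> C.
Hypothesis hf : normalized_lift a L P f.

(** The imaginary part of [L cos f = D]; on the imaginary axis it is the functional
    equation of the curve. *)
Lemma lift_sin (z : C) : closed_quadrant z ->
  L * sin (Re (f z)) * sinh (Im (f z)) = - Im (ceval D z).
Proof. by move=> zq; rewrite -(lift_cos hf zq) ccosE /=; ring. Qed.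

Lemma cts_near (g : C -> R) (z : C) (P' : R -> Prop) : continuous_at z g ->
    (\forall s \near g z, P' s) -> exists2 e : R, 0 < e & forall w, normc (w - z) < e -> P' (g w).
Proof. by move=> cg /cg /nbhs_complexP[e e0 he]; exists e. Qed.

Lemma cts_lift (z : C) : continuous_at z f.
Proof. exact: (lift_cts hf). Qed.

Lemma cts_Re_lift (z : C) : continuous_at z (fun w => Re (f w)).
Proof. by apply: cts_Re; exact: cts_lift. Qed.

Lemma cts_Im_lift (z : C) : continuous_at z (fun w => Im (f w)).
Proof. by apply: cts_Im; exact: cts_lift. Qed.

Lemma real_axis_continuous (A : set R) : {within A, continuous (fun t : R => Re (f t%:C))}.
Proof.
apply: continuous_subspaceT => t.
apply: (@cts_comp _ _ _ (fun t : R => t%:C : C) (fun w => Re (f w))); last exact: cts_Re_lift.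
by apply: cts_real_complex; exact: cts_id.
Qed.

Lemma imaginary_axis_continuous (t : R) : continuous_at t (fun y : R => f (0 +i* y)).
Proof.
apply: (@cts_comp _ _ _ (fun t : R => 0 +i* t : C) f); last exact: cts_lift.
by apply: cts_complex; [exact: cvg_cst|exact: cts_id].
Qed.

Lemma lift_Im_ge0 (z : C) : closed_quadrant z -> 0 <= Im (f z).
Proof.
move=> zq; rewrite leNgt; apply/negP => vz.
have [e e0 he] := @cts_near (fun w => Im (f w)) z (fun s => s < 0) (@cts_Im_lift z) (lt_nbhsl vz).
have [w wq /he] := first_quadrant_near zq e0.
by rewrite ltNge ltW// (lift_upper hf).
Qed.

Lemma real_axis_quadrant (t : R) : 0 <= t -> closed_quadrant (t%:C : C).
Proof. by split. Qed.

Lemma imaginary_axis_quadrant (y : R) : 0 <= y -> closed_quadrant (0 +i* y : C).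
Proof. by split. Qed.

Lemma lift_real (t : R) : 0 <= t -> L%:C * ccos (f t%:C) = (D.[t])%:C.
Proof. by move=> t0; rewrite -ceval_real; apply: (lift_cos hf); exact: real_axis_quadrant. Qed.

Lemma lift_real_gt (t : R) : 0 <= t -> L < `|D.[t]| -> 0 < Im (f t%:C).
Proof.
move=> t0 tL; rewrite lt_def lift_Im_ge0 ?andbT; last exact: real_axis_quadrant.
by apply/eqP; apply: (ccos_real_gt ext (lift_real t0) tL).
Qed.

(** On this segment [D >= L], hence [sin (Re f) = 0], and [f a = 0]. *)
Lemma lift_left (t : R) : 0 <= t <= a -> Re (f t%:C) = 0.
Proof.
move=> /andP[t0 ta]; have fa : Re (f a%:C) = 0 by rewrite (lift_a hf).
rewrite -fa; apply/esym.
apply: (@sin0_constant _ (fun t : R => Re (f t%:C)) t a ta (@real_axis_continuous _)).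
move=> s /andP[ts sa]; have s0 : 0 <= s by exact: le_trans ts.
move: sa; rewrite le_eqVlt => /orP[/eqP ->|sa]; first by rewrite fa sin0.
apply: (ccos_real_ge ext (lift_real s0)).
by rewrite (le_trans (ltW (deviation_left ext s0 sa)))// ler_norm.
Qed.

Lemma lift_left_gt (t : R) : 0 <= t < a -> 0 < Im (f t%:C).
Proof.
move=> /andP[t0 ta]; apply: lift_real_gt => //.
by rewrite (lt_le_trans (deviation_left ext t0 ta))// ler_norm.
Qed.

Lemma lift_middle (t : R) : a <= t <= 1 -> Im (f t%:C) = 0.
Proof.
move=> tin; have t0 : 0 <= t by case/andP: tin => at_ _; rewrite (le_trans _ at_)// ltW// (ext_a0 ext).
by apply: (ccos_real_le ext (lift_real t0)); exact: (ext_le ext).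
Qed.

(** The imaginary part of [D] just above a real point [t] is [y D' t] to first order. *)
Lemma deviation_Im_near_axis (t : R) (s : R) : s * D^`().[t] < 0 ->
  exists2 e : R, 0 < e & forall y, 0 < y < e -> s * Im (ceval D (t +i* y)) < 0.
Proof.
move=> sD; pose p := map_poly (real_complex R) D.
pose g (y : R) := s * Re (divided_difference p (t +i* y) t%:C).
have g0 : g 0 < 0.
  by rewrite /g divided_difference_diag /p deriv_map horner_map.
have cg : continuous_at 0 g.
  apply: cvgM; first exact: cvg_cst.
  apply: cts_Re; apply: cts_divided_difference; last exact: cts_cst.
  by apply: cts_complex; [exact: cvg_cst|exact: cts_id].
have /nbhs_ballP[e /= e0 he] := cg _ (lt_nbhsl g0).
exists e => // y /andP[y0 ye].
have gy : g y < 0.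
  by apply: (he y); rewrite /ball /= sub0r normrN gtr0_norm.
have := divided_differenceE p (t +i* y) t%:C.
rewrite -[p.[t +i* y]]/(ceval D _) -[p.[t%:C]]/(ceval D _) ceval_real => E.
have {E} := congr1 Im E; rewrite ImB /= subr0.
have -> (w : C) : Im (((t +i* y) - t%:C) * w) = y * Re w by case: w => p1 q1 /=; ring.
by move=> ->; move: gy; rewrite /g; nra.
Qed.

(** Between nodes [f] is real and [sin (Re f)] does not vanish.  Its sign is that of
    [sin (Re f) sinh (Im f) = - Im D / L] just above the axis, hence opposite to the
    sign of [D']. *)
Lemma lift_sin_between (j : nat) (t : R) : (j <= m)%N -> x j < t < x j.+1 ->
  0 < (-1) ^+ j * sin (Re (f t%:C)).
Proof.
move=> jm tin; have [DtL D't] := deviation_between_nodes ext jm tin.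
have /andP[xt tx] := tin.
have t0 : 0 < t by rewrite (lt_trans _ xt)// (lt_le_trans (ext_a0 ext))// (ext_ge_a ext)// leqW.
have tin1 : a <= t <= 1.
  rewrite (le_trans _ (ltW xt))/= ?(ext_ge_a ext) ?leqW//.
  by rewrite (le_trans (ltW tx))// (ext_le_1 ext).
have v0 := lift_middle tin1.
have [_ ct] := ccos_real ext (lift_real (ltW t0)).
rewrite v0 cosh0 mulr1 in ct.
have s0 : sin (Re (f t%:C)) != 0.
  apply/eqP => /sin0cos1 c1; move: DtL.
  by rewrite -/D -ct normrM c1 mulr1 gtr0_norm// ltxx.
rewrite lt_def mulf_neq0 ?signr_eq0//= leNgt; apply/negP => neg.
have [e e0 he] := deviation_Im_near_axis D't.
have cs : continuous_at (t%:C : C) (fun w => (-1) ^+ j * sin (Re (f w))).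
  apply: cts_scale.
  by apply: (@cts_comp _ _ _ (fun w => Re (f w)) sin); [exact: cts_Re_lift|exact: continuous_sin].
have [d d0 hd] := cts_near cs (lt_nbhsl neg).
pose y := Num.min e d / 2.
have ed0 : 0 < Num.min e d by rewrite lt_min e0.
have y0 : 0 < y by rewrite divr_gt0.
have mine : Num.min e d <= e by rewrite ge_min lexx.
have mind : Num.min e d <= d by rewrite ge_min lexx orbT.
have ye : y < e by rewrite /y; lra.
have yd : y < d by rewrite /y; lra.
have wq : first_quadrant (t +i* y : C) by split.
have Dw := he y ltac:(by rewrite y0 ye).
have sw : (-1) ^+ j * sin (Re (f (t +i* y))) < 0.
  apply: hd; rewrite normcE_sqrt /= subrr subr0 expr0n add0r sqrtr_sqr.
  by rewrite gtr0_norm.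
have vw : 0 < sinh (Im (f (t +i* y))) by rewrite sinh_gt0 (lift_upper hf).
have := lift_sin (first_quadrant_closed wq); move: Dw sw vw; rewrite -/D.
move: (Im (ceval D _)) (sin _) (sinh _) => A B S Dw sw vw E.
have : L * ((-1) ^+ j * B) * S < 0 by rewrite pmulr_llt0// pmulr_rlt0.
have -> : L * ((-1) ^+ j * B) * S = (-1) ^+ j * (L * B * S) by ring.
by rewrite E mulrN; lra.
Qed.

(** From [x j] to [x (j+1)] the path [f] starts at [j pi], keeps [(-1)^j sin] positive, and
    ends where [cos = (-1)^(j+1)]: it increases by exactly [pi]. *)
Lemma lift_nodes (j : nat) : (j <= m.+1)%N -> Re (f (x j)%:C) = j%:R * pi.
Proof.
elim: j => [_|j IH jm]; first by rewrite (ext_first ext) (lift_a hf) mul0r.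
have {}jm : (j <= m)%N by [].
have {}IH := IH (leqW jm).
have xx := ext_lt ext jm.
have cp (k : nat) : cos (k%:R * pi) = (-1) ^+ k :> R /\ sin (k%:R * pi) = 0 :> R.
  elim: k => [|k [ck sk]]; first by rewrite mul0r cos0 sin0.
  by rewrite -natr1 mulrDl mul1r cosDpi sinDpi ck sk oppr0 exprS mulN1r.
have [cj sj] := cp j.
pose g (t : R) := Re (f t%:C) - j%:R * pi.
have cosg t : cos (g t) = (-1) ^+ j * cos (Re (f t%:C)).
  by rewrite /g cosB cj sj mulr0 addr0 mulrC.
have sing t : sin (g t) = (-1) ^+ j * sin (Re (f t%:C)).
  by rewrite /g sinB cj sj mulr0 subr0 mulrC.
have cg : {within `[x j, x j.+1], continuous g}.
  move=> t; apply: cvgB; last exact: cvg_cst.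
  exact: (@real_axis_continuous `[x j, x j.+1] t).
have [_ /andP[g0 gpi]] := sin_gt0_path (ltW xx) cg ltac:(by rewrite /g IH subrr)
  ltac:(by move=> t tin; rewrite sing; exact: lift_sin_between).
have x1a : a <= x j.+1 by apply: (ext_ge_a ext).
have x11 : x j.+1 <= 1 by apply: (ext_le_1 ext).
have x10 : 0 <= x j.+1 by rewrite (le_trans _ x1a)// ltW// (ext_a0 ext).
have [_] := ccos_real ext (lift_real x10).
rewrite (lift_middle (t := x j.+1)) ?x1a// cosh0 mulr1 (ext_val ext)// => h.
have {}h : cos (Re (f (x j.+1)%:C)) = (-1) ^+ j.+1.
  by apply: (mulfI (lt0r_neq0 L0)); rewrite h mulrC.
have : g (x j.+1) = pi.
  apply: cos_inj; rewrite ?in_itv /= ?g0 ?lexx ?pi_ge0//.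
  by rewrite cosg h cospi exprS mulN1r mulrN -expr2 sqrr_sign.
by rewrite /g => /(canRL (subrK _)) ->; rewrite -natr1 mulrDl mul1r addrC.
Qed.

Lemma lift_right (t : R) : 1 <= t -> Re (f t%:C) = m.+1%:R * pi.
Proof.
move=> t1; rewrite -(lift_nodes (leqnn _)) (ext_last ext).
apply: (@sin0_constant _ (fun t : R => Re (f t%:C)) 1 t t1 (@real_axis_continuous _)).
move=> s /andP[s1 st].
have s0 : 0 <= s by exact: le_trans s1.
apply: (ccos_real_ge ext (lift_real s0)).
move: s1; rewrite le_eqVlt => /orP[/eqP <-|s1]; last by rewrite ltW// (deviation_right ext).
have <- : x m.+1 = 1 := ext_last ext.
by rewrite -/D (ext_val ext)// normrM normr_sign mul1r ler_norm.
Qed.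

Lemma lift_right_gt (t : R) : 1 < t -> 0 < Im (f t%:C).
Proof.
move=> t1; apply: lift_real_gt; first by rewrite ltW// (lt_trans _ t1).
exact: (deviation_right ext).
Qed.

Lemma lift_one : f 1 = (m.+1%:R * pi)%:C.
Proof.
have := lift_right (lexx 1); have := @lift_middle 1; rewrite lexx andbT.
have /andP[_ /ltW ->] := ext_a ext => /(_ isT).
have -> : 1%:C = 1 :> C by [].
by case: (f 1) => p q /= -> ->.
Qed.

Lemma lift_imaginary_eq (y : R) : 0 <= y ->
  L * sin (Re (f (0 +i* y))) * sinh (Im (f (0 +i* y))) = y.
Proof.
move=> y0; rewrite lift_sin; last exact: imaginary_axis_quadrant.
by rewrite (deviation_imaginary ext) opprK.
Qed.

(** The product in [lift_imaginary_eq] is positive and [Im f >= 0]. *)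
Lemma lift_imaginary_gt (y : R) : 0 < y ->
  0 < Im (f (0 +i* y)) /\ 0 < sin (Re (f (0 +i* y))).
Proof.
move=> y0; have := lift_imaginary_eq (ltW y0).
have v0 : 0 <= Im (f (0 +i* y)).
  by apply: lift_Im_ge0; apply: imaginary_axis_quadrant; exact: ltW.
have {}v0 : 0 < Im (f (0 +i* y)) \/ Im (f (0 +i* y)) = 0.
  by move: v0; rewrite le_eqVlt => /orP[/eqP <-|]; [right|left].
case: v0 => [v0|->]; last by rewrite sinh0 mulr0 => E; move: y0; rewrite -E ltxx.
have sv : 0 < sinh (Im (f (0 +i* y))) by rewrite sinh_gt0.
by move=> E; split=> //; move: y0; rewrite -{1}E pmulr_lgt0// pmulr_rgt0.
Qed.

(** [Re f] starts from [0] at the origin and its sine stays positive. *)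
Lemma lift_imaginary_Re (y : R) : 0 < y -> 0 < Re (f (0 +i* y)) < pi.
Proof.
move=> y0; have y1 : 0 <= y + 1 by lra.
have cg : {within `[0, y + 1], continuous (fun y : R => Re (f (0 +i* y)))}.
  by apply: continuous_subspaceT => t; apply: cts_Re; exact: imaginary_axis_continuous.
have [h _] := sin_gt0_path y1 cg ltac:(by apply: lift_left; rewrite lexx ltW// (ext_a0 ext))
  ltac:(by move=> t /andP[t0 _]; have [] := lift_imaginary_gt t0).
by apply: h; rewrite y0 /=; lra.
Qed.

End BoundaryValues.

(** * Growth and injectivity of the cosine, expansion of the exponential *)

Section ComplexCosine.
Context {R : realType}.
Local Notation C := (R[i]^o).
Local Notation Re := (@complex.Re R).
Local Notation Im := (@complex.Im R).
Local Notation normc := (@Normc.normc R).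

(** When every root is at distance at least [`|z| - r >= 1] from [z], the product of
    these distances is at least [`|z| - r] too, the polynomial not being constant. *)
Lemma poly_proper (p : {poly C}) (M : R) : (1 < size p)%N ->
  exists K : R, forall z, K < normc z -> M < normc p.[z].
Proof.
move=> sp; have p0 : p != 0 by rewrite -size_poly_gt0 ltnW.
have [rs srs [pE _]] := poly_roots_seq p0.
set c := lead_coef p in pE *.
have c0 : 0 < normc c by rewrite normc_gt0 lead_coef_eq0.
have rs0 : (0 < size rs)%N by rewrite -ltnS srs.
pose r := \sum_(rho <- rs) normc rho.
have r0 : 0 <= r by apply: sumr_ge0 => rho _; exact: normc_ge0.
(* r bounds every root in modulus; the bound leaves `|z| - r above 1 and `|M| / `|c|. *)
exists (r + 1 + `|M| / normc c) => z hz.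
have Mc : 0 <= `|M| / normc c by rewrite divr_ge0// ltW.
have far rho : rho \in rs -> normc z - r <= normc (z - rho).
  move=> rhors; have := le_normcD (z - rho) rho; rewrite subrK => h.
  have : normc rho <= r.
    rewrite /r (big_rem rho)//= lerDl; apply: sumr_ge0 => ? _; exact: normc_ge0.
  lra.
have X1 : 1 <= normc z - r by lra.
have X0 : 0 <= normc z - r by lra.
have big : normc z - r <= \prod_(rho <- rs) normc (z - rho).
  exact: le_trans (ler_eXnr rs0 X1) (expr_le_prod X0 far).
rewrite pE Normc.normcM normc_prod.
have : `|M| < normc c * (normc z - r).
  by rewrite mulrC -ltr_pdivrMr//; lra.
have := ler_norm M; have : normc c * (normc z - r) <= normc c * \prod_(rho <- rs) normc (z - rho).
  by rewrite ler_pM2l.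
lra.
Qed.

Lemma sinh_mono (v w : R) : v < w -> sinh v < sinh w.
Proof.
move=> vw; have h1 : expR v < expR w by rewrite ltr_expR.
have h2 : expR (- w) < expR (- v) by rewrite ltr_expR ltrN2.
by rewrite /sinh; lra.
Qed.

Lemma cos_eq1_small (t : R) : cos t = 1 -> `|t| < pi *+ 2 -> t = 0.
Proof.
move=> ct tpi; apply/eqP; rewrite -normr_le0 leNgt; apply/negP => t0.
have s0 : 0 < sin (`|t| / 2).
  by apply: sin_gt0_pi; move: tpi; rewrite mulr2n; lra.
have : cos `|t| = 1 by rewrite cos_norm.
have -> : `|t| = (`|t| / 2) *+ 2 by rewrite mulr2n; lra.
by rewrite cos_mulr2n cos2sin2 mulr2n; nra.
Qed.

(** The numbers [p = cos u cosh v] and [q = sin u sinh v] determine [v > 0], because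
    [(p / cosh v)^2 + (q / sinh v)^2 = 1] and the left-hand side decreases in [v];
    they are the coordinates on an ellipse with foci [1] and [-1].  Then [cos u] and
    [sin u] are known. *)
Lemma ccos_inj (w w' : C) : ccos w = ccos w' -> 0 < Im w -> 0 < Im w' ->
  `|Re w - Re w'| < pi *+ 2 -> w = w'.
Proof.
rewrite !ccosE => -[hA hB] v0 v0' small.
have s0 : 0 < sinh (Im w) by rewrite sinh_gt0.
have s0' : 0 < sinh (Im w') by rewrite sinh_gt0.
have {}hB : sin (Re w) * sinh (Im w) = sin (Re w') * sinh (Im w').
  by apply: oppr_inj.
have t1 := cos2Dsin2 (Re w); have t2 := cos2Dsin2 (Re w').
have c1 := cosh2Dsinh2 (Im w); have c2 := cosh2Dsinh2 (Im w').
have key (p q s c p' q' s' c' : R) : p ^+ 2 + q ^+ 2 = 1 -> p' ^+ 2 + q' ^+ 2 = 1 ->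
    c ^+ 2 = 1 + s ^+ 2 -> c' ^+ 2 = 1 + s' ^+ 2 -> p * c = p' * c' ->
    q * s = q' * s' -> 0 < s -> s < s' -> False.
  move=> h1 h2 h3 h4 h5 h6 h7 h8.
  have e1 : p ^+ 2 * (1 + s ^+ 2) = p' ^+ 2 * (1 + s' ^+ 2).
    by rewrite -h3 -h4 -!exprMn h5.
  have e2 : q ^+ 2 * s ^+ 2 = q' ^+ 2 * s' ^+ 2 by rewrite -!exprMn h6.
  have ss : s ^+ 2 < s' ^+ 2 by rewrite ltr_pXn2r ?nnegrE// ltW// (lt_trans h7).
  have s2 : 0 < s ^+ 2 by rewrite exprn_gt0.
  have q20 := sqr_ge0 q; have q20' := sqr_ge0 q'.
  move: (p ^+ 2) (q ^+ 2) (s ^+ 2) (p' ^+ 2) (q' ^+ 2) (s' ^+ 2) h1 h2 e1 e2 ss s2 q20 q20'.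
  move=> a b c0 a' b' c0' h1 h2 e1 e2 ss s2 q20 q20'.
  have f1 : a - a' = c0' - c0 by nra.
  have f2 : b < b' by lra.
  have f3 : b * c0 <= b' * c0 by rewrite ler_pM2r// ltW.
  have f4 : b' * c0 < b' * c0' by rewrite ltr_pM2l// (le_lt_trans q20).
  lra.
have vv : Im w = Im w'.
  have [h|h|//] := ltgtP (Im w) (Im w').
    by case: (key _ _ _ _ _ _ _ _ t1 t2 c1 c2 hA hB s0 (sinh_mono h)).
  by case: (key _ _ _ _ _ _ _ _ t2 t1 c2 c1 (esym hA) (esym hB) s0' (sinh_mono h)).
have cc : cos (Re w) = cos (Re w').
  by move: hA; rewrite vv; apply: mulIf; rewrite gt_eqF// cosh_gt0.
have ss : sin (Re w) = sin (Re w').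
  by move: hB; rewrite vv; apply: mulIf; rewrite gt_eqF.
have : Re w - Re w' = 0.
  apply: cos_eq1_small => //; rewrite cosB cc ss -!expr2; exact: cos2Dsin2.
by move=> /eqP; rewrite subr_eq0 => /eqP uu; case: w w' uu vv {hA hB v0 v0' small s0 s0' t1 t2 c1 c2 cc ss} => ? ? [? ?] /= -> ->.
Qed.

Lemma normc_ccos_le (w : C) : normc (ccos w) <= expR (normc w).
Proof.
have h1 : normc (ccos w) <= cosh (Im w).
  rewrite normcE_sqrt ccosE /= -[leRHS](ger0_norm (ltW (cosh_gt0 _))) -sqrtr_sqr ler_wsqrtr//.
  rewrite sqrrN [(cos _ * cosh _) ^+ 2]exprMn [(sin _ * sinh _) ^+ 2]exprMn cosh2Dsinh2.
  have := cos2Dsin2 (Re w); have := sqr_ge0 (sinh (Im w)).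
  by have := sqr_ge0 (sin (Re w)); have := sqr_ge0 (cos (Re w)); nra.
apply: (le_trans h1); apply: (@le_trans _ _ (expR `|Im w|)); last first.
  by rewrite ler_expR abs_Im_le.
have : expR (Im w) <= expR `|Im w| by rewrite ler_expR ler_norm.
have : expR (- Im w) <= expR `|Im w| by rewrite ler_expR -normrN ler_norm.
by rewrite /cosh; lra.
Qed.

Lemma cts_cexp (T : topologicalType) (t : T) (f : T -> C) :
  continuous_at t f -> continuous_at t (fun s => cexp (f s)).
Proof.
move=> ft; apply: ctsM.
  apply: cts_real_complex; apply: (@cts_comp _ _ _ (fun s => Re (f s)) (@expR R)).
    exact: cts_Re.
  exact: continuous_expR.
apply: cts_complex.
  apply: (@cts_comp _ _ _ (fun s => Im (f s)) (@cos R)); first exact: cts_Im.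
  exact: continuous_cos.
apply: (@cts_comp _ _ _ (fun s => Im (f s)) (@sin R)); first exact: cts_Im.
exact: continuous_sin.
Qed.

Lemma cts_ccos (T : topologicalType) (t : T) (f : T -> C) :
  continuous_at t f -> continuous_at t (fun s => ccos (f s)).
Proof.
move=> ft; have fi := ctsM (@cts_cst _ T t (0 +i* 1)) ft.
exact: (ctsM (ctsD (cts_cexp fi) (cts_cexp (ctsN fi))) (@cts_cst _ T t 2^-1)).
Qed.

Lemma derive_approx (f : R -> R) (df e : R) : is_derive (0 : R) (1 : R) f df -> 0 < e ->
  exists2 d, 0 < d & forall y, `|y| < d -> `|f y - f 0 - df * y| <= e * `|y|.
Proof.
move=> [fd <-] e0.
have : h^-1 *: (f (h *: 1 + 0) - f 0) @[h --> 0^'] --> 'D_1 f 0 by exact: fd.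
move/cvgrPdist_le => /(_ e e0) /nbhs_ballP[d /= d0 hd].
exists d => // y yd; have [->|y0] := eqVneq y 0.
  by rewrite mulr0 subrr subr0 normr0 mulr0.
have := hd y; rewrite /ball /= sub0r normrN => /(_ yd y0).
rewrite addr0 /GRing.scale /= mulr1 => h.
have -> : f y - f 0 - 'D_1 f 0 * y = - (('D_1 f 0 - y^-1 * (f y - f 0)) * y).
  by field.
by rewrite normrN normrM ler_wpM2r.
Qed.

(** Differentiability of [cexp] at the origin, with an explicit remainder, from the
    derivatives of [expR], [cos] and [sin]. *)
Lemma cexp_sub1 (e : R) : 0 < e -> exists2 d, 0 < d &
  forall h : C, normc h < d -> normc (cexp h - 1 - h) <= e * normc h.
Proof.
move=> e0.
have [e' [e'0 e'e e'1]] : exists e' : R, [/\ 0 < e', e' <= e / 8 & e' <= 1].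
  exists (Num.min (e / 8) 1); split; first by rewrite lt_min divr_gt0//=.
    by rewrite ge_min lexx.
  by rewrite ge_min lexx orbT.
have [d1 d10 h1] := @derive_approx (@expR R) (expR 0) e' (is_derive_expR 0) e'0.
have [d2 d20 h2] := @derive_approx (@cos R) (- sin 0) e' (is_derive_cos 0) e'0.
have [d3 d30 h3] := @derive_approx (@sin R) (cos 0) e' (is_derive_sin 0) e'0.
pose d := Num.min (Num.min d1 d2) (Num.min d3 (Num.min (1 / 4) e')).
exists d; first by rewrite !lt_min d10 d20 d30 e'0 divr_gt0//=.
move=> h; rewrite !lt_min => /andP[/andP[hd1 hd2] /andP[hd3 /andP[hd4 hd5]]].
have := abs_Re_le h; have := abs_Im_le h.
move=> yn xn.
have {}h1 := h1 (Re h) (le_lt_trans xn hd1).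
have {}h2 := h2 (Im h) (le_lt_trans yn hd2).
have {}h3 := h3 (Im h) (le_lt_trans yn hd3).
rewrite expR0 mul1r in h1; rewrite sin0 cos0 oppr0 mul0r subr0 in h2.
rewrite cos0 sin0 mul1r subr0 in h3.
apply: (le_trans (normc_le _)); rewrite cexpE /cis.
have -> : (expR (Re h))%:C * (cos (Im h) +i* sin (Im h)) - 1 - h =
   (expR (Re h) * cos (Im h) - 1 - Re h) +i* (expR (Re h) * sin (Im h) - Im h) :> C.
  case: h {yn xn h1 h2 h3 hd1 hd2 hd3 hd4 hd5} => p q /=.
  by apply/eqP; rewrite eq_complex /=; apply/andP; split; apply/eqP; ring.
rewrite /=.
move: (Re h) (Im h) (normc h) (normc_ge0 h) xn yn h1 h2 h3 hd4 hd5 => p q n n0 pn qn h1 h2 h3 n4 ne'.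
have E1 : `|expR p - 1| <= 2 * n.
  have -> : expR p - 1 = (expR p - 1 - p) + p by ring.
  rewrite (le_trans (ler_normD _ _))//.
  have := ler_pM (ltW e'0) (normr_ge0 p) e'1 pn; rewrite mul1r; lra.
have E2 : expR p <= 2.
  by have := ler_norm (expR p - 1); lra.
have E0 := expR_gt0 p.
have en : e' * `|p| <= e' * n by rewrite ler_pM2l.
have en' : e' * `|q| <= e' * n by rewrite ler_pM2l.
have F1 : `|expR p * cos q - 1 - p| <= 3 * (e' * n).
  have -> : expR p * cos q - 1 - p = (expR p - 1 - p) + expR p * (cos q - 1) by ring.
  rewrite (le_trans (ler_normD _ _))// normrM (gtr0_norm E0).
  have := ler_pM (ltW E0) (normr_ge0 _) E2 (le_trans h2 en'); lra.
have F2 : `|expR p * sin q - q| <= 4 * (e' * n).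
  have -> : expR p * sin q - q = expR p * (sin q - q) + (expR p - 1) * q by ring.
  rewrite (le_trans (ler_normD _ _))// !normrM (gtr0_norm E0).
  have := ler_pM (ltW E0) (normr_ge0 _) E2 (le_trans h3 en').
  have := ler_pM (normr_ge0 _) (normr_ge0 _) E1 qn.
  by nra.
by nra.
Qed.

End ComplexCosine.

(** * Complex differentiability *)

Section Derivability.
Context {R : realType}.
Local Notation C := (R[i]^o).
Local Notation Re := (@complex.Re R).
Local Notation Im := (@complex.Im R).
Local Notation normc := (@Normc.normc R).

(** The difference quotient of [cexp] at [0], completed by its limit. *)
Definition exp_slope (h : C) : C := if h == 0 then 1 else (cexp h - 1) / h.

Lemma exp_slopeE (h : C) : cexp h - 1 = h * exp_slope h.
Proof.
rewrite /exp_slope; case: eqVneq => [->|h0]; last by rewrite mulrC divfK.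
by rewrite cexp0 subrr mul0r.
Qed.

Lemma cts_exp_slope : continuous_at (0 : C) exp_slope.
Proof.
move=> A; rewrite /exp_slope eqxx => /nbhs_complexP[e e0 eA].
have [d d0 hd] := @cexp_sub1 R (e / 2) (divr_gt0 e0 (ltr0Sn _ _)).
apply/nbhs_complexP; exists d => // h; rewrite subr0 => hlt; apply: eA.
case: eqVneq => [_|h0]; first by rewrite subrr Normc.normc0.
have nh : 0 < normc h by rewrite normc_gt0.
have -> : (cexp h - 1) / h - 1 = (cexp h - 1 - h) / h by rewrite [RHS]mulrBl divff.
rewrite Normc.normcM Normc.normcV ltr_pdivrMr// (le_lt_trans (hd h hlt))//.
by rewrite ltr_pM2r//; lra.
Qed.

(** Caratheodory's form of differentiability, with [k w0] the derivative.  It is not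
    zero off the real axis, where [cexp (i w0)] and [cexp (- i w0)] have different moduli. *)
Lemma ccos_slope (w0 : C) : 0 < Im w0 -> exists k : C -> C,
  [/\ continuous_at w0 k, k w0 != 0 &
      forall w, ccos w - ccos w0 = (w - w0) * k w].
Proof.
move=> v0; pose j : C := 0 +i* 1.
pose k w := (cexp (j * w0) * (j * exp_slope (j * (w - w0)))
             - cexp (- (j * w0)) * (j * exp_slope (- (j * (w - w0))))) / 2.
exists k; split.
- have ch : continuous_at w0 (fun w => j * (w - w0) : C).
    by apply: ctsM; [exact: cts_cst|apply: ctsB; [exact: cts_id|exact: cts_cst]].
  apply: ctsM; last exact: cts_cst.
  apply: ctsB; (apply: ctsM; first exact: cts_cst); (apply: ctsM; first exact: cts_cst).
    apply: (@cts_comp _ _ _ (fun w => j * (w - w0) : C) exp_slope) => //.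
    by rewrite subrr mulr0; exact: cts_exp_slope.
  apply: (@cts_comp _ _ _ (fun w => - (j * (w - w0)) : C) exp_slope); first exact: ctsN.
  by rewrite subrr mulr0 oppr0; exact: cts_exp_slope.
- rewrite /k subrr mulr0 oppr0 /exp_slope eqxx mulr1 -mulrBl.
  have j0 : j != 0 by rewrite eq_complex /= oner_eq0 andbF.
  rewrite !mulf_neq0// ?invr_eq0 ?pnatr_eq0// subr_eq0; apply/eqP => E.
  have : normc (cexp (j * w0)) = normc (cexp (- (j * w0))) by rewrite E.
  have nexp (z : C) : normc (cexp z) = expR (Re z).
    rewrite cexpE Normc.normcM !normcE_sqrt /= expr0n addr0 sqrtr_sqr.
    by rewrite cos2Dsin2 sqrtr1 mulr1 gtr0_norm// expR_gt0.
  have Rej : Re (j * w0) = - Im w0 by case: (w0) => p q /=; ring.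
  have Rejn : Re (- (j * w0)) = Im w0 by case: (w0) => p q /=; ring.
  by rewrite !nexp Rej Rejn => /expR_inj; lra.
- move=> w; have [h hE] : exists h : C, h = j * (w - w0) by exists (j * (w - w0)).
  have E1 : cexp (j * w) = cexp (j * w0) * cexp h by rewrite -cexpD hE -mulrDr addrC subrK.
  have E2 : cexp (- (j * w)) = cexp (- (j * w0)) * cexp (- h).
    by rewrite -cexpD hE -opprD -mulrDr addrC subrK.
  rewrite /ccos -/j E1 E2 /k -hE.
  have -> : cexp h = 1 + h * exp_slope h by rewrite -exp_slopeE addrC subrK.
  have -> : cexp (- h) = 1 - h * exp_slope (- h).
    by rewrite -mulNr -exp_slopeE addrC subrK.
  rewrite -mulrBl mulrA; congr (_ / _).
  rewrite [RHS]mulrBr; move: (exp_slope h) (exp_slope (- h)) => S1 S2.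
  have -> : h = (w - w0) * j by rewrite mulrC.
  by move: (w - w0) (cexp (j * w0)) (cexp (- (j * w0))) => u A B; ring.
Qed.

(** By [divided_differenceE] and [ccos_slope], the increment of [l cos f = p] is both
    [(w - z) d] and [l (f w - f z) k], with [d] and [k] continuous.  Dividing gives the
    difference quotient of [f] as a continuous function. *)
Lemma arccosine_derivable (p : {poly C}) (f : C -> C) (l z : C) (e : R) :
    l != 0 -> 0 < e -> (forall w, normc (w - z) < e -> l * ccos (f w) = p.[w]) ->
    continuous_at z f -> 0 < Im (f z) ->
  derivable f z 1.
Proof.
move=> l0 e0 hf cf vz; have [k [ck k0 hk]] := ccos_slope vz.
have ckf : continuous_at z (fun w => k (f w)) by exact: cts_comp cf ck.
pose q w := divided_difference p w z / (l * k (f w)).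
have cq : continuous_at z q.
  apply: ctsM; first by apply: cts_divided_difference; [exact: cts_id|exact: cts_cst].
  by apply: ctsV; [rewrite mulf_neq0|apply: ctsM => //; exact: cts_cst].
have [d d0 hd] : exists2 d : R, 0 < d & forall w, normc (w - z) < d -> k (f w) != 0.
  have : nbhs (k (f z)) [set w : C | w != 0].
    apply/nbhs_complexP; exists (normc (k (f z))); first by rewrite normc_gt0.
    by move=> w; apply: contraTneq => ->; rewrite sub0r normcN ltxx.
  by move=> /ckf /nbhs_complexP[d d0 hd]; exists d.
have quot h : h != 0 -> normc h < e -> normc h < d ->
    h^-1 *: (f (h *: 1 + z) - f z) = q (h + z).
  move=> h0 he hd'; rewrite /GRing.scale /= mulr1.
  have hz : h + z - z = h by rewrite addrK.
  have kn : k (f (h + z)) != 0 by apply: hd; rewrite hz.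
  have E := divided_differenceE p (h + z) z.
  rewrite -!hf ?hz ?subrr ?Normc.normc0// -mulrBr hk in E.
  rewrite /q; apply: (mulfI h0); rewrite !mulrA mulfV// mul1r -E.
  by rewrite [_ * k _]mulrC mulrA mulrAC divff ?mul1r// mulf_neq0.
apply/cvg_ex; exists (q z) => A /cq /nbhs_complexP[r r0 hr].
apply/nbhs_complexP; exists (Num.min r (Num.min e d)); first by rewrite !lt_min r0 e0.
move=> h; rewrite subr0 !lt_min => /and3P[h1 h2 h3] h0 /=.
by rewrite quot//; apply: hr; rewrite addrK.
Qed.

End Derivability.

(** * Openness, properness and the half-strip *)

Section ConformalMap.
Context {R : realType}.
Local Notation C := (R[i]^o).
Local Notation Re := (@complex.Re R).
Local Notation Im := (@complex.Im R).
Local Notation normc := (@Normc.normc R).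

Variables (m : nat) (a L : R) (P : {poly R}) (x : nat -> R).
Hypothesis ext : extremal m a L P x.
Let D := P - 'X.
Let p := map_poly (real_complex R) D.
Let L0 : 0 < L := ext_L ext.
Variable f : C -> C.
Hypothesis hf : normalized_lift a L P f.
Local Notation W := (m.+1%:R * pi).

Lemma LC0 : (L%:C : C) != 0.
Proof. by rewrite eq_complex /= gt_eqF. Qed.

(** [`|D|] tends to infinity, while [`|cos w| <= exp `|w|]. *)
Lemma lift_proper (M : R) : exists K : R, forall z, closed_quadrant z ->
  K < normc z -> M < normc (f z).
Proof.
have sp : (1 < size p)%N by rewrite size_map_poly (size_deviation ext).
have [K hK] := poly_proper (L * expR M) sp.
exists K => z zq /hK; rewrite -[p.[z]]/(ceval D z) -(lift_cos hf zq).
rewrite Normc.normcM normcE_sqrt /= expr0n addr0 sqrtr_sqr gtr0_norm// ltr_pM2l//.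
by move=> h; have := lt_le_trans h (normc_ccos_le (f z)); rewrite ltr_expR.
Qed.

Lemma first_quadrant_open (z : C) : first_quadrant z ->
  exists2 e : R, 0 < e & forall w, normc (w - z) < e -> first_quadrant w.
Proof.
move=> [z0 z1]; exists (Num.min (Re z) (Im z)); first by rewrite lt_min z0.
move=> w; rewrite lt_min => /andP[h1 h2].
have := le_lt_trans (abs_Re_le (w - z)) h1; have := le_lt_trans (abs_Im_le (w - z)) h2.
by rewrite ReB ImB !ltr_norml => /andP[? ?] /andP[? ?]; split; lra.
Qed.

(** Given [w] near [f z0], openness of [D] yields [z] near [z0] with [D z = L cos w], that
    is [cos (f z) = cos w]; both points being close to [f z0], they are equal by
    [ccos_inj]. *)
Lemma lift_open (z0 : C) (e : R) : first_quadrant z0 -> 0 < e ->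
  exists2 d : R, 0 < d & forall w, normc (w - f z0) < d ->
    exists z, [/\ first_quadrant z, normc (z - z0) < e & f z = w].
Proof.
move=> zq e0; have v0 : 0 < Im (f z0) by exact: (lift_upper hf).
pose n := Num.min (Im (f z0)) pi.
have n0 : 0 < n by rewrite lt_min v0 pi_gt0.
have nI : n <= Im (f z0) by rewrite ge_min lexx.
have npi : n <= pi by rewrite ge_min lexx orbT.
have close w : normc (w - f z0) < n -> 0 < Im w /\ `|Re w - Re (f z0)| < pi.
  move=> wn; have := le_lt_trans (abs_Re_le (w - f z0)) wn.
  have := le_lt_trans (abs_Im_le (w - f z0)) wn.
  by rewrite ReB ImB !ltr_norml => /andP[? ?] /andP[? ?]; split; [|apply/andP; split]; lra.
have [e1 e10 he1] := first_quadrant_open zq.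
have [e2 e20 he2] : exists2 e2 : R, 0 < e2 & forall z, normc (z - z0) < e2 -> normc (f z - f z0) < n.
  have : nbhs (f z0) [set w | normc (w - f z0) < n] by apply/nbhs_complexP; exists n.
  by move=> /(lift_cts hf) /nbhs_complexP[e2 e20 he2]; exists e2.
pose e' := Num.min e (Num.min e1 e2).
have e'0 : 0 < e' by rewrite !lt_min e0 e10.
have [d1 d10 hd1] := deviation_open ext z0 e'0.
have [d2 d20 hd2] : exists2 d2 : R, 0 < d2 & forall w, normc (w - f z0) < d2 ->
    normc (L%:C * ccos w - ceval D z0) < d1.
  have cL : continuous_at (f z0) (fun w => L%:C * ccos w : C).
    by apply: ctsM; [exact: cts_cst|apply: cts_ccos; exact: cts_id].
  rewrite -(lift_cos hf (first_quadrant_closed zq)).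
  have : nbhs (L%:C * ccos (f z0) : C) [set w : C | normc (w - L%:C * ccos (f z0)) < d1].
    by apply/nbhs_complexP; exists d1.
  by move=> /cL /nbhs_complexP[d2 d20 hd2]; exists d2.
exists (Num.min d2 n); first by rewrite lt_min d20.
move=> w; rewrite lt_min => /andP[/hd2/hd1[z + Dz] wn].
rewrite !lt_min => /and3P[ze ze1 ze2].
have zq' := he1 _ ze1.
exists z; split => //.
have [wI wR] := close _ wn; have [fI fR] := close _ (he2 _ ze2).
apply: ccos_inj => //.
  by apply: (mulfI LC0); rewrite -Dz; apply: (lift_cos hf); exact: first_quadrant_closed.
rewrite mulr2n (le_lt_trans _ (ltrD fR wR))//.
have -> : Re (f z) - Re w = (Re (f z) - Re (f z0)) - (Re w - Re (f z0)) by ring.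
exact: ler_normB.
Qed.

Lemma quadrant_cases (z : C) : closed_quadrant z ->
  [\/ first_quadrant z, exists2 y : R, 0 < y & z = 0 +i* y
    | exists2 t : R, 0 <= t & z = t%:C].
Proof.
case: z => p1 q1 [/= p0 q0]; move: q0; rewrite le_eqVlt => /orP[/eqP <-|q0].
  by constructor 3; exists p1.
move: p0; rewrite le_eqVlt => /orP[/eqP <-|p0]; last by constructor 1.
by constructor 2; exists q1.
Qed.

Lemma lift_real_axis (t : R) : 0 <= t ->
  [\/ [/\ t < a, Re (f t%:C) = 0 & 0 < Im (f t%:C)], Im (f t%:C) = 0
    | [/\ 1 < t, Re (f t%:C) = W & 0 < Im (f t%:C)]].
Proof.
move=> t0; have [ta|at_] := ltP t a.
  constructor 1; split => //; first by apply: (lift_left ext hf); rewrite t0 ltW.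
  by apply: (lift_left_gt ext hf); rewrite t0.
have [t1|t1] := ltP 1 t.
  constructor 3; split => //; first by apply: (lift_right ext hf); exact: ltW.
  exact: (lift_right_gt ext hf).
by constructor 2; apply: (lift_middle ext hf); rewrite at_.
Qed.

Lemma lift_imaginary_inj (y y' : R) : 0 <= y -> 0 <= y' ->
  f (0 +i* y) = f (0 +i* y') -> y = y'.
Proof.
move=> y0 y0' E; rewrite -(lift_imaginary_eq ext hf y0) E.
exact: (lift_imaginary_eq ext hf).
Qed.

(** Reduces coincidences of [f] to coincidences of the polynomial [D]. *)
Lemma same_value_deviation (z w : C) : closed_quadrant z -> closed_quadrant w ->
  f z = f w -> ceval D z = ceval D w.
Proof. by move=> zq wq E; rewrite -(lift_cos hf zq) -(lift_cos hf wq) E. Qed.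

Lemma W_ge_pi : (pi : R) <= W.
Proof. by rewrite ler_peMl ?pi_ge0// ler1n. Qed.

Lemma closed_quadrant_closed : closed (@closed_quadrant R).
Proof.
have -> : @closed_quadrant R = [set z : C | 0 <= Re z] `&` [set z : C | 0 <= Im z] by [].
apply: closedI.
  apply: (@closed_comp _ _ (fun z : C => Re z) [set s | 0 <= s]); last exact: closed_ge.
  by move=> z _; apply: cts_Re; exact: cts_id.
apply: (@closed_comp _ _ (fun z : C => Im z) [set s | 0 <= s]); last exact: closed_ge.
by move=> z _; apply: cts_Im; exact: cts_id.
Qed.

(** A proper map is closed.  The statement is for sets of pairs in order to cover, besides
    the image of the closed quadrant, the set of values taken twice. *)
Lemma closed_image (B : set (C * C)) : closed B ->
    (forall q, B q -> [/\ closed_quadrant q.1, closed_quadrant q.2 & f q.1 = f q.2]) ->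
  closed [set f q.1 | q in B].
Proof.
move=> cB hB w cw.
have [K hK] := lift_proper (normc w + 1).
pose box : set C := [set z | 0 <= Re z <= K /\ 0 <= Im z <= K].
pose B' := (box `*` box) `&` B.
have cB' : compact B'.
  by apply: compact_closedI => //; apply: compact_setX; exact: compact_box.
have cI : closed [set f q.1 | q in B'].
  apply: compact_closed; first exact: norm_hausdorff.
  apply: (@continuous_compact _ _ (fun q : C * C => f q.1) B'); last exact: cB'.
  apply: continuous_subspaceT => q.
  by apply: (@cts_comp _ _ _ fst f); [exact: cts_fst|exact: (lift_cts hf)].
suff [q [_ Bq] <-] : [set f q.1 | q in B'] w by exists q.
apply: cI => N wN.
have wN' : nbhs w (N `&` [set w' : C | normc (w' - w) < 1]).
  by apply: filterI => //; apply/nbhs_complexP; exists 1.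
have [_ [[q Bq <-] [Nq qw]]] := cw _ wN'.
have [q1 q2 qq] := hB _ Bq.
have fq : normc (f q.1) <= normc w + 1.
  have := le_normcD (f q.1 - w) w; rewrite subrK => h; rewrite (le_trans h)// addrC lerD2l.
  exact: ltW.
have inbox z : closed_quadrant z -> normc (f z) <= normc w + 1 -> box z.
  move=> zq fz; have zK : normc z <= K by rewrite leNgt; apply/negP => /(hK _ zq); rewrite ltNge fz.
  have [z0 z1] := zq; split; rewrite ?z0 ?z1 /=.
    by rewrite (le_trans _ zK)// (le_trans (ler_norm _))// abs_Re_le.
  by rewrite (le_trans _ zK)// (le_trans (ler_norm _))// abs_Im_le.
exists (f q.1); split => //; exists q => //; split => //.
by split; apply: inbox => //; rewrite -qq.
Qed.

Lemma image_closed_quadrant : closed (f @` (@closed_quadrant R)).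
Proof.
have -> : f @` (@closed_quadrant R) =
    [set f q.1 | q in [set q : C * C | closed_quadrant q.1 /\ q.1 - q.2 = 0]].
  apply/seteqP; split=> [_ [z zq <-]|_ [[z w] [/= zq _] <-]]; last by exists z.
  by exists (z, z) => //; split => //=; rewrite subrr.
apply: closed_image.
  apply: closedI.
    by apply: (@closed_comp _ _ fst); [move=> q _; exact: cts_fst|exact: closed_quadrant_closed].
  apply: (@closed_comp _ _ (fun q : C * C => q.1 - q.2 : C) [set 0]).
    by move=> q _; apply: ctsB; [exact: cts_fst|exact: cts_snd].
  exact: (compact_closed (@norm_hausdorff _ _) (@compact_set1 _ 0)).
by move=> [z w] [/= zq /subr0_eq <-].
Qed.

Lemma image_open : open (f @` first_quadrant).
Proof.
rewrite openE => _ [z zq <-]; apply/nbhs_complexP.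
have [d d0 hd] := lift_open zq ltr01.
by exists d => // w /hd[z' [zq' _ <-]]; exists z'.
Qed.

(** The boundary of the quadrant is sent to the real line, to the sides of the half-strip
    or to the curve, hence outside [H].  If
    [H] met the image of [Q], it would be contained in it by connectedness, and the
    points [w - k s], at which [cos] has the same value, would be images of infinitely
    many solutions of [D z = L cos w]. *)
Lemma image_half_plane (H : set C) :
    connected H -> (forall w, H w -> 0 < Im w) ->
    (forall w, H w -> Re w < 0 \/ W < Re w) ->
    (exists s : R, s != 0 /\ exists w, forall k, H (w - (k%:R * s)%:C)
       /\ ccos (w - (k%:R * s)%:C) = ccos w) ->
  forall z, first_quadrant z -> ~ H (f z).
Proof.
move=> cH HIm HRe [s [s0 [w hw]]] z zq Hz.
(* A point of the closed quadrant mapped into H is interior. *)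
have out t : closed_quadrant t -> H (f t) -> first_quadrant t.
  move=> tq Ht; have v0 := HIm _ Ht.
  have [//|[y y0 E]|[r r0 E]] := quadrant_cases tq; rewrite E in Ht v0.
    have /andP[u0 u1] := lift_imaginary_Re ext hf y0.
    by case: (HRe _ Ht) => ?; have := W_ge_pi; lra.
  have W0 : (0 : R) < W by rewrite mulr_gt0// pi_gt0.
  by case: (lift_real_axis r0) => [[_ h _]|h|[_ h _]]; case: (HRe _ Ht); lra.
have sub : H `<=` f @` first_quadrant.
  apply: (connected_clopen_sub cH image_open image_closed_quadrant).
    apply/seteqP; split=> [b [Hb [t tq E]]|b [Hb [t tq E]]].
      by split=> //; exists t => //; exact: first_quadrant_closed.
    by split=> //; exists t => //; apply: out => //; rewrite E.
  by exists (f z); split => //; exists z.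
have /choice[g hg] : forall k, exists t, first_quadrant t /\ f t = w - (k%:R * s)%:C.
  by move=> k; have [/sub[t tq ft] _] := hw k; exists t.
pose q : {poly C} := (L%:C * ccos w : C)%:P - p.
have q0 : q != 0.
  rewrite /q -size_poly_gt0 addrC size_polyDl size_polyN.
    by rewrite size_map_poly ltnW// (size_deviation ext).
  by rewrite size_map_poly (leq_ltn_trans (size_polyC_leq1 _))// (size_deviation ext).
have := max_poly_roots (rs := [seq g k | k <- iota 0 (size q)]) q0.
rewrite size_map size_iota ltnn => h; apply: notF; apply: h.
  apply/allP => _ /mapP[k _ ->]; have [kq fk] := hg k.
  rewrite rootE hornerD hornerN hornerC subr_eq0; apply/eqP.
  have [_ <-] := hw k; rewrite -fk; apply: (lift_cos hf); exact: first_quadrant_closed.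
rewrite map_inj_uniq ?iota_uniq// => i j E.
have [_ fi] := hg i; have [_ fj] := hg j.
have : w - (i%:R * s)%:C = w - (j%:R * s)%:C :> C by rewrite -fi -fj E.
move=> /addrI/oppr_inj/(@complexI R)/(mulIf s0)/eqP.
by rewrite eqr_nat => /eqP.
Qed.

(** For [c = -1] and [c = 1] these are the parts of the upper half-plane on the left and
    on the right of the half-strip. *)
Lemma half_plane_convex (c d : R) :
  connected [set w : C | 0 < c * Re w + d /\ 0 < Im w].
Proof.
apply: convex_connected => -[p1 q1] [p2 q2] t [/= h1 h2] [/= h3 h4] /andP[t0 t1].
have conv (A B : R) : 0 < A -> 0 < B -> 0 < A + t * (B - A) by nra.
split => /=; last by rewrite mul0r addr0; exact: conv.
have := conv _ _ h1 h3; congr (_ < _); ring.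
Qed.

Lemma ccos_shift (w : C) (k : nat) (e : R) : e = 1 \/ e = -1 ->
  ccos (w - (k%:R * (e * (pi *+ 2)))%:C) = ccos w.
Proof.
have per j : cos (j%:R * (pi *+ 2)) = 1 :> R /\ sin (j%:R * (pi *+ 2)) = 0 :> R.
  elim: j => [|j [cj sj]]; first by rewrite mul0r cos0 sin0.
  by rewrite -natr1 mulrDl mul1r cosD2pi sinD2pi.
have [ck sk] := per k.
move=> [->|->]; first by rewrite mul1r ccosB_period.
by rewrite mulrCA mulN1r ccosB_period// ?cosN// sinN sk oppr0.
Qed.

(** By [image_half_plane] the image lies between the closed sides, and an open image
    cannot touch them. *)
Lemma lift_half_strip (z : C) : first_quadrant z -> half_strip m (f z).
Proof.
move=> zq; have p0 := @pi_gt0 R.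
have left z' : first_quadrant z' -> 0 <= Re (f z').
  move=> z'q; rewrite leNgt; apply/negP => neg.
  pose H := [set w : C | 0 < -1 * Re w + 0 /\ 0 < Im w].
  suff nH : ~ H (f z') by apply: nH; split; [lra|exact: (lift_upper hf)].
  apply: (@image_half_plane H (@half_plane_convex (-1) 0) _ _ _ z' z'q).
  - by move=> w [].
  - by move=> w [h _]; left; lra.
  - exists (1 * (pi *+ 2)); split; first by rewrite mul1r mulrn_eq0/= gt_eqF.
    exists (-1 +i* 1) => k; split; last by apply: ccos_shift; left.
    split => /=; last lra.
    have : 0 <= k%:R * (1 * pi *+ 2) :> R by rewrite mul1r mulr_ge0// mulrn_wge0// ltW.
    lra.
have right z' : first_quadrant z' -> Re (f z') <= W.
  move=> z'q; rewrite leNgt; apply/negP => big.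
  pose H := [set w : C | 0 < 1 * Re w + - W /\ 0 < Im w].
  suff nH : ~ H (f z') by apply: nH; split; [lra|exact: (lift_upper hf)].
  apply: (@image_half_plane H (@half_plane_convex 1 (- W)) _ _ _ z' z'q).
  - by move=> w [].
  - by move=> w [h _]; right; lra.
  - exists (-1 * (pi *+ 2)); split; first by rewrite mulN1r oppr_eq0 mulrn_eq0/= gt_eqF.
    exists ((W + 1) +i* 1) => k; split; last by apply: ccos_shift; right.
    split => /=; last lra.
    have : 0 <= k%:R * (pi *+ 2) :> R by rewrite mulr_ge0// mulrn_wge0// ltW.
    lra.
have [d d0 hd] := lift_open zq ltr01.
split; last exact: (lift_upper hf).
apply/andP; split; rewrite lt_neqAle ?left ?right// andbT; apply/eqP => E.
  have [|z' [z'q _ fz']] := hd (f z - (d / 2)%:C).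
    rewrite addrAC subrr add0r normcN normcE_sqrt /= expr0n addr0 sqrtr_sqr.
    by rewrite gtr0_norm; lra.
  by have := left _ z'q; rewrite fz' ReB -E /=; lra.
have [|z' [z'q _ fz']] := hd (f z - (- d / 2)%:C).
  rewrite addrAC subrr add0r normcN normcE_sqrt /= expr0n addr0 sqrtr_sqr.
  by rewrite ltr0_norm; lra.
by have := right _ z'q; rewrite fz' ReB E /=; lra.
Qed.

(** Pairs of points of the closed quadrant with the same image, the diagonal being kept
    only where [D'] vanishes.  Unlike the set of all pairs of distinct points with the
    same image, this set is closed. *)
Definition double_point : set (C * C) :=
  [set q | [/\ closed_quadrant q.1, closed_quadrant q.2, f q.1 - f q.2 = 0
             & divided_difference p q.1 q.2 = 0]].

Lemma closed_zeros (T : topologicalType) (g : T -> C) :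
  (forall t, continuous_at t g) -> closed [set t | g t = 0].
Proof.
move=> cg; apply: (@closed_comp _ _ g [set 0]); first by move=> t _; exact: cg.
exact: (compact_closed (@norm_hausdorff _ _) (@compact_set1 _ 0)).
Qed.

Lemma double_point_closed : closed double_point.
Proof.
have -> : double_point = ([set q | closed_quadrant q.1] `&` [set q | closed_quadrant q.2]) `&`
    ([set q | f q.1 - f q.2 = 0] `&` [set q | divided_difference p q.1 q.2 = 0]).
  by apply/seteqP; split=> [q []|q [[? ?] [? ?]]].
apply: closedI; apply: closedI.
- by apply: (@closed_comp _ _ fst); [move=> q _; exact: cts_fst|exact: closed_quadrant_closed].
- by apply: (@closed_comp _ _ snd); [move=> q _; exact: cts_snd|exact: closed_quadrant_closed].
- apply: closed_zeros => q; apply: ctsB.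
    by apply: (@cts_comp _ _ _ fst f); [exact: cts_fst|exact: (lift_cts hf)].
  by apply: (@cts_comp _ _ _ snd f); [exact: cts_snd|exact: (lift_cts hf)].
- by apply: closed_zeros => q; apply: cts_divided_difference; [exact: cts_fst|exact: cts_snd].
Qed.

Lemma double_pointP (z w : C) : closed_quadrant z -> closed_quadrant w ->
  z != w -> f z = f w -> double_point (z, w).
Proof.
move=> zq wq zw E; split => //=; first by rewrite E subrr.
have := divided_differenceE p z w.
rewrite -[p.[z]]/(ceval D z) -[p.[w]]/(ceval D w) (same_value_deviation zq wq E) subrr.
by move=> /esym/eqP; rewrite mulf_eq0 subr_eq0 (negPf zw) => /eqP.
Qed.

(** A zero of [D'] in the closed quadrant is a node, where [f] is real. *)
Lemma double_point_neq (z w : C) : double_point (z, w) -> 0 < Im (f z) ->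
  [/\ closed_quadrant z, closed_quadrant w, z != w & f z = f w].
Proof.
move=> [/= zq wq /subr0_eq E dd] v0; split => //; apply/eqP => zw.
move: dd; rewrite -zw divided_difference_diag /p deriv_map => Dz.
have [j /andP[_ jm] zj] := deviation_deriv_eq0 ext (proj1 zq) Dz.
move: v0; rewrite zj (lift_middle ext hf) ?ltxx//.
by rewrite (ext_ge_a ext) ?(ext_le_1 ext)// leqW.
Qed.

Lemma double_image_closed (B : set (C * C)) : closed B ->
  closed [set f q.1 | q in double_point `&` B].
Proof.
move=> cB; apply: closed_image; first by apply: closedI => //; exact: double_point_closed.
by move=> q [[? ? /subr0_eq ? _] _].
Qed.

(** Consider the [s] in [[0, y]] for which [f (is)] is taken a second time in the closed
    quadrant.  They form a closed set, which contains [y] if the conclusion fails; let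
    [s] be its minimum.  If [s > 0], the second point can only be in the open quadrant,
    since on the imaginary axis [y] is determined by [f (iy)] and on the real axis [Re f]
    or [Im f] differs; as [f] is open there, smaller [s] would do as well.  If [s = 0],
    the second point would be real and smaller than [a], where [D] is injective. *)
Lemma imaginary_not_image (z : C) (y : R) : first_quadrant z -> 0 < y ->
  f z <> f (0 +i* y).
Proof.
move=> zq y0 E.
(* Double points whose second component lies on the imaginary axis. *)
pose B : set (C * C) := [set q | (Re q.2)%:C = 0 :> C].
have cB : closed B.
  apply: closed_zeros => q; apply: cts_real_complex; apply: cts_Re; exact: cts_snd.
have cI := double_image_closed cB.
pose Y := `[0, y] `&` [set s : R | [set f q.1 | q in double_point `&` B] (f (0 +i* s))].
have YP s : 0 <= s -> [set f q.1 | q in double_point `&` B] (f (0 +i* s)) ->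
    exists z', double_point (z', 0 +i* s).
  move=> s0 [[z' w] [zw /= Rw] fz]; have := zw => -[/= _ [w0 w1] /subr0_eq E' _].
  have wE : w = 0 +i* Im w by case: w Rw {zw w0 w1 E'} => r1 i1 /= [->].
  exists z'; rewrite (_ : 0 +i* s = w)//.
  rewrite wE; congr (_ +i* _); apply: lift_imaginary_inj => //.
  by rewrite -wE -E' -fz.
have cY : closed Y.
  apply: closedI; first exact: itv_closed.
  apply: (@closed_comp _ _ (fun s : R => f (0 +i* s))) => // s _.
  exact: (imaginary_axis_continuous hf (t := s)).
have Yy : Y y.
  split; first by rewrite /= in_itv /= lexx ltW.
  exists (z, 0 +i* y) => //; split => //=.
  apply: double_pointP => //; first exact: first_quadrant_closed.
    by split => //=; exact: ltW.
  by apply/eqP => zy; case: zq => + _; rewrite zy /= ltxx.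
have [s sY hs] : exists2 s, Y s & forall s', Y s' -> s <= s'.
  have cpY : compact Y by apply: subclosed_compact cY (@segment_compact R 0 y) _; exact: subIsetl.
  have [s sY hs] := @compact_EVT_min _ R id Y (ex_intro _ y Yy) cpY (@continuous_subspaceT _ _ Y id (fun t => @cts_id _ t)).
  by exists s; [rewrite inE in sY|move=> s' s'Y; apply: hs; rewrite inE].
have [/= sin sI] := sY; move: sin; rewrite in_itv /= => /andP[s0 sy].
have [z' zs] := YP s s0 sI.
have sq := imaginary_axis_quadrant s0.
have := zs => -[/= z'q _ /subr0_eq Ez _].
move: s0; rewrite le_eqVlt => /orP[/eqP s0|s0].
- subst s; have a0 := ext_a0 ext.
  have u0 : Re (f 0) = 0 by apply: (lift_left ext hf); rewrite lexx ltW.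
  have v0 : 0 < Im (f 0) by apply: (lift_left_gt ext hf); rewrite lexx.
  have Ez0 : f z' = f 0 := Ez.
  have [_ _ /negP ne _] := double_point_neq zs ltac:(by rewrite Ez0).
  have [q|[y' y'0 zE]|[t t0 zE]] := quadrant_cases z'q.
  + by have [/andP[h _] _] := lift_half_strip q; rewrite Ez0 u0 ltxx in h.
  + by have /andP[h _] := lift_imaginary_Re ext hf y'0; rewrite -zE Ez0 u0 ltxx in h.
  + have ft : f t%:C = f 0 by rewrite -zE.
    case: (lift_real_axis t0) => [[ta _ _]|h|[_ h _]].
    * apply: ne; rewrite zE; apply/eqP; congr (_ +i* _).
      apply: (deviation_left_inj ext); rewrite ?in_itv /= ?t0 ?lexx ?ltW//.
      have := same_value_deviation (real_axis_quadrant t0) (real_axis_quadrant (lexx 0)) ft.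
      by rewrite !ceval_real => /(@complexI R).
    * by rewrite ft in h; rewrite h ltxx in v0.
    * by rewrite ft u0 in h; have := W_ge_pi; rewrite -h leNgt pi_gt0.
have /andP[u0 u1] := lift_imaginary_Re ext hf s0.
have [v0 _] := lift_imaginary_gt ext hf s0.
have [_ _ ne _] := double_point_neq zs ltac:(by rewrite Ez).
have z'Q : first_quadrant z'.
  have [//|[y' y'0 zE]|[t t0 zE]] := quadrant_cases z'q.
    have E' : y' = s by apply: lift_imaginary_inj; rewrite ?ltW// -zE.
    by rewrite zE E' eqxx in ne.
  have W1 := W_ge_pi.
  by case: (lift_real_axis t0) => [[_ h _]|h|[_ h _]]; rewrite -zE Ez in h; lra.
have [d d0 hd] := lift_open z'Q ltr01.
have : nbhs (f z') [set w | normc (w - f z') < d] by apply/nbhs_complexP; exists d.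
rewrite Ez => /(imaginary_axis_continuous hf (t := s)) /nbhs_ballP[e /= e0 he].
pose s' := s - Num.min (e / 2) (s / 2).
have n0 : 0 < Num.min (e / 2) (s / 2) by rewrite lt_min !divr_gt0.
have n1 : Num.min (e / 2) (s / 2) <= e / 2 by rewrite ge_min lexx.
have n2 : Num.min (e / 2) (s / 2) <= s / 2 by rewrite ge_min lexx orbT.
have s's : s' < s by rewrite /s'; lra.
have s'0 : 0 < s' by rewrite /s'; lra.
have [|z'' [z''q _ fz'']] := hd (f (0 +i* s')).
  rewrite Ez; apply: he; rewrite /ball /= /s' opprB addrC subrK gtr0_norm//; lra.
have : Y s'.
  split; first by rewrite /= in_itv /= !ltW// (lt_le_trans s's).
  exists (z'', 0 +i* s'); last exact: fz''.
  split; last by rewrite /B /=.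
  apply: double_pointP; [exact: first_quadrant_closed| | |exact: fz''].
    exact/imaginary_axis_quadrant/ltW.
  by apply/eqP => zy; case: z''q => + _; rewrite zy /= ltxx.
by move=> /hs; rewrite leNgt s's.
Qed.

End ConformalMap.

(** * Injectivity and the image *)

Section Region.
Context {R : realType}.
Local Notation C := (R[i]^o).
Local Notation Re := (@complex.Re R).
Local Notation Im := (@complex.Im R).
Local Notation normc := (@Normc.normc R).

Variables (m : nat) (a L : R) (P : {poly R}) (x : nat -> R).
Hypothesis ext : extremal m a L P x.
Let D := P - 'X.
Let p := map_poly (real_complex R) D.
Let L0 : 0 < L := ext_L ext.
Variable f : C -> C.
Hypothesis hf : normalized_lift a L P f.
Local Notation W := (m.+1%:R * pi).
Local Notation gamma := (f @` (@pos_imaginary_axis R)).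

Lemma half_strip_convex (w w' : C) (t : R) : half_strip m w -> half_strip m w' ->
  0 <= t <= 1 -> half_strip m (w + t%:C * (w' - w)).
Proof.
case: w w' => [p1 q1] [p2 q2] [/= /andP[h1 h2] h3] [/= /andP[h4 h5] h6] /andP[t0 t1].
have conv (A B : R) : 0 < A -> 0 < B -> 0 < A + t * (B - A) by nra.
split => /=; last by rewrite mul0r addr0; exact: conv.
rewrite mul0r subr0; apply/andP; split; first exact: conv.
have A0 : 0 < W - p1 by lra.
have B0 : 0 < W - p2 by lra.
by have := conv _ _ A0 B0; nra.
Qed.

Lemma half_strip_connected : connected (@half_strip R m).
Proof. by apply: convex_connected => w w' t hw hw' t01; exact: half_strip_convex. Qed.

(** The values on the real axis lie on the boundary of the half-strip. *)
Lemma preimage_half_strip (z : C) : closed_quadrant z -> half_strip m (f z) ->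
  first_quadrant z \/ exists2 y, 0 < y & z = 0 +i* y.
Proof.
move=> zq [/andP[u0 u1] v0].
have [?|?|[t t0 zE]] := quadrant_cases zq; [by left|by right|].
by rewrite zE in u0 u1 v0;
  case: (lift_real_axis ext hf t0) => [[_ h _]|h|[_ h _]]; rewrite h ?ltxx in u0 u1 v0.
Qed.

(** From [1] to infinity on the real axis the branch moves along the right side, from its lower end to
    infinity. *)
Lemma right_pointP (v : R) : 0 < v ->
  exists2 t, 1 < t & f t%:C = W +i* v.
Proof.
move=> v0; have [K hK] := lift_proper ext hf (W + v).
pose T := Num.max 1 (`|K| + 1).
have T1 : 1 <= T by rewrite le_max lexx.
have TK : K < normc (T%:C : C).
  rewrite normcE_sqrt /= expr0n addr0 sqrtr_sqr ger0_norm ?(le_trans _ T1)//.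
  have := ler_norm K; have : `|K| + 1 <= T by rewrite le_max lexx orbT.
  lra.
have Tq : closed_quadrant (T%:C : C) by apply: real_axis_quadrant; rewrite (le_trans _ T1).
have fT := hK _ Tq TK.
have uT := lift_right ext hf T1.
have W0 : (0 : R) < W by rewrite mulr_gt0// pi_gt0.
have vT : v < Im (f T%:C).
  have := normc_le (f T%:C); rewrite uT (gtr0_norm W0) ger0_norm ?(lift_Im_ge0 hf)//; lra.
have cf : {within `[1, T], continuous (fun t : R => Im (f t%:C))}.
  apply: continuous_subspaceT => t.
  apply: (@cts_comp _ _ _ (fun t : R => t%:C : C) (fun w => Im (f w))); last exact: cts_Im_lift hf _.
  by apply: cts_real_complex; exact: cts_id.
have v1 : Im (f 1%:C) = 0.
  by apply: (lift_middle ext hf); rewrite lexx; have /andP[_ /ltW ->] := ext_a ext.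
have [|t] := IVT T1 cf (v := v).
  by rewrite v1 ge_min le_max (ltW v0) (ltW vT) orbT.
rewrite in_itv /= => /andP[t1 tT] ft.
exists t.
  by rewrite lt_neqAle t1 andbT; apply/eqP => t1'; move: v0; rewrite -ft -t1' v1 ltxx.
by have := lift_right ext hf t1; rewrite -ft; case: (f t%:C) => ? ? /= ->.
Qed.

Lemma half_strip_near_right (v e : R) : 0 < v -> 0 < e ->
  exists2 w : C, half_strip m w & normc (w - (W +i* v)) < e.
Proof.
move=> v0 e0; have W0 : (0 : R) < W by rewrite mulr_gt0// pi_gt0.
pose d := Num.min (e / 2) (W / 2).
have d0 : 0 < d by rewrite lt_min !divr_gt0.
have d1 : d <= e / 2 by rewrite ge_min lexx.
have d2 : d <= W / 2 by rewrite ge_min lexx orbT.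
exists ((W - d) +i* v); first by split => //=; apply/andP; split; lra.
rewrite (le_lt_trans (normc_le _))//= subrr normr0 addr0 addrAC subrr add0r normrN.
by rewrite gtr0_norm//; lra.
Qed.

(** The set [A] of values taken twice is closed.  Within the half-strip it is also open:
    neither of two points with the same image lies on the imaginary axis, by
    [imaginary_not_image], so both are in the open quadrant, where [f] is open.  If [A]
    were not empty it would contain the half-strip, hence also its boundary point
    [W + i]; but that value is taken only at real points beyond [1], where [D] is injective. *)
Lemma lift_injective (z w : C) : first_quadrant z -> first_quadrant w ->
  f z = f w -> z = w.
Proof.
move=> zq wq E; apply/eqP; apply/negPn/negP => zw.
pose A := [set f q.1 | q in double_point P f `&` setT].
have cA : closed A by apply: (double_image_closed ext hf); exact: closedT.
have zw2 : double_point P f (z, w).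
  by apply: (double_pointP hf) => //; exact: first_quadrant_closed.
have int b : half_strip m b -> A b -> A° b.
  move=> hb Ab.
  have [[z1 z2] [dz _] /= fb] := Ab.
  have v0 : 0 < Im (f z1) by rewrite fb; case: hb.
  have [z1q z2q ne ff] := double_point_neq ext hf dz v0.
  have fb2 : half_strip m (f z2) by rewrite -ff fb.
  have fb1 : half_strip m (f z1) by rewrite fb.
  have [z1Q z2Q] : first_quadrant z1 /\ first_quadrant z2.
    have [q1|[y1 y10 E1]] := preimage_half_strip z1q fb1;
      have [q2|[y2 y20 E2]] := preimage_half_strip z2q fb2; split => //.
    - by case: (imaginary_not_image ext hf q1 y20); rewrite -E2.
    - by case: (imaginary_not_image ext hf q2 y10); rewrite -E1.
    - by move/eqP: ne; case; rewrite E1 E2; congr (_ +i* _);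
        apply: (lift_imaginary_inj ext hf); rewrite ?ltW// -E1 -E2.
    - by move/eqP: ne; case; rewrite E1 E2; congr (_ +i* _);
        apply: (lift_imaginary_inj ext hf); rewrite ?ltW// -E1 -E2.
  have n0 : 0 < normc (z1 - z2) / 2 by rewrite divr_gt0// normc_gt0 subr_eq0.
  have [d1 d10 h1] := lift_open ext hf z1Q n0.
  have [d2 d20 h2] := lift_open ext hf z2Q n0.
  apply/nbhs_complexP; exists (Num.min d1 d2); first by rewrite lt_min d10.
  move=> b'; rewrite lt_min => /andP[b1 b2].
  have [|z1' [z1'q n1 f1]] := h1 b'; first by rewrite fb.
  have [|z2' [z2'q n2 f2]] := h2 b'; first by rewrite -ff fb.
  exists (z1', z2') => //; split => //.
  apply: (double_pointP hf); rewrite ?f1 ?f2//; try exact: first_quadrant_closed.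
  apply/eqP => zz; rewrite zz in n1.
  have := le_normcD (z1 - z2') (z2' - z2); rewrite addrA subrK.
  have : normc (z1 - z2') = normc (z2' - z1) by rewrite -normcN opprB.
  lra.
have sub : half_strip m `<=` A°.
  apply: (connected_clopen_sub half_strip_connected _ cA); first exact: open_interior.
    apply/seteqP; split=> [b [hb /interior_subset Ab]|b [hb Ab]]; split => //.
    exact: int.
  have fzs := lift_half_strip ext hf zq.
  by exists (f z); split => //; apply: int => //; exists (z, w).
have : A (W +i* 1).
  apply: cA => N /nbhs_complexP[e e0 eN].
  have [w' sw we] := half_strip_near_right ltr01 e0.
  by exists w'; split; [by apply: interior_subset; apply: sub|exact: eN].
move=> [[z1 z2] [dz _] /= f1].
have v0 : 0 < Im (f z1) by rewrite f1.
have [z1q z2q /eqP ne ff] := double_point_neq ext hf dz v0.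
have real z' : closed_quadrant z' -> f z' = W +i* 1 -> exists2 t, 1 < t & z' = t%:C.
  move=> z'q fz'; have W0 : (0 : R) < W by rewrite mulr_gt0// pi_gt0.
  have [q|[y y0 E']|[t t0 E']] := quadrant_cases z'q.
  - by have [/andP[_]] := lift_half_strip ext hf q; rewrite fz' /= ltxx.
  - have /andP[_] := lift_imaginary_Re ext hf y0; rewrite -E' fz' /= => h.
    by have := W_ge_pi (R := R) m; lra.
  - exists t => //; case: (lift_real_axis ext hf t0) => [[_ h _]|h|[]//]; rewrite -E' fz' /= in h; lra.
have [t1 t11 E1] := real _ z1q f1.
have [t2 t21 E2] := real _ z2q ltac:(by rewrite -ff f1).
apply: ne; rewrite E1 E2; congr (_ +i* _).
apply: (deviation_right_inj ext); rewrite ?in_itv /= ?andbT ?ltW//.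
have := same_value_deviation hf z1q z2q ff; rewrite E1 E2 !ceval_real.
by move=> /(@complexI R).
Qed.

Lemma image_sub_strip : f @` first_quadrant `<=` half_strip m `\` gamma.
Proof.
move=> _ [z zq <-]; split; first exact: (lift_half_strip ext hf).
by move=> [_ [y y0 <-] E]; exact: (imaginary_not_image ext hf zq y0 (esym E)).
Qed.

Lemma image_connected : connected (f @` first_quadrant).
Proof.
apply: connected_continuous_connected; last first.
  by apply: continuous_subspaceT => z; exact: (lift_cts hf).
by apply: convex_connected => z w t zq wq t01; exact: segment_quadrant.
Qed.

(** The image of the closed quadrant is closed and exceeds the open set [f Q] only by
    points of the curve and of the boundary of the half-strip. *)
Lemma connected_sub_image (H : set C) : connected H ->
  H `<=` half_strip m `\` gamma -> H `&` f @` first_quadrant !=set0 ->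
  H `<=` f @` first_quadrant.
Proof.
move=> cH Hs; apply: (connected_clopen_sub cH (image_open ext hf) (image_closed_quadrant ext hf)).
apply/seteqP; split=> b [Hb [z zq fz]]; split => //; exists z => //.
  exact: first_quadrant_closed.
have [sb nb] := Hs _ Hb; rewrite -fz in sb.
have [//|[y y0 zE]] := preimage_half_strip zq sb.
by case: nb; exists z => //; exists y.
Qed.

Lemma right_side_closure : right_side m `<=` closure (f @` first_quadrant).
Proof.
move=> _ [v v0 <-]; have [t t1 <-] := right_pointP v0.
move=> N /(lift_cts hf) /nbhs_complexP[e e0 he].
have [w wq we] := first_quadrant_near (real_axis_quadrant (ltW (lt_trans ltr01 t1))) e0.
by exists (f w); split; [exists w|exact: he].
Qed.

(** Keeps the curve, its initial point included, away from the right side. *)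
Lemma imaginary_axis_image_closed : closed (f @` [set z : C | closed_quadrant z /\ Re z = 0]).
Proof.
have -> : f @` [set z : C | closed_quadrant z /\ Re z = 0] =
    [set f q.1 | q in [set q : C * C | [/\ closed_quadrant q.1, (Re q.1)%:C = 0 :> C & q.1 - q.2 = 0]]].
  apply/seteqP; split=> [_ [z [zq z0] <-]|_ [[z w] [/= zq [z0] _] <-]]; last by exists z.
  by exists (z, z) => //; split; rewrite //= ?z0 ?subrr.
apply: (closed_image ext hf); last by move=> [z w] [/= zq _ /subr0_eq <-].
have -> : [set q : C * C | [/\ closed_quadrant q.1, (Re q.1)%:C = 0 :> C & q.1 - q.2 = 0]] =
    [set q | closed_quadrant q.1] `&`
    ([set q : C * C | (Re q.1)%:C = 0 :> C] `&` [set q | q.1 - q.2 = 0]).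
  by apply/seteqP; split=> [q []|q [? []]].
apply: closedI; last apply: closedI.
- by apply: (@closed_comp _ _ fst); [move=> q _; exact: cts_fst|exact: closed_quadrant_closed].
- by apply: closed_zeros => q; apply: cts_real_complex; apply: cts_Re; exact: cts_fst.
- by apply: closed_zeros => q; apply: ctsB; [exact: cts_fst|exact: cts_snd].
Qed.

(** The image of [Q] is connected, so each of its points has the whole image in its
    component, and the image abuts on the right side.  Conversely, the part [H] of the
    half-strip near a point [q] of the right side is convex and does not meet the curve;
    so it lies in the image, and any component that abuts on the right side meets [H]. *)
Lemma right_region_image : right_region m gamma = f @` first_quadrant.
Proof.
have sub := image_sub_strip.
apply/seteqP; split=> [w [ws wr]|w wq]; last first.
  split; first exact: sub.
  apply: (subset_trans right_side_closure); apply: closure_subset.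
  exact: (connected_component_max wq sub image_connected).
have p0 : (0 : R) < pi by exact: pi_gt0.
pose q : C := W +i* 1.
have qr : right_side m q by exists 1 => //=.
have [e e0 he] : exists2 e : R, 0 < e & forall b, normc (b - q) < e ->
    ~ (f @` [set z : C | closed_quadrant z /\ Re z = 0]) b.
  have : nbhs q (~` (f @` [set z : C | closed_quadrant z /\ Re z = 0])).
    apply: open_nbhs_nbhs; split; first exact/closed_openC/imaginary_axis_image_closed.
    move=> [z [zq z0] fz]; have W1 := W_ge_pi (R := R) m.
    have zE : z = 0 +i* Im z by case: z z0 {zq fz} => ? ? /= ->.
    have [_] := zq; rewrite le_eqVlt => /orP[/eqP y0|y0].
      have Re0 : Re (f 0%:C) = 0.
        by apply: (lift_left ext hf); rewrite lexx ltW// (ext_a0 ext).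
      move: Re0; rewrite (_ : 0%:C = z); last by rewrite zE -y0.
      by rewrite fz /=; lra.
    have /andP[_] := lift_imaginary_Re ext hf y0; rewrite -zE fz /=; lra.
  by move=> /nbhs_complexP[e e0 he]; exists e.
pose H := [set b : C | normc (b - q) < e] `&` half_strip m.
have cH : connected H.
  apply: convex_connected => b c t [/= bq bs] [/= cq cs] t01.
  split; last exact: half_strip_convex.
  have /andP[t0 t1] := t01.
  have E : b + t%:C * (c - b) - q = (1 - t)%:C * (b - q) + t%:C * (c - q).
    by rewrite rmorphB rmorph1 /=; ring.
  rewrite /= E (le_lt_trans (le_normcD _ _))// !Normc.normcM.
  have nr (s : R) : 0 <= s -> normc (s%:C : C) = s.
    by move=> s0; rewrite normcE_sqrt /= expr0n addr0 sqrtr_sqr ger0_norm.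
  rewrite !nr ?subr_ge0//.
  have conv (A B : R) : 0 < A -> 0 < B -> 0 < A + t * (B - A) by nra.
  have := conv (e - normc (b - q)) (e - normc (c - q)).
  by rewrite !subr_gt0 => /(_ bq cq); lra.
have Hs : H `<=` half_strip m `\` gamma.
  move=> b [/he nb bs]; split => //; apply: contra_not nb.
  by move=> [_ [y y0 <-] <-]; exists (0 +i* y) => //; split => //; split => //=; exact: ltW.
have nq : nbhs q [set b : C | normc (b - q) < e] by apply/nbhs_complexP; exists e.
have Hf : H `<=` f @` first_quadrant.
  apply: connected_sub_image => //.
  have [b [bf bq]] := right_side_closure qr nq.
  by exists b; split => //; split => //; have [] := sub _ bf.
have [b [bC bq]] := wr _ qr _ nq.
have bs : half_strip m b by have [] := connected_component_sub bC.
have Cw : connected_component (half_strip m `\` gamma) w `<=` f @` first_quadrant.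
  apply: connected_sub_image.
  - exact: component_connected.
  - exact: connected_component_sub.
  - by exists b; split => //; apply: Hf; split.
by apply: Cw; exact: connected_component_refl.
Qed.

Lemma gamma_left_bounding : left_bounding_curve m gamma.
Proof.
have W1 := W_ge_pi (R := R) m.
split.
  move=> _ [_ [y y0 <-] <-]; have /andP[u0 u1] := lift_imaginary_Re ext hf y0.
  by have [v0 _] := lift_imaginary_gt ext hf y0; split => //; apply/andP; split; lra.
exists (fun t : R => f (0 +i* t)), (Im (f 0)); split.
- by move=> t _; exact: (imaginary_axis_continuous hf).
- split.
  + by move=> t t0 /=; exists (0 +i* t) => //; exists t.
  + move=> s t; rewrite !inE /= => s0 t0; apply: (lift_imaginary_inj ext hf); exact: ltW.
  + by move=> _ [_ [y y0 <-] <-]; exists y.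
- by apply: (lift_Im_ge0 hf); split => /=.
- have f0 : f (0 +i* 0) = 0 +i* Im (f 0).
    have : Re (f 0%:C) = 0 by apply: (lift_left ext hf); rewrite lexx ltW// (ext_a0 ext).
    by rewrite -[0 +i* 0]/(0%:C : C); case: (f 0%:C) => ? ? /= ->.
  rewrite -f0; apply: cvg_at_right_filter.
  exact: (imaginary_axis_continuous hf).
- apply/cvgryPge => A; have [K hK] := lift_proper ext hf A.
  near=> t; apply/ltW/hK; first by split => //=; near: t; apply: nbhs_pinfty_ge; rewrite num_real.
  rewrite normcE_sqrt /= expr0n add0r sqrtr_sqr (lt_le_trans _ (ler_norm _))//.
  by near: t; apply: nbhs_pinfty_gt; rewrite num_real.
Unshelve. all: by end_near. Qed.

Lemma lift_derivable (z : C) : first_quadrant z -> derivable f z 1.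
Proof.
move=> zq; have [e e0 he] := first_quadrant_open zq.
apply: (@arccosine_derivable R p f L%:C z e).
- exact: (LC0 ext).
- exact: e0.
- by move=> w /he wq; apply: (lift_cos hf); exact: first_quadrant_closed.
- exact: (lift_cts hf).
- exact: (lift_upper hf).
Qed.

Lemma closure_first_quadrant : closure first_quadrant `<=` @closed_quadrant R.
Proof.
apply: (subset_trans (closure_subset (@first_quadrant_closed R))).
exact: closed_quadrant_closed.
Qed.

Lemma lift_normalized_conformal : normalized_conformal_map m a gamma f.
Proof.
split.
- split; first exact: lift_derivable.
  rewrite right_region_image; split.
  + by move=> z zq; exists z.
  + by move=> z w; rewrite !inE; exact: lift_injective.
  + by move=> _ [z zq <-]; exists z.
- by apply: continuous_subspaceT => z; exact: (lift_cts hf).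
- exact: (lift_a hf).
- exact: (lift_one ext hf).
- move=> M; have [K hK] := lift_proper ext hf M.
  by exists K => z /closure_first_quadrant zq; exact: hK.
Qed.

End Region.

Theorem theorem7p1 (R : realType) (a : R) (m : nat) (P : {poly R})
    (ha : 0 < a < 1) (hP : best_approx m a P) :
  exists (gamma : set R[i]^o) (phi : R[i]^o -> R[i]^o),
    [/\ left_bounding_curve m gamma,
        normalized_conformal_map m a gamma phi,
        forall z, first_quadrant z ->
          ceval P z = z + (L_ m a)%:C * ccos (phi z),
        gamma = phi @` pos_imaginary_axis
      & forall y : R, 0 < y ->
          L_ m a * sin (complex.Re (phi (0 +i* y)))
            * sinh (complex.Im (phi (0 +i* y))) = y].
Proof.
have [x ext] := extremal_exists ha hP.
have [f hf] := normalized_lift_exists ext.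
exists (f @` (@pos_imaginary_axis R)), f; split => //.
- exact: (gamma_left_bounding ext hf).
- exact: (lift_normalized_conformal ext hf).
- move=> z zq; rewrite (lift_cos hf (first_quadrant_closed zq)) cevalB cevalX.
  by rewrite addrC subrK.
- by move=> y y0; exact: (lift_imaginary_eq ext hf (ltW y0)).
Qed.
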